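(* Let $\mathcal{G}$ be a Hausdorff ample groupoid with compact unit space. Let $\mathfrak{A}(\mathcal{G})$ denote either $L^I(\mathcal{G})$, $F_\lambda^{p,\ast}(\mathcal{G})$, or $F_\lambda^p(\mathcal{G})$, with $p\in[1,\infty)\setminus\{2\}$. Then $C(\mathcal{G}^{(0)},\mathbb{T})$ is the connected component of the identity in $\mathbf{U}(\mathfrak{A}(\mathcal{G}))$ (norm topology), and the sequence of groups $$1\to C(\mathcal{G}^{(0)},\mathbb{T})\xrightarrow{\ \iota\ }\mathbf{U}(\mathfrak{A}(\mathcal{G}))\xrightarrow{\ \sigma\ }\mathsf{F}(\mathcal{G})\to 1$$ is split exact, where $\iota$ is the inclusion and $\sigma(\mathfrak{a})=\operatorname{supp}(\mathfrak{a})$. In particular, there are canonical group isomorphisms $$\mathbf{U}(\mathfrak{A}(\mathcal{G}))\cong C(\mathcal{G}^{(0)},\mathbb{T})\rtimes\mathsf{F}(\mathcal{G}),$$ where $B\in\mathsf{F}(\mathcal{G})$ acts on $C(\mathcal{G}^{(0)},\mathbb{T})$ by $g\mapsto g\circ\rho_B^{-1}$, and $$\Psi\colon\mathsf{F}(\mathcal{G})\to\mathbf{U}(\mathfrak{A}(\mathcal{G}))/\mathbf{U}(\mathfrak{A}(\mathcal{G}))_0,\qquad \Psi(B)=[\mathbbm{1}_B].$$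
   Context: Groupoids are locally compact topological groupoids. $\mathcal{G}^{(0)}$ is the unit space, $\mathsf{r},\mathsf{s}$ are the range and source maps; $\mathcal{G}$ is étale if $\mathsf{r},\mathsf{s}$ are local homeomorphisms. A bisection is a subset on which $\mathsf{r}$ and $\mathsf{s}$ are injective. $\mathcal{G}$ is ample if it is étale and its topology has a basis of compact open bisections. For $u\in\mathcal{G}^{(0)}$ put $\mathcal{G}_u=\mathsf{s}^{-1}(u)$, $\mathcal{G}^u=\mathsf{r}^{-1}(u)$. $C_c(\mathcal{G})$ carries the convolution $(f\ast g)(x)=\sum_{yz=x}f(y)g(z)$ and involution $f^*(x)=\overline{f(x^{-1})}$. - $L^I(\mathcal{G})$ is the completion of $C_c(\mathcal{G})$ in $\|f\|_I=\max\{\sup_u\sum_{x\in\mathcal{G}_u}|f(x)|,\ \sup_u\sum_{x\in\mathcal{G}^u}|f(x)|\}$. - $F_\lambda^p(\mathcal{G})$ (the $p$-pseudofunctions) is the completion of $C_c(\mathcal{G})$ in $\|f\|_{F^p_\lambda}=\sup_u\|\lambda_u(f)\|_{\mathcal{B}(\ell^p(\mathcal{G}_u))}$, where $(\lambda_u(f)\xi)(x)=\sum_{y\in\mathcal{G}_u}f(xy^{-1})\xi(y)$. - $F_\lambda^{p,\ast}(\mathcal{G})$ (the symmetrized $p$-pseudofunctions) is the completion of $C_c(\mathcal{G})$ in $\max\{\|f\|_{F^p_\lambda},\|f^*\|_{F^p_\lambda}\}$. In each case the inclusion $C_c(\mathcal{G})\subseteq C_0(\mathcal{G})$ extends to an injective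 contractive linear map $\mathfrak{A}(\mathcal{G})\to C_0(\mathcal{G})$, by which elements of $\mathfrak{A}(\mathcal{G})$ are regarded as functions on $\mathcal{G}$; $\operatorname{supp}(\mathfrak{a})=\{x\in\mathcal{G}:\mathfrak{a}(x)\neq0\}$. Since $\mathcal{G}^{(0)}$ is compact, $\mathfrak{A}(\mathcal{G})$ is unital with unit $\mathbbm{1}_{\mathcal{G}^{(0)}}$; functions on the clopen set $\mathcal{G}^{(0)}$ are extended by zero to $\mathcal{G}$, so $C(\mathcal{G}^{(0)})\subseteq\mathfrak{A}(\mathcal{G})$. For a unital Banach algebra $\mathfrak{A}$, $\mathbf{U}(\mathfrak{A})$ is the group of invertible $\mathfrak{u}\in\mathfrak{A}$ with $\|\mathfrak{u}\|=\|\mathfrak{u}^{-1}\|=1$ (invertible isometries), and $\mathbf{U}(\mathfrak{A})_0$ is its connected component of the identity. For $\mathcal{G}$ Hausdorff étale with compact unit space, the topological full group $\mathsf{F}(\mathcal{G})$ is the group of open bisections $B$ with $\mathsf{r}(B)=\mathsf{s}(B)=\mathcal{G}^{(0)}$, with product $AB=\{ab:a\in A,b\in B,\mathsf{s}(a)=\mathsf{r}(b)\}$ and inverse $A^{-1}=\{a^{-1}:a\in A\}$. Each $B\in\mathsf{F}(\mathcal{G})$ gives a homeomorphism $\rho_B=\mathsf{r}|_B\circ(\mathsf{s}|_B)^{-1}$ of $\mathcal{G}^{(0)}$. The well-definedness of $\sigma$ (i.e. $\operatorname{supp}(\mathfrak{a})\in\mathsf{F}(\mathcal{G})$ for $\mathfrak{a}\in\mathbf{U}(\mathfrak{A}(\mathcal{G}))$)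 is part of the assertion. *)

(* Defs.v *)
From HB Require Import structures.
From mathcomp Require Import all_boot all_order all_algebra.
From mathcomp Require Import complex.
From mathcomp Require Import all_classical all_reals all_analysis.

Set Implicit Arguments.
Unset Strict Implicit.
Unset Printing Implicit Defensive.

Import Order.TTheory GRing.Theory Num.Theory.
Import numFieldNormedType.Exports.

Local Open Scope classical_set_scope.
Local Open Scope ring_scope.
Local Open Scope complex_scope.

(** * Unital Banach algebras *)

(* The product is a field of a record over a complete normed module: a structure
   inheriting from both [normedModType] and [pzRingType] cannot be declared,
   because [numDomainType] already inherits from both of their ancestors.  The
   algebra is nonzero, as usual for a unital Banach algebra. *)
Record banach_algebra (K : numFieldType) (A : completeNormedModType K) :=
  BanachAlgebra {
  bmul : A -> A -> A;
  bone : A;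
  bmulA : forall x y z, bmul x (bmul y z) = bmul (bmul x y) z;
  bmul1x : forall x, bmul bone x = x;
  bmulx1 : forall x, bmul x bone = x;
  bmulDl : forall x y z, bmul (x + y) z = bmul x z + bmul y z;
  bmulDr : forall x y z, bmul x (y + z) = bmul x y + bmul x z;
  bmulZl : forall (c : K) x y, bmul (c *: x) y = c *: bmul x y;
  bmulZr : forall (c : K) x y, bmul x (c *: y) = c *: bmul x y;
  bone_neq0 : bone != 0;
  bmul_norm : forall x y, `|bmul x y| <= `|x| * `|y|
}.

Section Inverses.
Variables (K : numFieldType) (A : completeNormedModType K).
Variable alg : banach_algebra A.

Definition inverses (u : A) : set A :=
  [set v | bmul alg u v = bone alg /\ bmul alg v u = bone alg].

Definition invertible (u : A) : Prop := inverses u !=set0.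

(* The inverse of [u] if [u] is invertible, a default value otherwise. *)
Definition binv (u : A) : A := xget (bone alg) (inverses u).

End Inverses.

(** * Topological groupoids *)

(* A groupoid is given by its set of arrows; units are identified with their
   identity arrows.  The product is a total function constrained only on
   composable pairs (x, y), those with src x = rng y. *)
Record groupoid (G : Type) := Groupoid {
  src : G -> G;
  rng : G -> G;
  gpmul : G -> G -> G;
  gpinv : G -> G;
  src_src : forall x, src (src x) = src x;
  rng_src : forall x, rng (src x) = src x;
  src_rng : forall x, src (rng x) = rng x;
  rng_rng : forall x, rng (rng x) = rng x;
  src_mul : forall x y, src x = rng y -> src (gpmul x y) = src y;
  rng_mul : forall x y, src x = rng y -> rng (gpmul x y) = rng x;
  gpmulA : forall x y z, src x = rng y -> src y = rng z ->
    gpmul x (gpmul y z) = gpmul (gpmul x y) z;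
  gpmul_src : forall x, gpmul x (src x) = x;
  gpmul_rng : forall x, gpmul (rng x) x = x;
  src_inv : forall x, src (gpinv x) = rng x;
  rng_inv : forall x, rng (gpinv x) = src x;
  gpmulV : forall x, gpmul x (gpinv x) = rng x;
  gpmulVr : forall x, gpmul (gpinv x) x = src x
}.

Section Groupoids.
Variables (G : topologicalType) (gr : groupoid G).

Definition units : set G := range (src gr).

Definition src_fiber (u : G) : set G := [set x | src gr x = u].
Definition rng_fiber (u : G) : set G := [set x | rng gr x = u].

Definition topological_groupoid : Prop :=
  {within [set q : G * G | src gr q.1 = rng gr q.2],
     continuous (fun q : G * G => gpmul gr q.1 q.2)}
  /\ continuous (gpinv gr).

(* [f] as a map from [X] to the subspace [Y0] of [Y]. *)
Definition local_homeomorphism (X Y : topologicalType) (Y0 : set Y)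
    (f : X -> Y) : Prop :=
  forall x, Y0 (f x) /\
    exists (U : set X) (g : Y -> X),
      [/\ open U /\ U x,
          exists2 W, open W & f @` U = W `&` Y0,
          {within U, continuous f},
          {in U, cancel f g} &
          {within f @` U, continuous g}].

Definition etale : Prop :=
  [/\ topological_groupoid,
      locally_compact [set: G],
      local_homeomorphism units (rng gr) &
      local_homeomorphism units (src gr)].

Definition bisection (B : set G) : Prop :=
  {in B &, injective (rng gr)} /\ {in B &, injective (src gr)}.

Definition ample : Prop :=
  etale /\ basis [set B : set G | [/\ compact B, open B & bisection B]].

End Groupoids.

(** * The convolution algebra and its norms *)

Section Convolution.
Variables (R : realType) (G : topologicalType) (gr : groupoid G).
Local Notation C := R[i].
Local Notation normc := (@ComplexField.Normc.normc R).

Definition supp (f : G -> C) : set G := [set x | f x != 0].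

Definition Cc : set (G -> C) :=
  [set f | continuous (f : G -> C^o) /\ compact (closure (supp f))].

(* Here and in [lreg] the sums have finitely many nonzero terms for [f] in
   [Cc] over an etale groupoid; [\sum_(_ \in _)] is the finite-support sum. *)
Definition convolution (f g : G -> C) : G -> C := fun x =>
  \sum_(q \in [set q : G * G | src gr q.1 = rng gr q.2
                               /\ gpmul gr q.1 q.2 = x]) f q.1 * g q.2.

Definition star (f : G -> C) : G -> C := fun x => (f (gpinv gr x))^*.

Definition normI (f : G -> C) : \bar R :=
  maxe (ereal_sup [set \esum_(x in src_fiber gr u) (normc (f x))%:E
                  | u in units gr])
       (ereal_sup [set \esum_(x in rng_fiber gr u) (normc (f x))%:E
                  | u in units gr]).

(* The l^p norm of the restriction of [xi] to [D]; it is [+oo] when that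
   restriction is not p-summable. *)
Definition lpnorm (p : R) (D : set G) (xi : G -> C) : \bar R :=
  ((\esum_(x in D) (normc (xi x) `^ p)%:E) `^ p^-1)%E.

Definition lreg (u : G) (f xi : G -> C) : G -> C := fun x =>
  \sum_(y \in src_fiber gr u) f (gpmul gr x (gpinv gr y)) * xi y.

Definition lreg_opnorm (p : R) (u : G) (f : G -> C) : \bar R :=
  ereal_sup [set lpnorm p (src_fiber gr u) (lreg u f xi)
            | xi in [set xi | (lpnorm p (src_fiber gr u) xi <= 1)%E]].

Definition normF (p : R) (f : G -> C) : \bar R :=
  ereal_sup [set lreg_opnorm p u f | u in units gr].

Definition normFs (p : R) (f : G -> C) : \bar R :=
  maxe (normF p f) (normF p (star f)).

(* ([A], [alg]), with [i] restricted to [Cc], is the completion of the normed algebra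
   ([Cc], [N]).  Values of [i] off [Cc] are irrelevant.  The norm of [A] takes
   its values in the nonnegative reals inside [C], whence the real part. *)
Record is_completion (N : (G -> C) -> \bar R) (A : completeNormedModType C)
    (alg : banach_algebra A) (i : (G -> C) -> A) : Prop := IsCompletion {
  completion_linear : forall (c : C) f g, Cc f -> Cc g ->
    i (fun x => c * f x + g x) = c *: i f + i g;
  completion_mul : forall f g, Cc f -> Cc g ->
    i (convolution f g) = bmul alg (i f) (i g);
  completion_isometry : forall f, Cc f -> (complex.Re `|i f|)%:E = N f;
  completion_dense : dense (i @` Cc)
}.

(* [j] is the contractive linear map extending the inclusion of [Cc] into the
   functions on [G] with the supremum norm; it is unique by density. *)
Record is_realization (A : completeNormedModType C) (i : (G -> C) -> A)
    (j : A -> G -> C) : Prop := IsRealization {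
  realization_linear : forall (c : C) a b x,
    j (c *: a + b) x = c * j a x + j b x;
  realization_contractive : forall a x, `|j a x| <= `|a|;
  realization_extends : forall f, Cc f -> j (i f) = f
}.

End Convolution.

(** * Groups carried by subsets *)

(* None of the operations has to be meaningful off the carrier. *)
Record group_data (T : Type) := GroupData {
  gcar : set T;
  gmul : T -> T -> T;
  gone : T;
  ginv : T -> T
}.

Record is_group (T : Type) (H : group_data T) : Prop := IsGroup {
  is_group_mul : forall x y, gcar H x -> gcar H y -> gcar H (gmul H x y);
  is_group_one : gcar H (gone H);
  is_group_inv : forall x, gcar H x -> gcar H (ginv H x);
  is_group_mulA : forall x y z, gcar H x -> gcar H y -> gcar H z ->
    gmul H x (gmul H y z) = gmul H (gmul H x y) z;
  is_group_mul1 : forall x, gcar H x -> gmul H (gone H) x = x;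
  is_group_mulV : forall x, gcar H x -> gmul H (ginv H x) x = gone H
}.

Section GroupMaps.
Variables (T1 T2 T3 : Type).

Definition is_hom (H : group_data T1) (K : group_data T2) (f : T1 -> T2) :=
  (forall x, gcar H x -> gcar K (f x)) /\
  (forall x y, gcar H x -> gcar H y -> f (gmul H x y) = gmul K (f x) (f y)).

Definition is_iso (H : group_data T1) (K : group_data T2) (f : T1 -> T2) :=
  is_hom H K f /\ set_bij (gcar H) (gcar K) f.

End GroupMaps.

(* The sequence 1 -> K -> E -> Q -> 1 with maps [f] and [s]. *)
Record split_exact (T1 T2 T3 : Type) (K : group_data T1) (E : group_data T2)
    (Q : group_data T3) (f : T1 -> T2) (s : T2 -> T3) : Prop := SplitExact {
  split_exact_hom_l : is_hom K E f;
  split_exact_hom_r : is_hom E Q s;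
  split_exact_inj : {in gcar K &, injective f};
  split_exact_mid : f @` gcar K = [set e | gcar E e /\ s e = gone Q];
  split_exact_surj : set_surj (gcar E) (gcar Q) s;
  split_exact_section :
    exists2 t : T3 -> T2, is_hom Q E t & forall q, gcar Q q -> s (t q) = q
}.

Definition acts_by_automorphisms (T1 T2 : Type) (H : group_data T2)
    (K : group_data T1) (act : T2 -> T1 -> T1) : Prop :=
  (forall h, gcar H h -> is_iso K K (act h)) /\
  (forall h h' k, gcar H h -> gcar H h' -> gcar K k ->
     act (gmul H h h') k = act h (act h' k)).

Definition semidirect (T1 T2 : Type) (K : group_data T1) (H : group_data T2)
    (act : T2 -> T1 -> T1) : group_data (T1 * T2) :=
  GroupData (gcar K `*` gcar H)
    (fun a b => (gmul K a.1 (act a.2 b.1), gmul H a.2 b.2))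
    (gone K, gone H)
    (fun a => (act (ginv H a.2) (ginv K a.1), ginv H a.2)).

Definition lcoset (T : Type) (E : group_data T) (N : set T) (x : T) : set T :=
  [set gmul E x n | n in N].

Definition quotient_group (T : Type) (E : group_data T) (N : set T) :
    group_data (set T) :=
  GroupData (lcoset E N @` gcar E)
    (fun X Y => [set gmul E x y | x in X & y in Y])
    N
    (fun X => ginv E @` X).

(** * The groups attached to a groupoid *)

Section Groups.
Variables (R : realType) (G : topologicalType) (gr : groupoid G).
Local Notation C := R[i].
Local Notation G0 := (units gr).

(* Functions on the unit space are extended by zero to [G]; the pointwise
   inverse of such a function is again zero off the unit space. *)
Definition circle_group : group_data (G -> C) :=
  GroupData
    [set h : G -> C | [/\ {within G0, continuous (h : G -> C^o)},
                          forall x, G0 x -> `|h x| = 1 &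
                          forall x, ~ G0 x -> h x = 0]]
    (fun h k x => h x * k x)
    (\1_G0 : G -> C)
    (fun h x => (h x)^-1).

Definition isometry_group (A : completeNormedModType C)
    (alg : banach_algebra A) : group_data A :=
  GroupData
    [set u : A | [/\ invertible alg u, `|u| = 1 & `|binv alg u| = 1]]
    (bmul alg) (bone alg) (binv alg).

Definition full_group : group_data (set G) :=
  GroupData
    [set B : set G | [/\ open B, bisection gr B,
                         rng gr @` B = G0 & src gr @` B = G0]]
    (fun A B => [set x | exists a b,
       [/\ A a, B b, src gr a = rng gr b & x = gpmul gr a b]])
    G0
    (fun B => gpinv gr @` B).

Definition rho (B : set G) : G -> G := rng gr \o 'pinv_id B (src gr).

Definition full_act (B : set G) (g : G -> C) : G -> C := fun x =>
  if x \in G0 then g ('pinv_id G0 (rho B) x) else 0.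

End Groups.

(* Main.v *)
Require Import Defs.
From HB Require Import structures.
From mathcomp Require Import all_boot all_order all_algebra.
From mathcomp Require Import complex.
From mathcomp Require Import all_classical all_reals all_analysis.
From mathcomp Require Import ring lra.

Set Implicit Arguments.
Unset Strict Implicit.
Unset Printing Implicit Defensive.

Import Order.TTheory GRing.Theory Num.Theory.
Import numFieldNormedType.Exports.
Import ComplexField.Normc.

Local Open Scope classical_set_scope.
Local Open Scope ring_scope.
Local Open Scope complex_scope.

(* Each of the three norms dominates the norm of the left regular
   representation on l^q for some q <> 2 (q = 1 for the I-norm).  An invertible
   isometry [u] with inverse [v] therefore acts isometrically on every l^q(G_x),
   and the equality case of the Clarkson-type inequalities applied to the images
   of two point masses gives Lamperti's conclusion: the function [j u] has at
   most one nonzero value on each range fibre, and so has [j v].  Expanding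
   [u v = 1 = v u] then shows that [j u] is supported on an open bisection with
   full range and source, where it has modulus 1; since [j u] is within 1/2 of a
   compactly supported function, this support is compact.  Two such elements at
   distance < 1 have the same support, so the kernel of the support map is open
   and closed, and it is connected because a circle-valued function on a
   zero-dimensional compact space splits into a part avoiding -1 and a part
   avoiding 1. *)

(** * Groups carried by subsets *)

(** The algebra [A] is an abstract completion: an isometry [u] is not given as an operator on l^q,
    and its rows are not known to be summable. Every estimate is therefore made with compactly
    supported approximants of [u] and of its inverse, acting by convolution on one source fibre, and
    then passed to the limit; along the way isometry holds only up to a factor (1 + 1/(n+1))^q.
    Point masses need not be continuous, but indicators of compact open bisections restrict to them
    on a fibre. The exponent 2 is excluded because there the Clarkson inequality becomes the
    parallelogram identity, whose equality says nothing about supports. Products in [A] are never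
    expanded as infinite sums: after disjointness one term is left, reached by continuity from
    convolutions with functions on a single bisection. Once isometries are known to be functions of
    modulus 1 on a full bisection, the extension is computed arrow by arrow; the indicators of full
    bisections split it, and conjugation by them is the action. Joining a circle-valued function to
    1 takes no logarithm, only three normalized segments. *)

Section GroupData.
Variables (T : Type) (H : group_data T).
Hypothesis H_group : is_group H.
Local Notation "x * y" := (gmul H x y).
Local Notation "1" := (gone H).
Local Notation "x ^-1" := (ginv H x).
Local Notation car := (gcar H).

Let mulH := is_group_mul H_group.
Let oneH := is_group_one H_group.
Let invH := is_group_inv H_group.
Let mulA := is_group_mulA H_group.
Let mul1 := is_group_mul1 H_group.
Let mulV := is_group_mulV H_group.

Lemma group_mulKl x y : car x -> car y -> x^-1 * (x * y) = y.
Proof. by move=> Hx Hy; rewrite mulA ?mulV ?mul1//; exact: invH. Qed.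

Lemma group_cancel_l x y z : car x -> car y -> car z -> x * y = x * z -> y = z.
Proof. by move=> Hx Hy Hz e; rewrite -(group_mulKl Hx Hy) e group_mulKl. Qed.

Lemma group_mulr1 x : car x -> x * 1 = x.
Proof.
move=> Hx; have Hi := invH Hx.
apply: (@group_cancel_l x^-1) => //; first exact: mulH.
by rewrite mulA// mulV// mul1.
Qed.

Lemma group_mulrV x : car x -> x * x^-1 = 1.
Proof.
move=> Hx; have Hi := invH Hx.
apply: (@group_cancel_l x^-1) => //; first exact: mulH.
by rewrite group_mulKl// group_mulr1.
Qed.

Lemma group_mulVKl x y : car x -> car y -> x * (x^-1 * y) = y.
Proof. by move=> Hx Hy; rewrite mulA ?group_mulrV ?mul1//; exact: invH. Qed.

Lemma group_mulKr x y : car x -> car y -> (y * x) * x^-1 = y.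
Proof.
by move=> Hx Hy; rewrite -mulA ?group_mulrV ?group_mulr1//; exact: invH.
Qed.

Lemma group_mulVKr x y : car x -> car y -> (y * x^-1) * x = y.
Proof.
by move=> Hx Hy; rewrite -mulA ?mulV ?group_mulr1//; exact: invH.
Qed.

Lemma group_cancel_r x y z : car x -> car y -> car z -> y * x = z * x -> y = z.
Proof. by move=> Hx Hy Hz e; rewrite -(group_mulKr Hx Hy) e group_mulKr. Qed.

Lemma group_inv_uniq x y : car x -> car y -> x * y = 1 -> y = x^-1.
Proof.
move=> Hx Hy e; apply: (group_cancel_l Hx Hy (invH Hx)).
by rewrite e group_mulrV.
Qed.

End GroupData.

Section Homs.
Variables (T1 T2 : Type) (H : group_data T1) (K : group_data T2) (f : T1 -> T2).
Hypotheses (H_group : is_group H) (K_group : is_group K) (f_hom : is_hom H K f).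

Lemma hom_one : f (gone H) = gone K.
Proof.
have oneH := is_group_one H_group; have oneK := is_group_one K_group.
case: f_hom => fcar fmul; apply: (group_cancel_l K_group (fcar _ oneH)) => //.
  exact: fcar.
by rewrite (group_mulr1 K_group)// -?fmul// ?(is_group_mul1 H_group)//; exact: fcar.
Qed.

Lemma hom_inv x : gcar H x -> f (ginv H x) = ginv K (f x).
Proof.
move=> Hx; have Hi := is_group_inv H_group Hx.
case: (f_hom) => fcar fmul; apply: (group_inv_uniq K_group); try exact: fcar.
by rewrite -fmul// (group_mulrV H_group)// hom_one.
Qed.

End Homs.

(** * Semidirect products for an action by automorphisms *)

Section Semidirect.
Variables (T1 T2 : Type) (K : group_data T1) (H : group_data T2).
Variable act : T2 -> T1 -> T1.
Hypotheses (K_group : is_group K) (H_group : is_group H).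
Hypothesis act_aut : acts_by_automorphisms H K act.

Lemma act_car h k : gcar H h -> gcar K k -> gcar K (act h k).
Proof. by move=> Hh; case: (act_aut.1 _ Hh) => -[+ _] _; exact. Qed.

Lemma actM h k k' : gcar H h -> gcar K k -> gcar K k' ->
  act h (gmul K k k') = gmul K (act h k) (act h k').
Proof. by move=> Hh; case: (act_aut.1 _ Hh) => -[_ +] _; exact. Qed.

(** Not part of [acts_by_automorphisms], but forced by it: [act (gone H)] is idempotent and
    injective. *)
Lemma act1 k : gcar K k -> act (gone H) k = k.
Proof.
have H1 := is_group_one H_group; move=> Hk.
case: (act_aut.1 _ H1) => _ [_ inj _].
apply: inj; rewrite ?inE//; first exact: act_car.
by rewrite -act_aut.2// (is_group_mul1 H_group).
Qed.

Lemma semidirect_is_group : is_group (semidirect K H act).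
Proof.
have KM := is_group_mul K_group; have HM := is_group_mul H_group.
have KV := is_group_inv K_group; have HV := is_group_inv H_group.
split => /=.
- move=> [k h] [k' h'] /= [/= Kk Hh] [/= Kk' Hh']; split => /=.
    by apply: KM => //; exact: act_car.
  exact: HM.
- by split; [exact: is_group_one | exact: is_group_one].
- move=> [k h] /= [/= Kk Hh]; split => /=; last exact: HV.
  by apply: act_car; [exact: HV | exact: KV].
- move=> [k h] [k' h'] [k'' h''] /= [/= Kk Hh] [/= Kk' Hh'] [/= Kk'' Hh''].
  congr pair; last exact: (is_group_mulA H_group).
  rewrite actM//; last exact: act_car.
  rewrite (is_group_mulA K_group)//; try exact: act_car.
    by rewrite act_aut.2.
  by apply: act_car => //; exact: act_car.
- move=> [k h] /= [/= Kk Hh].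
  by rewrite act1// (is_group_mul1 K_group)// (is_group_mul1 H_group).
- move=> [k h] /= [/= Kk Hh]; have Hi := HV _ Hh; have Ki := KV _ Kk.
  rewrite (is_group_mulV H_group)//; congr pair.
  rewrite -actM// (is_group_mulV K_group)//.
  exact: (@hom_one _ _ K K _ K_group K_group (act_aut.1 _ Hi).1).
Qed.

End Semidirect.

(** * Quotients by the kernel of a split epimorphism *)

Section Quotient.
Variables (T1 T2 : Type) (E : group_data T1) (Q : group_data T2).
Variables (s : T1 -> T2) (t : T2 -> T1).
Hypotheses (E_group : is_group E) (Q_group : is_group Q).
Hypotheses (s_hom : is_hom E Q s) (t_hom : is_hom Q E t).
Hypothesis tK : forall q, gcar Q q -> s (t q) = q.

Local Notation N := [set e | gcar E e /\ s e = gone Q].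

(** Dividing by [x] moves the fibre of [s] over [s x] into the kernel. Seen as fibres, cosets are
    indexed by [Q], and the setwise operations of the quotient become those of [Q]. *)
Lemma lcoset_kerE x : gcar E x ->
  lcoset E N x = [set e | gcar E e /\ s e = s x].
Proof.
move=> Ex; have EM := is_group_mul E_group; have EV := is_group_inv E_group.
case: (s_hom) => scar sM; apply/seteqP; split => [_ [n [En sn] <-]|e [Ee se]].
  split; first exact: EM.
  by rewrite sM// sn (group_mulr1 Q_group)//; exact: scar.
exists (gmul E (ginv E x) e); last by rewrite (group_mulVKl E_group).
have Ei := EV _ Ex; split; first exact: EM.
rewrite sM// (hom_inv E_group Q_group)// se (is_group_mulV Q_group)//.
exact: scar.
Qed.

Local Notation fib q := [set e | gcar E e /\ s e = q].

Lemma quotient_carE :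
  gcar (quotient_group E N) = [set fib q | q in gcar Q].
Proof.
case: (s_hom) => scar sM; case: (t_hom) => tcar tM.
apply/seteqP; split => [_ [x Ex <-]|_ [q Hq <-]].
  by rewrite lcoset_kerE//; exists (s x) => //; exact: scar.
by exists (t q); [exact: tcar | rewrite lcoset_kerE ?tK//; exact: tcar].
Qed.

Lemma quotient_mulE q q' : gcar Q q -> gcar Q q' ->
  gmul (quotient_group E N) (fib q) (fib q') = fib (gmul Q q q').
Proof.
case: (s_hom) => scar sM; case: (t_hom) => tcar tM Hq Hq'.
have EM := is_group_mul E_group; have EV := is_group_inv E_group.
apply/seteqP; split => [_ [x [Ex sx] [y [Ey sy] <-]]|e [Ee se]] /=.
  by split; [exact: EM | rewrite sM// sx sy].
have Et := tcar _ Hq; have Ei := EV _ Et.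
(* Factoring [e] requires some point of the fibre over [q]; the section provides it. *)
exists (t q) => /=; first by rewrite tK.
exists (gmul E (ginv E (t q)) e); last by rewrite (group_mulVKl E_group).
split; first exact: EM.
by rewrite sM// (hom_inv E_group Q_group)// se tK// (group_mulKl Q_group).
Qed.

Lemma quotient_invE q : gcar Q q ->
  ginv (quotient_group E N) (fib q) = fib (ginv Q q).
Proof.
case: (s_hom) => scar sM; case: (t_hom) => tcar tM Hq.
have EM := is_group_mul E_group; have EV := is_group_inv E_group.
apply/seteqP; split => [_ [x [Ex sx] <-]|e [Ee se]] /=.
  by split; [exact: EV | rewrite (hom_inv E_group Q_group)// sx].
have invK T (H : group_data T) (H_group : is_group H) x :
    gcar H x -> ginv H (ginv H x) = x.
  move=> Hx; have Hi := is_group_inv H_group Hx.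
  by apply/esym; apply: (group_inv_uniq H_group) => //; rewrite (is_group_mulV H_group).
exists (ginv E e); last exact: invK.
split; first exact: EV.
by rewrite (hom_inv E_group Q_group)// se invK.
Qed.

Lemma quotient_is_group : is_group (quotient_group E N).
Proof.
have QM := is_group_mul Q_group; have QV := is_group_inv Q_group.
have Q1 := is_group_one Q_group.
have car q : gcar Q q -> gcar (quotient_group E N) (fib q).
  by move=> Hq; rewrite quotient_carE; exists q.
split.
- move=> X Y; rewrite quotient_carE => -[q Hq <-] [q' Hq' <-].
  by rewrite quotient_mulE//; exists (gmul Q q q') => //; exact: QM.
- exact: (car _ Q1).
- move=> X; rewrite quotient_carE => -[q Hq <-].
  by rewrite quotient_invE//; exists (ginv Q q) => //; exact: QV.
- move=> X Y Z; rewrite quotient_carE => -[q Hq <-] [q' Hq' <-] [q'' Hq'' <-].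
  rewrite !quotient_mulE//; try exact: QM.
  by rewrite (is_group_mulA Q_group).
- move=> X; rewrite quotient_carE => -[q Hq <-].
  by rewrite [LHS]quotient_mulE// (is_group_mul1 Q_group).
- move=> X; rewrite quotient_carE => -[q Hq <-].
  by rewrite quotient_invE// quotient_mulE ?(is_group_mulV Q_group)//; exact: QV.
Qed.

Lemma quotient_iso : is_iso Q (quotient_group E N) (fun q => lcoset E N (t q)).
Proof.
case: (s_hom) => scar sM; case: (t_hom) => tcar tM.
have fibE q : gcar Q q -> lcoset E N (t q) = fib q.
  by move=> Hq; rewrite lcoset_kerE ?tK//; exact: tcar.
have fcar q : gcar Q q -> gcar (quotient_group E N) (lcoset E N (t q)).
  by move=> Hq; rewrite quotient_carE fibE//; exists q.
have QM := is_group_mul Q_group.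
split; [split => //|split].
- move=> q q' Hq Hq'; rewrite !fibE ?quotient_mulE//; exact: QM.
- exact: fcar.
- move=> q q'; rewrite !inE => Hq Hq'; rewrite !fibE// => e.
  have : fib q (t q) by split; [exact: tcar | exact: tK].
  by rewrite e => -[_]; rewrite tK.
- by rewrite quotient_carE => _ [q Hq <-] /=; exists q => //; exact: fibE.
Qed.

End Quotient.

(** * Equality in the Clarkson-type inequalities *)

Section PowR.
Variable R : realType.
Implicit Types (q r a b : R).

(** Away from 0 the power is differentiable; at 0 the radius e^(1/q) works. The absolute value keeps
    the argument where [powR] is the usual power. *)
Lemma continuous_norm_powR q : 0 < q -> continuous (fun x : R => `|x| `^ q).
Proof.
move=> q0 x; have [->|x0] := eqVneq x 0.
  rewrite /continuous_at normr0 powR0 ?gt_eqF//; apply/cvgrPdist_lt => e e0.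
  near=> y; rewrite sub0r normrN ger0_norm ?powR_ge0//.
  have -> : e = (e `^ q^-1) `^ q by rewrite -powRrM mulVf ?gt_eqF// powRr1// ltW.
  apply: gt0_ltr_powR => //; rewrite ?nnegrE ?powR_ge0//.
  near: y; apply: cvgr0_norm_lt; first exact: cvg_id.
  exact: powR_gt0.
apply: (@continuous_comp _ _ _ (fun y : R => `|y|) (fun y => y `^ q)).
  exact: norm_continuous.
have x0' : 0 < `|x| by rewrite normr_gt0.
apply: differentiable_continuous; apply/derivable1_diffP.
exact: (@ex_derive _ _ _ _ _ _ _ (is_derive1_powR q x0')).
Unshelve. all: by end_near. Qed.

Lemma cvg_powR q (u : nat -> R) l : 0 < q -> (forall n, 0 <= u n) ->
  u n @[n --> \oo] --> l -> u n `^ q @[n --> \oo] --> l `^ q.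
Proof.
move=> q0 u0 ul.
have l0 : 0 <= l.
  rewrite -(cvg_lim (@Rhausdorff R) ul).
  by apply: limr_ge; [exact: (cvgP _ ul) | exact: nearW].
rewrite -(ger0_norm l0).
under eq_fun do rewrite -(ger0_norm (u0 _)).
apply: (@cvg_comp _ _ _ u (fun x => `|x| `^ q) _ _ _ ul).
exact: continuous_norm_powR.
Qed.

Lemma powR_convex_half r a b : 1 <= r -> 0 <= a -> 0 <= b ->
  2 * ((a + b) / 2) `^ r <= a `^ r + b `^ r.
Proof.
move=> r1 a0 b0.
have h0 : (0 : R) <= 2^-1 by lra.
have h1 : (2^-1 : R) <= 1 by lra.
have : (2^-1 * a + (1 - 2^-1) * b) `^ r <= 2^-1 * a `^ r + (1 - 2^-1) * b `^ r.
  by apply: (convex_powR r1 (Itv01 h0 h1)); rewrite inE/= in_itv/= ?a0 ?b0.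
rewrite (_ : 1 - 2^-1 = 2^-1 :> R); last by lra.
by rewrite -!mulrDr [2^-1 * (a + b)]mulrC => h; rewrite -ler_pdivlMl.
Qed.

(** Midpoint convexity for the exponent 1/r at the points a^r and b^r, raised to the power r. *)
Lemma powR_concave_half r a b : 0 < r -> r <= 1 -> 0 <= a -> 0 <= b ->
  a `^ r + b `^ r <= 2 * ((a + b) / 2) `^ r.
Proof.
move=> r0 r1 a0 b0.
have ri : 1 <= r^-1 by rewrite invf_ge1.
have := powR_convex_half ri (powR_ge0 a r) (powR_ge0 b r).
rewrite -!powRrM divff ?gt_eqF// !powRr1// => h.
have c0 : 0 <= (a `^ r + b `^ r) / 2 by rewrite divr_ge0// addr_ge0// powR_ge0.
have key c : 0 <= c -> 2 * c `^ r^-1 <= a + b -> c <= ((a + b) / 2) `^ r.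
  move=> c0' hc; have -> : c = (c `^ r^-1) `^ r.
    by rewrite -powRrM mulVf ?gt_eqF// powRr1.
  apply: ge0_ler_powR; rewrite ?nnegrE ?powR_ge0 ?divr_ge0 ?addr_ge0 ?(ltW r0)//.
  by rewrite ler_pdivlMr// [leLHS]mulrC.
by rewrite mulrC -ler_pdivrMr//; exact: key.
Qed.

(** In a^r = a a^(r-1) the second factor strictly increases when its base becomes a + b; the two
    estimates add up to (a + b) (a + b)^(r-1). *)
Lemma powR_add_lt r a b : 1 < r -> 0 < a -> 0 < b ->
  a `^ r + b `^ r < (a + b) `^ r.
Proof.
move=> r1 a0 b0.
have step x y : 0 < x -> 0 < y -> x `^ r < x * (x + y) `^ (r - 1).
  move=> x0 y0; rewrite -(mulr_powRB1 (ltW x0)) ?(lt_trans _ r1)// ltr_pM2l//.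
  by apply: gt0_ltr_powR; rewrite ?subr_gt0 ?nnegrE ?ltrDl// ltW// addr_gt0.
rewrite -(@mulr_powRB1 _ (a + b)) ?(lt_trans _ r1) ?ltW ?addr_gt0// mulrDl.
by rewrite ltrD ?step// [a + b]addrC step.
Qed.

Lemma powR_add_gt r a b : 0 < r -> r < 1 -> 0 < a -> 0 < b ->
  (a + b) `^ r < a `^ r + b `^ r.
Proof.
move=> r0 r1 a0 b0; have ri : 1 < r^-1 by rewrite invf_gt1.
have := powR_add_lt ri (powR_gt0 r a0) (powR_gt0 r b0).
rewrite -!powRrM divff ?gt_eqF// !powRr1 ?ltW// => h.
have c0 : 0 <= a `^ r + b `^ r by rewrite addr_ge0// powR_ge0.
rewrite -[ltRHS](powRr1 c0) -[in ltRHS](@mulVf _ r) ?gt_eqF// powRrM.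
by apply: gt0_ltr_powR; rewrite ?nnegrE ?powR_ge0 ?ltW ?addr_gt0.
Qed.

End PowR.

(** * Moduli of complex numbers and the Clarkson inequalities with their equality case *)

Section Modulus.
Variable R : realType.
Local Notation C := R[i].
Implicit Types (z w : C) (q : R).

Lemma normcC z : `|z| = (normc z)%:C.
Proof. by case: z => a b; rewrite normc_def. Qed.

Lemma normc_ge0 z : 0 <= normc z.
Proof. by case: z => a b; exact: sqrtr_ge0. Qed.

Lemma normc_eq0 z : (normc z == 0) = (z == 0).
Proof. by rewrite -[RHS]normr_eq0 normcC eq_complex /= eqxx andbT. Qed.

Lemma normc_gt0 z : (0 < normc z) = (z != 0).
Proof. by rewrite lt_def normc_ge0 andbT normc_eq0. Qed.

Lemma normc_real (x : R) : normc x%:C = `|x|.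
Proof. by rewrite /= expr0n addr0 sqrtr_sqr. Qed.

Lemma normc_distr z w : `|normc z - normc w| <= normc (z - w).
Proof.
have h (x y : C) : normc x - normc y <= normc (x - y).
  by rewrite lerBlDr -[x in leLHS](subrK y) le_normcD.
have := h z w; have := h w z; rewrite -[normc (w - z)]normcN opprB => h1 h2.
by rewrite ler_norml; apply/andP; split; lra.
Qed.

Lemma normc_Re z : `|complex.Re z| <= normc z.
Proof. by have := normc_ge_Re z; rewrite normcC lecR. Qed.

Lemma cvg_normc T (F : set_system T) (f : T -> C) (z : C) : Filter F ->
  (f t : C^o) @[t --> F] --> (z : C^o) -> normc (f t) @[t --> F] --> normc z.
Proof.
move=> FF /cvgrPdist_lt fz; apply/cvgrPdist_lt => e e0.
have e0' : 0 < e%:C by rewrite ltcR.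
apply: filterS (fz _ e0') => t; rewrite normcC ltcR.
exact: le_lt_trans (normc_distr _ _).
Qed.

Lemma parallelogram z w :
  normc (z + w) ^+ 2 + normc (z - w) ^+ 2 = 2 * (normc z ^+ 2 + normc w ^+ 2).
Proof.
case: z w => a b [c d] /=.
by rewrite !sqr_sqrtr ?addr_ge0 ?sqr_ge0//; ring.
Qed.

(** Squared moduli turn the exponent q into q/2, which lies below or above 1 according as q < 2 or q
    > 2, and make the parallelogram identity linear in the bases. *)
Lemma normc_powR z q : normc z `^ q = (normc z ^+ 2) `^ (q / 2).
Proof.
by rewrite -powR_mulrn ?normc_ge0// -powRrM mulrC divfK.
Qed.

(** Concavity of t^(q/2) and the parallelogram identity bound the left side by 2 (|z|^2 +
    |w|^2)^(q/2); subadditivity of t^(q/2) bounds this by the right side. The second step is strict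
    unless z or w vanishes, whence the equality case. *)
Lemma clarkson_lt q z w : 1 <= q -> q < 2 ->
  normc (z + w) `^ q + normc (z - w) `^ q
    <= 2 * (normc z `^ q + normc w `^ q) ?= iff (z * w == 0).
Proof.
move=> q1 q2; have q0 : q != 0 by rewrite gt_eqF// (lt_le_trans _ q1).
apply/leifP; have [/eqP|] := boolP (z * w == 0).
  move/eqP; rewrite mulf_eq0 => /orP[]/eqP->.
    by rewrite add0r sub0r normcN normc0 powR0// add0r mulr_natl.
  by rewrite addr0 subr0 normc0 powR0// addr0 mulr_natl.
rewrite mulf_eq0 negb_or => /andP[z0 w0].
have r0 : 0 < q / 2 by lra.
have r1 : q / 2 < 1 by lra.
rewrite !(normc_powR _ q).
apply: le_lt_trans (powR_concave_half r0 (ltW r1) _ _) _; rewrite ?sqr_ge0//.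
rewrite parallelogram mulrC [2 * _ / 2]mulrC mulKf// mulrC ltr_pM2l//.
by apply: powR_add_gt => //; rewrite exprn_gt0// normc_gt0.
Qed.

(** For q/2 > 1 the power is convex and strictly superadditive, which reverses both steps. *)
Lemma clarkson_gt q z w : 2 < q ->
  2 * (normc z `^ q + normc w `^ q)
    <= normc (z + w) `^ q + normc (z - w) `^ q ?= iff (z * w == 0).
Proof.
move=> q2; have q0 : q != 0 by rewrite gt_eqF// (lt_trans _ q2).
apply/leifP; have [/eqP|] := boolP (z * w == 0).
  move/eqP; rewrite mulf_eq0 => /orP[]/eqP->.
    by rewrite add0r sub0r normcN normc0 powR0// add0r mulr_natl.
  by rewrite addr0 subr0 normc0 powR0// addr0 mulr_natl.
rewrite mulf_eq0 negb_or => /andP[z0 w0].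
have r1 : 1 < q / 2 by lra.
rewrite !(normc_powR _ q).
apply: lt_le_trans (powR_convex_half (ltW r1) _ _); rewrite ?sqr_ge0//.
rewrite parallelogram [2 * _ / 2]mulrC mulKf// ltr_pM2l//.
by apply: powR_add_lt => //; rewrite exprn_gt0// normc_gt0.
Qed.

End Modulus.

(** * Topology of ample groupoids *)

Section LocalHomeo.
Variables (X Y : topologicalType) (Y0 : set Y) (f : X -> Y).
Hypothesis f_lh : local_homeomorphism Y0 f.

Lemma local_homeomorphism_continuous : continuous f.
Proof.
move=> x; have [_ [U [g [[oU Ux] _ cf _ _]]]] := f_lh x.
by move: cf; rewrite continuous_open_subspace// => /(_ x); apply; rewrite inE.
Qed.

Lemma local_homeomorphism_open V : open Y0 -> open V -> open (f @` V).
Proof.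
move=> oY0 oV; rewrite openE => _ [x Vx <-].
have [_ [U [g [[oU Ux] [W oW fU] _ fg cg]]]] := f_lh x.
have ofU : open (f @` U) by rewrite fU; exact: openI.
have fUx : (f @` U) (f x) by exists x.
move: cg; rewrite continuous_open_subspace// => /(_ (f x)).
rewrite inE => /(_ fUx) cg.
have gV : nbhs (f x) (g @^-1` V).
  by apply: cg; rewrite fg ?inE//; exact: open_nbhs_nbhs.
have : nbhs (f x) (f @` U) by exact: open_nbhs_nbhs.
move=> /(filterI gV) ; apply: filterS => y [/= gVy [z Uz fz]].
by exists z => //; rewrite -(fg z) ?inE// fz.
Qed.

End LocalHomeo.

(** A filter on [B] is pushed forward and clusters at some [f x] with [x] in [B]; the cluster point
    lifts because images of neighbourhoods of [x] inside [B] are neighbourhoods of [f x]. This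
    transfers compactness from the unit space to full bisections. *)
Lemma openmap_inj_compact (X Y : topologicalType) (f : X -> Y) (B : set X) :
  (forall V, open V -> open (f @` V)) -> open B -> {in B &, injective f} ->
  compact (f @` B) -> compact B.
Proof.
move=> fo oB fi cB F FF FB.
have FfB : F (f @^-1` (f @` B)) by apply: filterS FB => x Bx; exists x.
have [_ [[x Bx <-] clx]] := cB (f @ F) _ FfB.
exists x; split=> // A V FA Vx.
have FAB : F (f @^-1` (f @` (A `&` B))).
  by apply: filterS (filterI FA FB) => y ABy; exists y.
move: Vx; rewrite nbhsE => -[V' [oV' V'x] V'V].
have nV : nbhs (f x) (f @` (V' `&` B)).
  by apply: open_nbhs_nbhs; split; [exact/fo/openI | exists x].
have [_ [[y [Ay By] <-] [z [V'z Bz] fzy]]] := clx _ _ FAB nV.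
exists y; split=> //; apply: V'V.
by rewrite (fi y z)// ?inE.
Qed.

Lemma basis_compact_cover (X : topologicalType) (P : set (set X)) (K O : set X) :
  basis P -> compact K -> open O -> K `<=` O ->
  exists s : seq (set X),
    [/\ forall B, B \in s -> P B /\ B `<=` O & K `<=` \big[setU/set0]_(B <- s) B].
Proof.
move=> [oP bP] cK oO KO.
pose D := [set B | P B /\ B `<=` O].
(* Lists of admissible basic sets directed by inclusion: eventually means for all lists containing a
   given one. The near-covering form of compactness for this filter yields the finite subcover. *)
pose F := filter_from [set s : seq (set X) | forall B, B \in s -> D B]
  (fun s => [set t : seq (set X) | (forall B, B \in t -> D B) /\ {subset s <= t}]).
have FF : Filter F.
  apply: filter_from_filter; first by exists [::].
  move=> s t Ds Dt; exists (s ++ t) => [B|u [Du su]].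
    by rewrite mem_cat => /orP[/Ds|/Dt].
  by split; split=> // B Bs; apply: su; rewrite mem_cat Bs ?orbT.
have /compact_near_coveringP cK' := cK.
have [x Kx|s Ds] := cK' _ F (fun s x => (\big[setU/set0]_(B <- s) B) x) FF; last first.
  by move=> h; exists s; split; [exact: Ds | apply: (h s); split].
have [B [PB Bx] BO] := bP x O (open_nbhs_nbhs (conj oO (KO _ Kx))).
exists (B, [set t : seq (set X) | (forall B, B \in t -> D B) /\ {subset [:: B] <= t}]).
  split => /=.
    by apply: open_nbhs_nbhs; split => //; exact: oP.
  by exists [:: B] => // B'; rewrite inE => /eqP->; split.
move=> [y t] [/= By [Dt Bt]].
by rewrite -bigcup_seq; exists B => //; apply: Bt; rewrite inE.
Qed.

Lemma closed_equalizer (X Y : topologicalType) (f g : X -> Y) :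
  hausdorff_space Y -> continuous f -> continuous g ->
  closed [set x | f x = g x].
Proof.
move=> hY cf cg x clx; apply: hY => A B nA nB.
have [y [/= e [Ay By]]] := clx _ (@filterI _ (nbhs x) _ (f @^-1` A) (g @^-1` B)
  (cf x A nA) (cg x B nB)).
by exists (f y); split => //; rewrite e.
Qed.

(** * Cancellation rules in a groupoid *)

Section GroupoidAlgebra.
Variables (G : Type) (gr : groupoid G).
Local Notation s := (src gr).
Local Notation r := (rng gr).
Local Notation "x * y" := (gpmul gr x y).
Local Notation "x ^-1" := (gpinv gr x).

Lemma gpinvK x : x^-1^-1 = x.
Proof.
rewrite -[LHS](gpmul_src gr) src_inv rng_inv -(gpmulVr gr x).
by rewrite gpmulA ?src_inv ?rng_inv// gpmulVr src_inv gpmul_rng.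
Qed.

Lemma gpinv_inj : injective (gpinv gr).
Proof. exact: can_inj gpinvK. Qed.

Lemma gpmulKV x y : r x = r y -> x * (x^-1 * y) = y.
Proof.
by move=> e; rewrite gpmulA ?rng_inv ?src_inv// gpmulV e gpmul_rng.
Qed.

Lemma gpmulVK x y : s x = s y -> (x * y^-1) * y = x.
Proof.
by move=> e; rewrite -gpmulA ?rng_inv ?src_inv// gpmulVr -e gpmul_src.
Qed.

Lemma gpmulKl x y : s x = r y -> x^-1 * (x * y) = y.
Proof.
by move=> e; rewrite gpmulA ?src_inv// gpmulVr e gpmul_rng.
Qed.

Lemma gpmulKr x y : s x = r y -> (x * y) * y^-1 = x.
Proof.
by move=> e; rewrite -gpmulA ?rng_inv// gpmulV -e gpmul_src.
Qed.

Lemma src_div x y : s x = s y -> s (x * y^-1) = r y.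
Proof. by move=> e; rewrite src_mul ?rng_inv// src_inv. Qed.

Lemma rng_div x y : s x = s y -> r (x * y^-1) = r x.
Proof. by move=> e; rewrite rng_mul ?rng_inv. Qed.

Lemma src_ldiv x y : r x = r y -> s (x^-1 * y) = s y.
Proof. by move=> e; rewrite src_mul ?src_inv. Qed.

Lemma rng_ldiv x y : r x = r y -> r (x^-1 * y) = s x.
Proof. by move=> e; rewrite rng_mul ?src_inv// rng_inv. Qed.

Lemma gpinv_div x y : s x = s y -> (x * y^-1)^-1 = y * x^-1.
Proof.
move=> e; have ab : x * y^-1 * (y * x^-1) = r (x * y^-1).
  rewrite rng_div// -gpmulA ?rng_inv ?src_inv ?rng_div//.
  by rewrite gpmulKl ?rng_inv// gpmulV.
rewrite -[LHS](gpmul_src gr) src_inv -ab gpmulKl//.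
by rewrite src_div ?rng_div.
Qed.

End GroupoidAlgebra.

Section Units.
Variables (G : topologicalType) (gr : groupoid G).
Local Notation s := (src gr).
Local Notation r := (rng gr).
Local Notation "x * y" := (gpmul gr x y).
Local Notation "x ^-1" := (gpinv gr x).
Local Notation G0 := (units gr).

Lemma units_src x : G0 (s x). Proof. by exists x. Qed.

Lemma units_rng x : G0 (r x).
Proof. by exists (r x) => //; rewrite src_rng. Qed.

Lemma src_unit u : G0 u -> s u = u.
Proof. by move=> [x _ <-]; rewrite src_src. Qed.

Lemma rng_unit u : G0 u -> r u = u.
Proof. by move=> [x _ <-]; rewrite rng_src. Qed.

Lemma unitsP u : G0 u <-> s u = u.
Proof. by split; [exact: src_unit | move=> <-; exact: units_src]. Qed.

Lemma mul_unitl u x : G0 u -> u = r x -> u * x = x.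
Proof. by move=> _ ->; rewrite gpmul_rng. Qed.

Lemma inv_unit u : G0 u -> u^-1 = u.
Proof.
move=> G0u; have su := src_unit G0u; have ru := rng_unit G0u.
by rewrite -{1}(gpmul_src gr u^-1) src_inv ru gpmulVr su.
Qed.

Lemma bisection_units : bisection gr G0.
Proof.
by split=> x y; rewrite !inE => Gx Gy; rewrite ?src_unit ?rng_unit.
Qed.

Lemma bisection_rng B x y : bisection gr B -> B x -> B y -> r x = r y -> x = y.
Proof. by move=> [h _] Bx By; apply: h; rewrite inE. Qed.

Lemma bisection_src B x y : bisection gr B -> B x -> B y -> s x = s y -> x = y.
Proof. by move=> [_ h] Bx By; apply: h; rewrite inE. Qed.

Lemma bisectionP B : (forall x y, B x -> B y -> r x = r y -> x = y) ->
  (forall x y, B x -> B y -> s x = s y -> x = y) -> bisection gr B.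
Proof. by move=> h1 h2; split=> x y; rewrite !inE; [exact: h1 | exact: h2]. Qed.

Lemma bisection_inv B : bisection gr B -> bisection gr [set x | B x^-1].
Proof.
move=> bB; apply: bisectionP => x y /= Bx By e; apply: (@gpinv_inj _ gr).
  by apply: (bisection_src bB) => //; rewrite !src_inv.
by apply: (bisection_rng bB) => //; rewrite !rng_inv.
Qed.

End Units.

(** * Openness, compactness and continuity in an ample groupoid *)

Section AmpleTopology.
Variables (G : topologicalType) (gr : groupoid G).
Hypotheses (G_hausdorff : hausdorff_space G) (G_ample : ample gr).
Hypothesis G0_compact : compact (units gr).
Local Notation s := (src gr).
Local Notation r := (rng gr).
Local Notation "x * y" := (gpmul gr x y).
Local Notation "x ^-1" := (gpinv gr x).
Local Notation G0 := (units gr).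

Lemma continuous_src : continuous s.
Proof. by case: G_ample => -[_ _ _ /local_homeomorphism_continuous]. Qed.

Lemma continuous_rng : continuous r.
Proof. by case: G_ample => -[_ _ /local_homeomorphism_continuous]. Qed.

Lemma continuous_inv : continuous (gpinv gr).
Proof. by case: G_ample => -[[]]. Qed.

(** Near a unit, both z and s z lie in a set where the source map is injective; they have the same
    source, so z = s z. *)
Lemma open_units : open G0.
Proof.
rewrite openE => u G0u.
case: G_ample => -[_ _ _ lh] _; have [_ [U [g [[oU Uu] _ _ fg _]]]] := lh u.
have : nbhs u (U `&` s @^-1` U).
  apply: open_nbhs_nbhs; split; last by split=> //=; rewrite src_unit.
  by apply: openI => //; apply: open_comp => // x _; exact: continuous_src.
apply: filterS => z [Uz Usz]; apply/unitsP.
by rewrite -[RHS]fg ?inE// -[LHS]fg ?inE// src_src.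
Qed.

Lemma open_src V : open V -> open (s @` V).
Proof.
move=> oV; case: G_ample => -[_ _ _ lh] _.
by apply: (local_homeomorphism_open lh) => //; exact: open_units.
Qed.

Lemma compact_src K : compact K -> compact (s @` K).
Proof.
move=> cK; apply: continuous_compact => //.
by apply: continuous_subspaceT; exact: continuous_src.
Qed.

Lemma bisection_compact B : open B -> bisection gr B -> s @` B = G0 -> compact B.
Proof.
move=> oB bB sB; apply: (openmap_inj_compact open_src) => //; first exact: bB.2.
by rewrite sB.
Qed.

Lemma open_inv B : open B -> open [set x | B x^-1].
Proof. by move=> oB; apply: open_comp => // x _; exact: continuous_inv. Qed.

(** The product is continuous only on composable pairs, so composability is required along the
    filter as well as at the limit. *)
Lemma cvg_gpmul T (F : set_system T) (f g : T -> G) x y : Filter F ->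
  s x = r y -> (\forall t \near F, s (f t) = r (g t)) ->
  f @ F --> x -> g @ F --> y -> (f t * g t) @[t --> F] --> x * y.
Proof.
move=> FF sxy Ffg fx gy U nU.
case: G_ample => -[[+ _] _ _ _] _ => /(_ (x, y) U nU).
rewrite /nbhs/= -nbhs_subspace_in//= => nV.
have /(_ _ nV) h : (f t, g t) @[t --> F] --> (x, y) by exact: cvg_pair.
have Fh := @filterI _ _ FF _ _ h Ffg.
by refine (@filterS _ _ FF _ _ _ Fh) => t [Vt e]; exact: Vt.

Qed.

Lemma ample_basis x O : open O -> O x ->
  exists K, [/\ compact K, open K, bisection gr K, K x & K `<=` O].
Proof.
move=> oO Ox; case: G_ample => _ [_ /(_ x O)] [|K [[cK oK bK] Kx] KO].
  exact: open_nbhs_nbhs.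
by exists K.
Qed.

(** Zero-dimensionality enters here: a finite union of compact open bisections separates [K] from
    the complement of [O]. *)
Lemma compact_open_between (K O : set G) : compact K -> open O -> K `<=` O ->
  exists Q, [/\ compact Q, open Q, K `<=` Q & Q `<=` O].
Proof.
move=> cK oO KO; case: G_ample => _ bP.
have [t [tP Kt]] := basis_compact_cover bP cK oO KO.
exists (\big[setU/set0]_(B <- t) B).
have h (B : set G) : B \in t -> [/\ compact B, open B & B `<=` O].
  by move=> /tP [[]].
split => //; rewrite big_seq; elim/big_ind: _ => //.
- exact: compact0.
- exact: compactU.
- by move=> B /h[].
- exact: open0.
- exact: openU.
- by move=> B /h[].
- by move=> A B AO BO x [/AO|/BO].
- by move=> B /h[].
Qed.

End AmpleTopology.

(** * Compactly supported functions and convolution *)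

Section CompactSupport.
Variables (R : realType) (G : topologicalType) (gr : groupoid G).
Hypotheses (G_hausdorff : hausdorff_space G) (G_ample : ample gr).
Hypothesis G0_compact : compact (units gr).
Local Notation C := R[i].
Implicit Types f g h : G -> C.

Lemma suppP f x : ~ supp f x <-> f x = 0.
Proof.
rewrite /supp/=; split; last by move=> ->; rewrite eqxx.
by move=> /negP; rewrite negbK => /eqP.
Qed.

Lemma Cc_supp f K : continuous (f : G -> C^o) -> compact K -> supp f `<=` K ->
  Cc f.
Proof.
move=> cf cK fK; split=> //; apply: (subclosed_compact _ cK).
  exact: closed_closure.
have /closure_id -> : closed K by exact: (compact_closed G_hausdorff cK).
exact: closure_subset.
Qed.

Lemma CcM f h : Cc f -> continuous (h : G -> C^o) -> Cc (fun x => f x * h x).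
Proof.
move=> [cf kf] ch; apply: (Cc_supp _ kf).
  by move=> x; apply: cvgM; [exact: cf | exact: ch].
move=> x; rewrite /supp/= => fhx; apply: subset_closure; rewrite /supp/=.
by apply: contra_neq fhx => ->; rewrite mul0r.
Qed.

Lemma CcL (c : C) f g : Cc f -> Cc g -> Cc (fun x => c * f x + g x).
Proof.
move=> [cf kf] [cg kg]; apply: (Cc_supp _ (compactU kf kg)).
  move=> x; apply: cvgD; last exact: cg.
  by apply: cvgM; [exact: cvg_cst | exact: cf].
move=> x; rewrite /supp/= => h.
have [fx0|fx0] := eqVneq (f x) 0; last by left; exact: subset_closure.
by right; apply: subset_closure; rewrite fx0 mulr0 add0r in h.
Qed.

Lemma CcD f g : Cc f -> Cc g -> Cc (fun x => f x + g x).
Proof.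
move=> cf cg; have := CcL 1 cf cg; congr Cc.
by apply/funext => x; rewrite mul1r.
Qed.

Lemma CcB f g : Cc f -> Cc g -> Cc (fun x => f x - g x).
Proof.
move=> cf cg; have := CcL (-1) cg cf; congr Cc.
by apply/funext => x; rewrite mulN1r addrC.
Qed.

Lemma continuous_indic (K : set G) : open K -> closed K ->
  continuous (\1_K : G -> C^o).
Proof.
move=> oK cK x; apply/cvgrPdist_lt => e e0.
have [xK|xK] := pselect (K x).
  have : nbhs x K by exact: open_nbhs_nbhs.
  by apply: filterS => y yK; rewrite !indicE !mem_set// subrr normr0.
have : nbhs x (~` K) by apply: open_nbhs_nbhs; split=> //; exact: closed_openC.
by apply: filterS => y yK; rewrite !indicE !memNset// subrr normr0.
Qed.

Lemma supp_indic (K : set G) : supp (\1_K : G -> C) = K.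
Proof.
apply/seteqP; split=> x; rewrite /supp/= indicE.
  by have [/set_mem//|] := boolP (x \in K); rewrite eqxx.
by move=> Kx; rewrite mem_set// oner_neq0.
Qed.

Lemma Cc_indic (K : set G) : open K -> compact K -> Cc (\1_K : G -> C).
Proof.
move=> oK cK; apply: (Cc_supp _ cK); last by rewrite supp_indic.
by apply: continuous_indic => //; exact: (compact_closed G_hausdorff cK).
Qed.

(** Induction on a finite cover of the support by compact open bisections. A member [K] is clopen,
    so cutting [f] down to it stays in [Cc], and the remainder is covered by the other members. On
    one bisection every convolution has at most one term. *)
Lemma Cc_ind (P : (G -> C) -> Prop) :
  (forall f g, Cc f -> Cc g -> P f -> P g -> P (fun x => f x + g x)) ->
  (forall f K, Cc f -> supp f `<=` K -> compact K -> open K -> bisection gr K ->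
    P f) ->
  forall f, Cc f -> P f.
Proof.
move=> PD Pb f Ccf.
have [_ bP] := G_ample.
have [t [tP]] := basis_compact_cover bP (proj2 Ccf) openT (@subsetT _ _).
have {}tP B : B \in t -> [/\ compact B, open B & bisection gr B].
  by move=> /tP [].
move=> /(subset_trans (@subset_closure _ _)).
elim: t f Ccf tP => [|K t ih] f Ccf tP ft.
  apply: (Pb _ set0) => //; [|exact: compact0|exact: open0|].
    by rewrite big_nil in ft.
  by split=> x y; rewrite inE.
have [cK oK bK] : [/\ compact K, open K & bisection gr K].
  by apply: tP; rewrite inE eqxx.
have c1K : continuous (\1_K : G -> C^o).
  by apply: continuous_indic => //; exact: (compact_closed G_hausdorff cK).
have CcfK : Cc (fun x => f x * \1_K x) by exact: CcM.
rewrite (_ : f = (fun x => f x * \1_K x + (f x - f x * \1_K x))); last first.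
  by apply/funext => x; rewrite addrC subrK.
apply: (PD (fun x => f x * \1_K x) (fun x => f x - f x * \1_K x)).
- exact: CcfK.
- exact: CcB.
- apply: (Pb _ K) => // x; rewrite /supp/= indicE.
  by have [/set_mem//|] := boolP (x \in K); rewrite mulr0 eqxx.
- apply: ih => [|B Bt|x]; first exact: CcB.
  by apply: tP; rewrite inE Bt orbT.
rewrite /supp/= indicE; have [|/negP xK] := boolP (x \in K).
  by rewrite mulr1 subrr eqxx.
rewrite mulr0 subr0 => /ft; rewrite big_cons => -[xK'|//].
by exfalso; apply: xK; rewrite inE.
Qed.

Lemma Cc_finite_src f u : Cc f -> finite_set (supp f `&` src_fiber gr u).
Proof.
move: f; apply: Cc_ind => [f g _ _ ff fg|f K _ fK _ _ bK].
  apply: (@sub_finite_set _ _ (supp f `&` src_fiber gr u `|` supp g `&` src_fiber gr u)).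
    move=> x [fgx xu]; have [fx0|fx0] := eqVneq (f x) 0; [right|left] => //.
    by split=> //; move: fgx; rewrite /supp/= fx0 add0r.
  by rewrite finite_setU.
have [[x [fx xu]]|h] := pselect (exists x, (supp f `&` src_fiber gr u) x).
  apply: (@sub_finite_set _ _ [set x]); last exact: finite_set1.
  move=> y [fy yu]; apply: (bisection_src bK); [exact: fK|exact: fK|].
  by rewrite (xu : src gr x = u).
apply: (@sub_finite_set _ _ set0); last exact: finite_set0.
by move=> x xu; apply: h; exists x.
Qed.

Lemma Cc_star f : Cc f -> Cc (star gr f).
Proof.
move=> [cf kf].
have ci := continuous_inv G_ample.
have supp_star : supp (star gr f) `<=` gpinv gr @` closure (supp f).
  move=> x; rewrite /supp/star/= conjc_eq0 => h.
  by exists (gpinv gr x); [exact: subset_closure | rewrite gpinvK].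
apply: Cc_supp supp_star; last first.
  by apply: continuous_compact => //; exact: continuous_subspaceT.
move=> x; apply/cvgrPdist_lt => e e0.
have /cvgrPdist_lt/(_ _ e0) : (f (gpinv gr y) : C^o) @[y --> x] --> (f (gpinv gr x) : C^o).
  exact: (@cvg_comp _ _ _ (gpinv gr) (f : G -> C^o) _ _ _ (ci x) (cf _)).
by apply: filterS => y; rewrite /star -rmorphB normcJ.
Qed.

End CompactSupport.

(** * Convolution as the regular representation on source fibres *)

Section ConvolutionAlgebra.
Variables (R : realType) (G : topologicalType) (gr : groupoid G).
Hypotheses (G_hausdorff : hausdorff_space G) (G_ample : ample gr).
Hypothesis G0_compact : compact (units gr).
Local Notation C := R[i].
Local Notation s := (src gr).
Local Notation r := (rng gr).
Local Notation "x ∙ y" := (gpmul gr x y) (at level 40, left associativity).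
Local Notation inv := (gpinv gr).
Local Notation conv := (convolution gr).
Implicit Types f g h : G -> C.

(** A factorization of [x] is determined by its right factor, which ranges over the source fibre
    containing [x]. *)
Lemma conv_lreg f g x : conv f g x = lreg gr (s x) f g x.
Proof.
rewrite /convolution /lreg.
apply: (@reindex_fsbig _ _ _ _ _ (fun z => (x ∙ inv z, z))
  (src_fiber gr (s x))
  [set q : G * G | s q.1 = r q.2 /\ q.1 ∙ q.2 = x] (fun q => f q.1 * g q.2)).
split.
- by move=> z; rewrite /src_fiber /= => e; rewrite src_div// gpmulVK.
- by move=> z z' _ _ [].
- move=> [y z] /= [e <-]; exists z; first by rewrite /src_fiber/= src_mul.
  by rewrite gpmulKr.
Qed.

Lemma lregDr u f g h x : Cc g -> Cc h ->
  lreg gr u f (fun y => g y + h y) x = lreg gr u f g x + lreg gr u f h x.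
Proof.
move=> cg ch; rewrite /lreg.
pose D := supp g `&` src_fiber gr u `|` supp h `&` src_fiber gr u.
have fD : finite_set D by rewrite finite_setU; split; exact: Cc_finite_src.
have DF : D `<=` src_fiber gr u by move=> y [[]|[]].
have gD y : src_fiber gr u y -> ~ D y -> g y = 0.
  by move=> uy nD; apply/suppP => gy; apply: nD; left.
have hD y : src_fiber gr u y -> ~ D y -> h y = 0.
  by move=> uy nD; apply/suppP => gy; apply: nD; right.
rewrite -!(@fsbig_widen _ _ _ _ D (src_fiber gr u))//.
- rewrite -fsbig_split//; apply: eq_fsbigr => y _; exact: mulrDr.
- by move=> y [uy nD]; rewrite /= hD// mulr0.
- by move=> y [uy nD]; rewrite /= gD// mulr0.
- by move=> y [uy nD]; rewrite /= gD// hD// addr0 mulr0.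
Qed.

Lemma convDr f g h : Cc g -> Cc h ->
  conv f (fun y => g y + h y) = (fun x => conv f g x + conv f h x).
Proof. by move=> cg ch; apply/funext => x; rewrite !conv_lreg lregDr. Qed.

Lemma conv_bisection f g K x z : bisection gr K -> supp g `<=` K ->
  K z -> s z = s x -> conv f g x = f (x ∙ inv z) * g z.
Proof.
move=> bK gK Kz szx; rewrite conv_lreg /lreg.
rewrite -(@fsbig_widen _ _ _ _ [set z])//.
- by rewrite fsbig_set1.
- by move=> _ ->.
- move=> y [sy /= yz]; rewrite (_ : g y = 0) ?mulr0//.
  apply/suppP => /gK Ky; apply: yz.
  by apply: (bisection_src bK) => //; rewrite szx.
Qed.

Lemma conv_bisection0 f g K x : supp g `<=` K ->
  (forall z, K z -> s z <> s x) -> conv f g x = 0.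
Proof.
move=> gK xK; rewrite conv_lreg /lreg; apply: fsbig1 => y sy.
rewrite (_ : g y = 0) ?mulr0//.
by apply/suppP => /gK Ky; apply: (xK y).
Qed.

(** For [g] on one compact open bisection [K], the value at [x] is f(x z^-1) g(z) with [z] the point
    of [K] over [s x], or 0 if there is none. Both cases occur on open sets, because the source of
    [K] is clopen. *)
Lemma Cc_conv f g : Cc f -> Cc g -> Cc (conv f g).
Proof.
move=> cf; move: g; apply: (Cc_ind G_hausdorff G_ample) => [g h cg ch ? ?|g K cg gK cK oK bK].
  by rewrite convDr//; exact: CcD.
have csrc := continuous_src G_ample.
have cinv := continuous_inv G_ample.
have osK : open (s @` K) by exact: (open_src G_ample).
have csK : closed (s @` K).
  exact: (compact_closed G_hausdorff (compact_src G_ample cK)).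
have convE x z : K z -> s z = s x -> conv f g x = f (x ∙ inv z) * g z.
  exact: conv_bisection.
(* The inverse of the source map on [K], with a default value off the source of [K]. It is
   continuous because the source map is open. *)
have [sec secP] : {sec : G -> G & forall v, (s @` K) v -> K (sec v) /\ s (sec v) = v}.
    apply: (@choice _ _ (fun v z => (s @` K) v -> K z /\ s z = v)) => v.
    have [[z Kz zv]|nv] := pselect ((s @` K) v); first by exists z.
    by exists v => /nv.
  have csec v : (s @` K) v -> sec w @[w --> v] --> sec v.
  move=> Kv V nV; have [Ks ss] := secP _ Kv.
  move: nV; rewrite nbhsE => -[V' [oV' V's] V'V].
  have nv : nbhs v (s @` (V' `&` K)).
    apply: open_nbhs_nbhs; split; first by apply: (open_src G_ample); exact: openI.
    by exists (sec v).
  change (nbhs v (sec @^-1` V)).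
  apply: filterS nv => _ [z [V'z Kz] <-]; apply: V'V.
  have [K' e] := secP (s z) (imageP _ Kz).
  by rewrite (bisection_src bK K' Kz e).
have cconv : continuous (conv f g : G -> C^o).
  move=> x; have [Kx|nKx] := pselect ((s @` K) (s x)); last first.
    have n0 : nbhs x (s @^-1` (~` (s @` K))).
      apply: open_nbhs_nbhs; split => //; apply: open_comp => [? _|]; first exact: csrc.
      exact: closed_openC.
    apply/cvgrPdist_lt => e e0; apply: filterS n0 => y nKy.
    rewrite !(conv_bisection0 _ gK) ?subrr ?normr0// => z Kz ez.
      by apply: nKy; exists z.
    by apply: nKx; exists z.
  have nx : nbhs x (s @^-1` (s @` K)).
    by apply: open_nbhs_nbhs; split => //; apply: open_comp => // ? _; exact: csrc.
  have [Ksx ssx] := secP _ Kx.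
  have cs : sec (s y) @[y --> x] --> sec (s x).
    exact: (@cvg_comp _ _ _ s sec _ _ _ (csrc x) (csec _ Kx)).
  have ci : inv (sec (s y)) @[y --> x] --> inv (sec (s x)).
    exact: (@cvg_comp _ _ _ (fun y => sec (s y)) inv _ _ _ cs (cinv _)).
  have cm : (y ∙ inv (sec (s y))) @[y --> x] --> x ∙ inv (sec (s x)).
    apply: (cvg_gpmul G_ample) => //; first by rewrite rng_inv.
      by apply: filterS nx => y Ky; rewrite rng_inv (secP _ Ky).2.
  have ccf : (f (y ∙ inv (sec (s y))) : C^o) @[y --> x] --> (f (x ∙ inv (sec (s x))) : C^o).
    exact: (@cvg_comp _ _ _ (fun y => y ∙ inv (sec (s y))) (f : G -> C^o) _ _ _ cm (proj1 cf _)).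
  have ccg : (g (sec (s y)) : C^o) @[y --> x] --> (g (sec (s x)) : C^o).
    exact: (@cvg_comp _ _ _ (fun y => sec (s y)) (g : G -> C^o) _ _ _ cs (proj1 cg _)).
  have ccm : (f (y ∙ inv (sec (s y))) * g (sec (s y)) : C^o) @[y --> x] -->
      (conv f g x : C^o).
    by rewrite (convE x (sec (s x)) Ksx ssx); apply: cvgM; [exact: ccf | exact: ccg].
  apply: cvg_trans ccm; apply: near_eq_cvg; apply: filterS nx => y Ky.
  have [Ksy ssy] := secP _ Ky.
  by rewrite (convE y (sec (s y)) Ksy ssy).
(* Nonvanishing at [x] makes [x] a product of a point of the support of [f] and a point of [K];
   composability is a closed condition, so these products form a compact set. *)
apply: (@Cc_supp _ _ G_hausdorff _ ((fun q : G * G => q.1 ∙ q.2) @`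
  ((closure (supp f) `*` K) `&` [set q | s q.1 = r q.2]))) => //.
- apply: continuous_compact.
    case: G_ample => -[[cm _] _ _ _] _.
    by apply: continuous_subspaceW cm => q [_]; exact.
  apply: compact_closedI; first by apply: compact_setX => //; exact: (proj2 cf).
  apply: (@closed_equalizer _ _ (s \o fst) (r \o snd) G_hausdorff) => q.
    by apply: continuous_comp; [exact: cvg_fst | exact: csrc].
  by apply: continuous_comp; [exact: cvg_snd | exact: (continuous_rng G_ample)].
- move=> x; rewrite /supp/= => hx.
  have [[z Kz szx]|nz] := pselect (exists2 z, K z & s z = s x); last first.
    move: hx; rewrite (conv_bisection0 _ gK) ?eqxx// => z Kz e.
    by apply: nz; exists z.
  move: hx; rewrite (convE _ _ Kz szx) mulf_eq0 negb_or => /andP[fx gx].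
  exists (x ∙ inv z, z) => /=; last by rewrite gpmulVK.
  by split; [split=> //=; exact: subset_closure | rewrite /= src_div].
Qed.

Lemma conv_unit f : conv f \1_(units gr) = f.
Proof.
apply/funext => x.
rewrite (@conv_bisection _ _ (units gr) _ (s x)) ?supp_indic//.
- rewrite indicE mem_set; last exact: units_src.
  by rewrite mulr1 inv_unit ?gpmul_src//; exact: units_src.
- exact: bisection_units.
- exact: units_src.
- exact: src_src.
Qed.

End ConvolutionAlgebra.

(** * The three norms *)

(** Bounds on finite lists survive pointwise limits; lower semicontinuity of the norms comes down to
    this. *)
Lemma esum_leP (R : realType) (T : choiceType) (D : set T) (a : T -> R) (M : R) :
  (forall x, 0 <= a x) ->
  (\esum_(x in D) (a x)%:E <= M%:E)%E <->
  (forall t : seq T, uniq t -> (forall x, x \in t -> D x) -> \sum_(x <- t) a x <= M).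
Proof.
move=> a0; split => [aM t ut tD|h].
  rewrite -lee_fin -sumEFin; apply: le_trans aM.
  apply: esum_ge; exists [set` t]; last by rewrite -fsbig_seq.
  by split => // x /tD.
apply: ge_ereal_sup => _ [X [fX XD] <-].
rewrite fsbig_finite// sumEFin lee_fin; apply: h; first exact: finmap.fset_uniq.
by move=> x; rewrite in_fset_set// inE => /XD.
Qed.

Lemma ler_sum_single (R : realType) (T : eqType) (t : seq T) (a : T -> R) (c : R) :
  0 <= c -> uniq t -> (forall x, x \in t -> a x <= c) ->
  (forall x y, x \in t -> y \in t -> a x != 0 -> a y != 0 -> x = y) ->
  \sum_(x <- t) a x <= c.
Proof.
move=> c0; elim: t => [|x t ih] /=; first by rewrite big_nil.
move=> /andP[xt ut] ac inj; rewrite big_cons.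
have [ax|ax] := eqVneq (a x) 0.
  rewrite ax add0r; apply: ih => // [y yt|y z yt zt].
    by apply: ac; rewrite inE yt orbT.
  by apply: inj; rewrite inE ?yt ?zt orbT.
rewrite big_seq big1 ?addr0 => [|y yt]; first by rewrite ac// inE eqxx.
apply/eqP; apply: contraNT xt => ay.
by rewrite (inj x y) ?inE ?eqxx ?yt ?orbT.
Qed.

Section Norms.
Variables (R : realType) (G : topologicalType) (gr : groupoid G).
Hypotheses (G_hausdorff : hausdorff_space G) (G_ample : ample gr).
Hypothesis G0_compact : compact (units gr).
Local Notation C := R[i].
Local Notation s := (src gr).
Local Notation r := (rng gr).
Local Notation "x ∙ y" := (gpmul gr x y) (at level 40, left associativity).
Local Notation inv := (gpinv gr).
Local Notation conv := (convolution gr).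
Implicit Types f g h xi : G -> C.

(** The q-th power of [lpnorm]. Without the root, sums for different functions can be added and
    compared term by term, as the Clarkson inequalities require. *)
Definition qsum (q : R) (D : set G) xi : \bar R :=
  \esum_(x in D) (normc (xi x) `^ q)%:E.

Lemma qsum_leP q D xi M : (qsum q D xi <= M%:E)%E <->
  (forall t : seq G, uniq t -> (forall x, x \in t -> D x) ->
    \sum_(x <- t) normc (xi x) `^ q <= M).
Proof. by apply: esum_leP => x; exact: powR_ge0. Qed.

Lemma lpnorm_leP q D xi c : 0 < q -> 0 <= c ->
  (lpnorm q D xi <= c%:E)%E <-> (qsum q D xi <= (c `^ q)%:E)%E.
Proof.
move=> q0 c0; rewrite /lpnorm -/(qsum q D xi).
have : (0 <= qsum q D xi)%E by apply: esum_ge0 => x _; rewrite lee_fin powR_ge0.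
case: (qsum q D xi) => [e| |]//= e0; last first.
  by rewrite invr_eq0 (gt_eqF q0).
rewrite !lee_fin in e0 *; split => h.
  have -> : e = (e `^ q^-1) `^ q by rewrite -powRrM mulVf ?gt_eqF// powRr1.
  by apply: ge0_ler_powR; rewrite ?nnegrE ?powR_ge0 ?(ltW q0).
have -> : c = (c `^ q) `^ q^-1 by rewrite -powRrM divff ?gt_eqF// powRr1.
by apply: ge0_ler_powR; rewrite ?nnegrE ?powR_ge0 ?invr_ge0 ?(ltW q0).
Qed.

Lemma lreg_seq u f xi x (t : seq G) : uniq t ->
  (forall y, y \in t -> s y = u) ->
  (forall y, s y = u -> y \notin t -> f (x ∙ inv y) * xi y = 0) ->
  lreg gr u f xi x = \sum_(y <- t) f (x ∙ inv y) * xi y.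
Proof.
move=> ut tu h; rewrite /lreg (@fsbigE _ _ _ _ _ t)//.
  by rewrite big_seq_cond [RHS]big_seq; apply: eq_bigl => y;
    apply: andb_idr => /tu; rewrite inE.
Qed.

Lemma Cc_seq f u : Cc f -> exists t : seq G, [/\ uniq t,
  forall y, y \in t -> s y = u & forall y, s y = u -> y \notin t -> f y = 0].
Proof.
move=> cf; have fin := Cc_finite_src G_hausdorff G_ample u cf.
exists (finmap.enum_fset (fset_set (supp f `&` src_fiber gr u))).
split; first exact: finmap.fset_uniq.
  by move=> y; rewrite in_fset_set// inE => -[].
by move=> y sy; rewrite in_fset_set// notin_setE => ny; apply/suppP => fy; apply: ny.
Qed.

(** The operator norm speaks of the unit ball, so [h] is scaled by M^(-1/q); the regular
    representation is homogeneous on functions with finite support in the fibre. *)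
Lemma normF_qsum q f c u h M : 0 < q -> 0 <= c -> (normF gr q f <= c%:E)%E ->
  units gr u -> Cc h -> 0 < M -> (qsum q (src_fiber gr u) h <= M%:E)%E ->
  (qsum q (src_fiber gr u) (lreg gr u f h) <= (c `^ q * M)%:E)%E.
Proof.
move=> q0 c0 fc u0 ch M0 /qsum_leP hM.
have [t [ut tu ht]] := Cc_seq u ch.
pose m : C := (M `^ (- q^-1))%:C.
have mq : normc m `^ q = M^-1.
  rewrite normc_real ger0_norm ?powR_ge0// -powRrM mulNr mulVf ?gt_eqF//.
  by rewrite powR_inv1// ltW.
have lm x : lreg gr u f (fun y => m * h y) x = m * lreg gr u f h x.
  rewrite !(lreg_seq ut tu)//; last 2 first.
  - by move=> y sy yt; rewrite ht ?mulr0.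
  - by move=> y sy yt; rewrite ht ?mulr0.
  by rewrite big_distrr/=; apply: eq_bigr => y _; rewrite mulrCA.
have : (lpnorm q (src_fiber gr u) (lreg gr u f (fun y => m * h y)%R) <= c%:E)%E.
  apply: le_trans fc; apply: le_trans (ereal_sup_ubound _); last first.
    by exists u => //; exact: u0.
  apply: ereal_sup_ubound; exists (fun y => m * h y) => //=.
  apply/lpnorm_leP => //; apply/qsum_leP => t' ut' t'u.
  under eq_bigr do rewrite normcM powRM ?normc_ge0// mq.
  by rewrite -big_distrr/= powR1 mulrC ler_pdivrMr// mul1r; exact: hM.
move=> /(lpnorm_leP _ _ q0 c0)/qsum_leP H; apply/qsum_leP => t' ut' t'u.
have := H t' ut' t'u.
under eq_bigr do rewrite lm normcM powRM ?normc_ge0// mq.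
by rewrite -big_distrr/= mulrC ler_pdivrMr.
Qed.

(** On a finite list of arrows only finitely many values of [xi] matter, the rows of [f] being
    finite. Cutting [xi] down to them changes nothing for [f], and for f - h n it leaves finite sums
    that converge pointwise. *)
Lemma normF_lsc q f (h : nat -> G -> C) c : 0 < q -> 0 <= c -> Cc f ->
  (forall n, (normF gr q (fun x => f x - h n x)%R <= c%:E)%E) ->
  (forall x, (h n x : C^o) @[n --> \oo] --> (0 : C^o)) ->
  (normF gr q f <= c%:E)%E.
Proof.
move=> q0 c0 cf fhc h0.
apply: ge_ereal_sup => _ [u u0 <-]; apply: ge_ereal_sup => _ [xi xi1 <-].
move: xi1 => /= /(lpnorm_leP _ _ q0 ler01); rewrite powR1 => /qsum_leP xi1.
apply/lpnorm_leP => //; apply/qsum_leP => t ut tu.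
(* Rows of [f] are columns of [star gr f]: f(x y^-1) is nonzero only if y x^-1 lies in the support
   of [star gr f], which meets the source fibre over [r x] in a finite list [Z]. *)
have [Y [uY Yu fY]] : exists Y : seq G, [/\ uniq Y, forall y, y \in Y -> s y = u &
    forall x y, x \in t -> s y = u -> y \notin Y -> f (x ∙ inv y) = 0].
  have cfs : Cc (star gr f) by exact: Cc_star.
  elim: {xi1 fhc ut} t tu => [|x t ih] tu; first by exists [::].
  have [|Y [uY Yu fY]] := ih; first by move=> y yt; apply: tu; rewrite inE yt orbT.
  have sx : s x = u by apply: tu; rewrite inE eqxx.
  have [Z [uZ Zu fZ]] := Cc_seq (r x) cfs.
  exists (undup ([seq z ∙ x | z <- Z] ++ Y)); split; first exact: undup_uniq.
    move=> y; rewrite mem_undup mem_cat => /orP[/mapP[z /Zu sz ->]|/Yu//].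
    by rewrite src_mul.
  move=> x' y; rewrite inE => /orP[/eqP->|x't] sy;
    rewrite mem_undup mem_cat negb_or => /andP[yZ yY]; last exact: fY.
  rewrite -(@gpinv_div _ gr y x) ?sx//; apply/eqP; rewrite -conjc_eq0; apply/eqP.
  apply: (fZ (y ∙ inv x)); first by rewrite src_div ?sx.
  by apply: contra yZ => yZ; apply/mapP; exists (y ∙ inv x) => //; rewrite gpmulVK ?sx.
pose xi' y := if y \in Y then xi y else 0.
have lY g x : lreg gr u g xi' x = \sum_(y <- Y) g (x ∙ inv y) * xi y.
  rewrite (lreg_seq uY Yu) => [|y sy yY]; last by rewrite /xi' (negbTE yY) mulr0.
  by rewrite big_seq [RHS]big_seq; apply: eq_bigr => y yY; rewrite /xi' yY.
have xi'1 : (lpnorm q (src_fiber gr u) xi' <= 1%:E)%E.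
  apply/lpnorm_leP => //; rewrite powR1; apply/qsum_leP => t' ut' t'u.
  apply: le_trans (xi1 _ ut' t'u); apply: ler_sum => y _; rewrite /xi'.
  by case: ifP => // _; rewrite normc0 powR0 ?gt_eqF// powR_ge0.
have bound n : \sum_(x <- t)
    normc (\sum_(y <- Y) (f (x ∙ inv y) - h n (x ∙ inv y)) * xi y) `^ q <= c `^ q.
  have : (lpnorm q (src_fiber gr u) (lreg gr u (fun x => f x - h n x)%R xi') <= c%:E)%E.
    apply: le_trans (fhc n); apply: le_trans (ereal_sup_ubound _); last first.
      by exists u => //; exact: u0.
    by apply: ereal_sup_ubound; exists xi'.
  move=> /(lpnorm_leP _ _ q0 c0)/qsum_leP/(_ t ut tu).
  by under eq_bigr do rewrite lY.
have -> : \sum_(x <- t) normc (lreg gr u f xi x) `^ q =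
    \sum_(x <- t) normc (\sum_(y <- Y) f (x ∙ inv y) * xi y) `^ q.
  rewrite big_seq [RHS]big_seq; apply: eq_bigr => x xt.
  by rewrite (lreg_seq uY Yu) => // y sy yY; rewrite fY ?mul0r.
pose F n := \sum_(x <- t)
    normc (\sum_(y <- Y) (f (x ∙ inv y) - h n (x ∙ inv y)) * xi y) `^ q.
have Fcvg : F n @[n --> \oo] -->
    \sum_(x <- t) normc (\sum_(y <- Y) f (x ∙ inv y) * xi y) `^ q.
  apply: cvg_big => [|x _]; first exact: add_continuous.
  apply: cvg_powR => // [n|]; first exact: normc_ge0.
  apply: cvg_normc.
  apply: cvg_big => [|y _]; first exact: add_continuous.
  apply: cvgM; last exact: cvg_cst.
  rewrite -[X in _ --> X]subr0.
  by apply: cvgB; [exact: cvg_cst | exact: h0].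
rewrite -(cvg_lim (@Rhausdorff R) Fcvg).
by apply: limr_le; [exact: (cvgP _ Fcvg) | exact: nearW].
Qed.

End Norms.

(** * The properties shared by the three norms *)

Section NormClasses.
Variables (R : realType) (G : topologicalType) (gr : groupoid G).
Hypotheses (G_hausdorff : hausdorff_space G) (G_ample : ample gr).
Hypothesis G0_compact : compact (units gr).
Local Notation C := R[i].
Local Notation s := (src gr).
Local Notation r := (rng gr).
Local Notation "x ∙ y" := (gpmul gr x y) (at level 40, left associativity).
Local Notation inv := (gpinv gr).
Local Notation conv := (convolution gr).
Implicit Types f g h xi : G -> C.

(* What the argument uses of the three norms.  The norm being a supremum of
   functions of finitely many values of [f], it is lower semicontinuous for
   pointwise convergence; this is what makes [j] injective. *)
Record tame_norm (q : R) (N : (G -> C) -> \bar R) : Prop := TameNorm {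
  tame_ge1 : 1 <= q;
  tame_neq2 : q != 2;
  tame_conv : forall f c u h M, Cc f -> 0 <= c -> (N f <= c%:E)%E ->
    units gr u -> Cc h -> 0 < M -> (qsum q (src_fiber gr u) h <= M%:E)%E ->
    (qsum q (src_fiber gr u) (conv f h) <= (c `^ q * M)%:E)%E;
  tame_lsc : forall f (h : nat -> G -> C) c, 0 <= c -> Cc f ->
    (forall n, Cc (h n)) ->
    (forall n, (N (fun x => f x - h n x)%R <= c%:E)%E) ->
    (forall x, (h n x : C^o) @[n --> \oo] --> (0 : C^o)) ->
    (N f <= c%:E)%E;
  tame_bisection : forall f K c, 0 <= c -> bisection gr K -> supp f `<=` K ->
    (forall x, normc (f x) <= c) -> (N f <= c%:E)%E
}.

Lemma qsum_conv q u f h :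
  qsum q (src_fiber gr u) (conv f h) = qsum q (src_fiber gr u) (lreg gr u f h).
Proof. by apply: eq_esum => x <-; rewrite conv_lreg. Qed.

(** A function on a bisection acts as a partial permutation with weights bounded by [c]: row [x] has
    at most one entry, at [phi x], by injectivity of the range map on [K], and [phi] is injective by
    that of the source map. *)
Lemma normF_bisection q f K c : 0 < q -> 0 <= c -> bisection gr K ->
  supp f `<=` K -> (forall x, normc (f x) <= c) -> (normF gr q f <= c%:E)%E.
Proof.
move=> q0 c0 bK fK fc.
apply: ge_ereal_sup => _ [u u0 <-]; apply: ge_ereal_sup => _ [xi xi1 <-].
move: xi1 => /= /(lpnorm_leP _ _ q0 ler01); rewrite powR1 => /qsum_leP xi1.
apply/lpnorm_leP => //; apply/qsum_leP => t ut tu.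
pose P x y := s y = u /\ K (x ∙ inv y).
have [phi phiP] : {phi : G -> G & forall x, (exists y, P x y) -> P x (phi x)}.
  apply: (@choice _ _ (fun x z => (exists y, P x y) -> P x z)) => x.
  have [[y Pxy]|nP] := pselect (exists y, P x y); first by exists y.
  by exists x.
have Pinj x y y' : s x = u -> P x y -> P x y' -> y = y'.
  move=> sx [sy Ky] [sy' Ky']; apply: (@gpinv_inj _ gr).
  have e : x ∙ inv y = x ∙ inv y'.
    by apply: (bisection_rng bK) => //; rewrite !rng_div ?sx ?sy ?sy'.
  rewrite -[LHS](@gpmulKl _ gr x) ?rng_inv ?sx ?sy//.
  by rewrite e gpmulKl// rng_inv sx sy'.
have Pinj' x x' y : s x = u -> s x' = u -> P x y -> P x' y -> x = x'.
  move=> sx sx' [sy Ky] [_ Ky'].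
  have e : x ∙ inv y = x' ∙ inv y.
    by apply: (bisection_src bK) => //; rewrite !src_div ?sx ?sx' ?sy.
  by rewrite -[LHS](@gpmulVK _ gr _ y) ?sx ?sy// e gpmulVK// sx' sy.
pose Q x := `[< exists y, P x y >].
have l0 x : s x = u -> ~ Q x -> lreg gr u f xi x = 0.
  move=> sx nQ; apply: fsbig1 => y sy; rewrite (_ : f _ = 0) ?mul0r//.
  by apply/suppP => /fK Ky; apply: nQ; apply/asboolP; exists y.
have l1 x : s x = u -> Q x -> lreg gr u f xi x = f (x ∙ inv (phi x)) * xi (phi x).
  move=> sx /asboolP /phiP Px; rewrite (@lreg_seq _ _ _ _ _ _ _ [:: phi x])//.
  - by rewrite big_seq1.
  - by move=> y; rewrite inE => /eqP ->; exact: Px.1.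
  move=> y sy yx; rewrite (_ : f _ = 0) ?mul0r//.
  apply/suppP => /fK Ky; move: yx; rewrite inE => /eqP; apply.
  by apply: (Pinj x).
rewrite (bigID Q)/= [X in _ + X]big_seq_cond [X in _ + X]big1 ?addr0; last first.
  move=> x /andP[xt nQ]; rewrite l0 ?normc0 ?powR0 ?gt_eqF//; first exact: tu.
  exact/negP.
apply: (@le_trans _ _ (\sum_(x <- [seq x <- t | Q x]) c `^ q * normc (xi (phi x)) `^ q)).
  rewrite big_filter [leLHS]big_seq_cond [leRHS]big_seq_cond.
  apply: ler_sum => x /andP[/tu sx Qx]; rewrite l1// normcM powRM ?normc_ge0//.
  apply: ler_wpM2r; first exact: powR_ge0.
  by apply: ge0_ler_powR; rewrite ?nnegrE ?normc_ge0 ?(ltW q0).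
rewrite -big_distrr/= -[leRHS]mulr1; apply: ler_wpM2l; first exact: powR_ge0.
rewrite -(big_map phi xpredT (fun y => normc (xi y) `^ q)); apply: xi1.
  rewrite map_inj_in_uniq ?filter_uniq// => x x'.
  rewrite !mem_filter => /andP[/asboolP/phiP Px /tu sx] /andP[/asboolP/phiP Px' /tu sx'] e.
  by apply: (Pinj' x x' (phi x)) => //; rewrite e.
move=> y /mapP[x]; rewrite mem_filter => /andP[/asboolP/phiP Px _] ->.
exact: Px.1.
Qed.

Lemma normI_leP f c : (normI gr f <= c%:E)%E <->
  (forall u, units gr u -> forall t : seq G, uniq t ->
     (forall x, x \in t -> s x = u) -> \sum_(x <- t) normc (f x) <= c) /\
  (forall u, units gr u -> forall t : seq G, uniq t ->
     (forall x, x \in t -> r x = u) -> \sum_(x <- t) normc (f x) <= c).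
Proof.
rewrite /normI ge_max; split.
  move=> /andP[h1 h2]; split => u u0;
    apply/(esum_leP _ _ (fun x => normc_ge0 (f x))).
    by apply: le_trans h1; apply: ereal_sup_ubound; exists u.
  by apply: le_trans h2; apply: ereal_sup_ubound; exists u.
by move=> [h1 h2]; apply/andP; split; apply: ge_ereal_sup => _ [u u0 <-];
  apply/(esum_leP _ _ (fun x => normc_ge0 (f x))); [exact: h1 | exact: h2].
Qed.

(** On l^1 a convolution operator is bounded by the column sums of its kernel, which are sums of |f|
    over source fibres; hence the exponent 1. The other clauses reduce to finite sums over
    fibres. *)
Lemma normI_tame : tame_norm 1 (normI gr).
Proof.
split => //; first by rewrite lt_eqF ?ltr1n.
- move=> f c u h M cf c0 /normI_leP [fc _] u0 ch M0 /qsum_leP hM.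
  rewrite qsum_conv; apply/qsum_leP => t ut tu.
  have [Y [uY Yu hY]] := Cc_seq G_hausdorff G_ample u ch.
  under eq_bigr do rewrite powRr1 ?normc_ge0//.
  rewrite powRr1//.
  apply: (@le_trans _ _ (\sum_(x <- t) \sum_(y <- Y)
      normc (f (x ∙ inv y)) * normc (h y))).
    apply: ler_sum => x _; rewrite (lreg_seq uY Yu) => [|y sy yY]; last first.
      by rewrite hY// mulr0.
    elim/big_ind2 : _ => [|a b a' b' ha hb|y _]; first by rewrite normc0.
      by apply: le_trans (le_normcD _ _) _; exact: lerD.
    by rewrite normcM.
  rewrite exchange_big/=.
  apply: (@le_trans _ _ (\sum_(y <- Y) c * normc (h y))).
    rewrite big_seq [leRHS]big_seq; apply: ler_sum => y /Yu sy.
    rewrite -big_distrl/=; apply: ler_wpM2r; first exact: normc_ge0.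
    rewrite -(big_map (fun x => x ∙ inv y) xpredT (fun z => normc (f z))).
    apply: (fc (r y)); first exact: units_rng.
      rewrite map_inj_in_uniq// => x x' /tu sx /tu sx' e.
      by rewrite -[LHS](@gpmulVK _ gr _ y) ?(sx : s x = u)// e gpmulVK// (sx' : s x' = u).
    by move=> _ /mapP[x /tu sx ->]; rewrite src_div// sy.
  rewrite -big_distrr/=; apply: ler_wpM2l => //.
  apply: le_trans (hM Y uY Yu); apply: ler_sum => y _.
  by rewrite powRr1 ?normc_ge0.
- move=> f h c c0 cf ch fhc h0.
  have lim (t : seq G) : (forall n, \sum_(x <- t) normc (f x - h n x) <= c) ->
      \sum_(x <- t) normc (f x) <= c.
    move=> hc.
    have Fcvg : (fun n => \sum_(x <- t) normc (f x - h n x)) n @[n --> \oo] -->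
        \sum_(x <- t) normc (f x).
      apply: cvg_big => [|x _]; first exact: add_continuous.
      apply: cvg_normc; rewrite -[X in _ --> X]subr0.
      by apply: cvgB; [exact: cvg_cst | exact: h0].
    rewrite -(cvg_lim (@Rhausdorff R) Fcvg).
    by apply: limr_le; [exact: (cvgP _ Fcvg) | exact: nearW].
  apply/normI_leP; split => u u0 t ut tu; apply: lim => n;
    have /normI_leP[h1 h2] := fhc n; [exact: (h1 u) | exact: (h2 u)].
- move=> f K c c0 bK fK fc.
  have fK' x : normc (f x) != 0 -> K x by rewrite normc_eq0 => /fK.
  apply/normI_leP; split => u u0 t ut tu; apply: ler_sum_single => // x y xt yt
    /fK' Kx /fK' Ky.
    by apply: (bisection_src bK) => //; rewrite !tu.
  by apply: (bisection_rng bK) => //; rewrite !tu.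
Qed.

Lemma normF_tame p : 1 <= p -> p != 2 -> tame_norm p (normF gr p).
Proof.
move=> p1 p2; have p0 : 0 < p by exact: lt_le_trans p1.
split => //.
- by move=> f c u h M _ c0 fc u0 ch M0 hM; rewrite qsum_conv; exact: normF_qsum.
- by move=> f h c c0 cf _ fhc h0; exact: normF_lsc fhc h0.
- by move=> f K c c0 bK fK fc; exact: normF_bisection bK fK fc.
Qed.

(** The action on l^p is controlled by the first of the two norms alone; the other clauses pass to
    [star gr f], since inversion preserves bisections and conjugation preserves moduli. *)
Lemma normFs_tame p : 1 <= p -> p != 2 -> tame_norm p (normFs gr p).
Proof.
move=> p1 p2; have [_ _ T1 T2 T3] := normF_tame p1 p2.
split => //.
- move=> f c u h M cf c0; rewrite /normFs ge_max => /andP[fc _].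
  exact: T1.
- move=> f h c c0 cf ch fhc h0; rewrite /normFs ge_max.
  have fhc' n : (normF gr p (fun x => f x - h n x)%R <= c%:E)%E /\
      (normF gr p (star gr (fun x => f x - h n x)%R) <= c%:E)%E.
    by apply/andP; rewrite -ge_max; exact: fhc.
  apply/andP; split; first exact: (T2 f h c c0 cf ch (fun n => (fhc' n).1) h0).
  apply: (T2 (star gr f) (fun n => star gr (h n)) c c0).
  + exact: Cc_star.
  + by move=> n; exact: Cc_star.
  + move=> n; rewrite (_ : (fun x => _) = star gr (fun x => f x - h n x)).
      exact: (fhc' n).2.
    by apply/funext => x; rewrite /star rmorphB.
  + move=> x; apply/cvgrPdist_lt => e e0.
    have /cvgrPdist_lt/(_ _ e0) := h0 (inv x).
    by apply: filterS => n; rewrite !sub0r !normrN /star normcJ.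
- move=> f K c c0 bK fK fc; rewrite /normFs ge_max; apply/andP; split; first exact: (T3 f K).
  apply: (T3 (star gr f) [set x | K (inv x)] c c0); first exact: bisection_inv.
    by move=> x; rewrite /supp/star/= conjc_eq0 => /fK.
  move=> x; rewrite /star; have := normcJ (f (inv x)).
  by rewrite !normcC => -[->].
Qed.

End NormClasses.

(** * The completed algebra *)

Section Algebra.
Variables (R : realType) (G : topologicalType) (gr : groupoid G).
Hypotheses (G_hausdorff : hausdorff_space G) (G_ample : ample gr).
Hypothesis G0_compact : compact (units gr).
Variables (q : R) (N : (G -> R[i]) -> \bar R).
Hypothesis N_tame : tame_norm gr q N.
Variables (A : completeNormedModType R[i]) (alg : banach_algebra A).
Variables (i : (G -> R[i]) -> A) (j : A -> G -> R[i]).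
Hypotheses (A_completion : is_completion gr N alg i).
Hypothesis (j_realization : is_realization i j).
Local Notation C := R[i].
Local Notation s := (src gr).
Local Notation r := (rng gr).
Local Notation "x ∙ y" := (gpmul gr x y) (at level 40, left associativity).
Local Notation inv := (gpinv gr).
Local Notation conv := (convolution gr).
Local Notation "a ⋅ b" := (bmul alg a b) (at level 40, left associativity).
Local Notation G0 := (units gr).
Implicit Types (f g h : G -> C) (a b : A).

(* The norm of [A] takes values in the nonnegative reals inside [C]. *)
Definition nu a : R := complex.Re `|a|.

Lemma nuE a : `|a| = (nu a)%:C.
Proof. by rewrite RRe_real// normr_real. Qed.

Lemma nu_ge0 a : 0 <= nu a.
Proof. by rewrite -lecR -nuE normr_ge0. Qed.

Lemma nuD a b : nu (a + b) <= nu a + nu b.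
Proof. by rewrite -lecR rmorphD/= -!nuE ler_normD. Qed.

Lemma nuM a b : nu (a ⋅ b) <= nu a * nu b.
Proof. by rewrite -lecR rmorphM/= -!nuE bmul_norm. Qed.

Lemma nuB a b : nu (a - b) = nu (b - a).
Proof. by rewrite /nu distrC. Qed.

Lemma nu_dist a b c : nu (a - b) <= nu (a - c) + nu (c - b).
Proof. by have := nuD (a - c) (c - b); rewrite addrA subrK. Qed.

Lemma nu_eq0 a : nu a = 0 -> a = 0.
Proof. by move=> h; apply/normr0_eq0; rewrite nuE h. Qed.

Lemma normE1 a : `|a| = 1 <-> nu a = 1.
Proof. by rewrite nuE; split => [/(congr1 (@complex.Re R))|->]. Qed.

Lemma bmulBl a b c : (a - b) ⋅ c = a ⋅ c - b ⋅ c.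
Proof. by rewrite -scaleN1r bmulDl bmulZl scaleN1r. Qed.

Lemma bmulBr a b c : c ⋅ (a - b) = c ⋅ a - c ⋅ b.
Proof. by rewrite -scaleN1r bmulDr bmulZr scaleN1r. Qed.

(** Convergence in [A], phrased with the real number [nu] so that squeezing and limits take place in
    the reals. *)
Definition acvg (u : nat -> A) a := nu (a - u n) @[n --> \oo] --> (0 : R).

Lemma acvg_le (u : nat -> A) a (e : nat -> R) :
  (forall n, nu (a - u n) <= e n) -> e n @[n --> \oo] --> (0 : R) -> acvg u a.
Proof.
move=> ue e0; apply: (squeeze_cvgr (f := fun=> 0) (h := e)) => //.
  by apply: nearW => n; rewrite nu_ge0 ue.
exact: cvg_cst.
Qed.

Lemma acvg_cst a : acvg (fun=> a) a.
Proof.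
rewrite /acvg; under eq_fun do rewrite subrr /nu normr0.
exact: cvg_cst.
Qed.

Lemma acvg_unique u a b : acvg u a -> acvg u b -> a = b.
Proof.
move=> ua ub; apply/eqP; rewrite -subr_eq0; apply/eqP/nu_eq0.
apply/eqP; rewrite eq_le nu_ge0 andbT.
have h : (nu (a - u n) + nu (b - u n)) @[n --> \oo] --> (0 + 0 : R) by exact: cvgD.
rewrite -[leRHS]addr0 -(cvg_lim (@Rhausdorff R) h).
apply: limr_ge; first exact: (cvgP _ h).
by apply: nearW => n; rewrite (nuB b); exact: nu_dist.
Qed.

Lemma acvg_mul u v a b : acvg u a -> acvg v b -> acvg (fun n => u n ⋅ v n) (a ⋅ b).
Proof.
move=> ua vb.
apply: (@acvg_le _ _ (fun n => nu (a - u n) * nu b +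
  (nu a + nu (a - u n)) * nu (b - v n))) => [n|].
  apply: le_trans (nu_dist _ _ (u n ⋅ b)) _.
  rewrite -bmulBl -bmulBr; apply: lerD; first exact: nuM.
  apply: le_trans (nuM _ _) _; apply: ler_wpM2r; first exact: nu_ge0.
  by have := nuD a (u n - a); rewrite subrKC nuB.
rewrite -[X in _ --> X](_ : 0 * nu b + (nu a + 0) * 0 = 0); last first.
  by rewrite mul0r mulr0 addr0.
apply: cvgD; first by apply: cvgM => //; exact: cvg_cst.
by apply: cvgM => //; apply: cvgD => //; exact: cvg_cst.
Qed.

Lemma jL (c : C) a b x : j (c *: a + b) x = c * j a x + j b x.
Proof. exact: realization_linear j_realization _ _ _ _. Qed.

Lemma jB a b x : j (a - b) x = j a x - j b x.
Proof. by rewrite addrC -scaleN1r jL mulN1r addrC. Qed.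

Lemma jD a b x : j (a + b) x = j a x + j b x.
Proof. by rewrite -[a]scale1r jL mul1r scale1r. Qed.

Lemma j_le a x : normc (j a x) <= nu a.
Proof.
by rewrite -lecR -nuE -normcC; exact: realization_contractive j_realization _ _.
Qed.

Lemma ji f : Cc f -> j (i f) = f.
Proof. exact: realization_extends j_realization _. Qed.

Lemma acvg_j u a : acvg u a -> forall x, (j (u n) x : C^o) @[n --> \oo] --> (j a x : C^o).
Proof.
move=> ua x; apply/cvgrPdist_lt => e e0.
have eR : e = (complex.Re e)%:C by rewrite RRe_real// gtr0_real.
have e0' : 0 < complex.Re e by rewrite -ltcR -eR.
move/cvgrPdist_lt : ua => /(_ _ e0'); apply: filterS => n.
rewrite sub0r normrN ger0_norm ?nu_ge0// => h.
by rewrite eR -jB normcC ltcR; exact: le_lt_trans (j_le _ _) h.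
Qed.

Arguments acvg_j [u a] _ x.

Lemma iL (c : C) f g : Cc f -> Cc g ->
  i (fun x => c * f x + g x) = c *: i f + i g.
Proof. exact: completion_linear A_completion _ _ _. Qed.

Lemma iM f g : Cc f -> Cc g -> i (conv f g) = i f ⋅ i g.
Proof. exact: completion_mul A_completion _ _. Qed.

Lemma iD f g : Cc f -> Cc g -> i (fun x => f x + g x) = i f + i g.
Proof.
move=> cf cg; rewrite -[i f]scale1r -iL//; congr i.
by apply/funext => x; rewrite mul1r.
Qed.

Lemma iB f g : Cc f -> Cc g -> i (fun x => f x - g x) = i f - i g.
Proof.
move=> cf cg; rewrite addrC -scaleN1r -iL//; congr i.
by apply/funext => x; rewrite mulN1r addrC.
Qed.

Lemma iN f c : Cc f -> nu (i f) <= c <-> (N f <= c%:E)%E.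
Proof.
by move=> cf; rewrite -(completion_isometry A_completion cf) lee_fin.
Qed.

Lemma approx a : exists F : nat -> G -> C, (forall n, Cc (F n)) /\
  (forall n, nu (a - i (F n)) <= n.+1%:R^-1).
Proof.
have h n : exists f, Cc f /\ nu (a - i f) <= n.+1%:R^-1.
  have e0 : 0 < (n.+1%:R^-1 : R) by rewrite invr_gt0.
  have e0' : 0 < (n.+1%:R^-1 : R)%:C by rewrite ltcR.
  have b0 : ball a (n.+1%:R^-1 : R)%:C !=set0 by exists a; exact: ballxx.
  have [x [xb [f cf fx]]] := completion_dense A_completion b0 (ball_open a _).
  by move: xb; rewrite -fx -ball_normE /= nuE ltcR => /ltW; exists f.
have [F FP] := choice h.
by exists F; split => n; have [] := FP n.
Qed.

Lemma cvg_invS : (n.+1%:R^-1 : R) @[n --> \oo] --> (0 : R).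
Proof. exact: cvg_harmonic. Qed.

Lemma approx_acvg a (F : nat -> G -> C) :
  (forall n, nu (a - i (F n)) <= n.+1%:R^-1) -> acvg (fun n => i (F n)) a.
Proof. by move=> h; apply: (acvg_le h); exact: cvg_invS. Qed.

Lemma Cc_units : Cc (\1_G0 : G -> C).
Proof. by apply: Cc_indic => //; exact: (open_units G_ample). Qed.

(** By density [i \1_G0] is a right unit, and a right unit equals the two-sided unit. *)
Lemma i_units : i \1_G0 = bone alg.
Proof.
have mul1 a : a ⋅ i \1_G0 = a.
  have [F [cF Fa]] := approx a; have ua := approx_acvg Fa.
  apply: (acvg_unique (u := fun n => i (F n))) => //.
  have := acvg_mul ua (acvg_cst (i \1_G0)).
  congr (acvg _ _); apply/funext => n.
  by rewrite -iM ?(conv_unit gr)//; exact: Cc_units.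
by rewrite -[LHS](bmul1x alg) mul1.
Qed.

Lemma j_one : j (bone alg) = \1_G0.
Proof. by rewrite -i_units ji//; exact: Cc_units. Qed.

(** Approximants [F n] of [a] tend to 0 pointwise, and F m - F (n + m) has norm at most 2/(m+1).
    Lower semicontinuity in [n] gives this bound for F m, hence 3/(m+1) for [a]. *)
Lemma j_ker a : j a = (fun=> 0) -> a = 0.
Proof.
move=> ja; have [F [cF Fa]] := approx a.
apply: nu_eq0; apply/eqP; rewrite eq_le nu_ge0 andbT.
have bound m : nu a <= 3 * m.+1%:R^-1.
  have : nu (i (F m)) <= 2 * m.+1%:R^-1.
    apply/(iN _ (cF m)).
    (* The shift by [m] makes the bound hold for every [n], not only for large ones. *)
    apply: (tame_lsc N_tame (h := fun n => F (n + m)%N) _ (cF m) (fun n => cF _)).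
    - by rewrite mulr_ge0// invr_ge0.
    - move=> n; apply/iN; first exact: CcB.
      rewrite iB//; apply: le_trans (nu_dist _ _ a) _.
      rewrite nuB mulr_natl mulr2n; apply: lerD => //.
      apply: le_trans (Fa _) _.
      by rewrite lef_pV2 ?posrE// ler_nat ltnS leq_addl.
    - move=> x; have := acvg_j (approx_acvg Fa) x; rewrite ja.
      rewrite -(cvg_shiftn m).
      have -> : (fun n => F (n + m)%N x) = (fun n => j (i (F (n + m)%N)) x).
        by apply/funext => n; rewrite ji.
      exact.
  have := nu_dist a 0 (i (F m)); rewrite !subr0 => h1 h2.
  apply: le_trans h1 _; move: (Fa m) h2.
  by move: (m.+1%:R^-1) (nu (i (F m))) (nu (a - i (F m))) => x y z; lra.
have h : (3 * n.+1%:R^-1 : R) @[n --> \oo] --> (3 * 0 : R).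
  by apply: cvgM; [exact: cvg_cst | exact: cvg_invS].
rewrite -(mulr0 (3 : R)) -(cvg_lim (@Rhausdorff R) h).
by apply: limr_ge; [exact: (cvgP _ h) | exact: nearW].
Qed.

Lemma j_inj : injective j.
Proof.
move=> a b e; apply/eqP; rewrite -subr_eq0; apply/eqP/j_ker.
by apply/funext => x; rewrite jB e subrr.
Qed.

Lemma cvgC_unique (u : nat -> C) (y z : C) :
  (u n : C^o) @[n --> \oo] --> (y : C^o) ->
  (u n : C^o) @[n --> \oo] --> (z : C^o) -> y = z.
Proof. by move=> uy uz; apply: (@cvg_unique C^o _ _ _ y z uy uz); exact: norm_hausdorff. Qed.

Lemma j_mul_bisection a g K x z : Cc g -> bisection gr K -> supp g `<=` K ->
  K z -> s z = s x -> j (a ⋅ i g) x = j a (x ∙ inv z) * g z.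
Proof.
move=> cg bK gK Kz szx; have [F [cF Fa]] := approx a; have ua := approx_acvg Fa.
apply: (cvgC_unique (acvg_j (acvg_mul ua (acvg_cst (i g))) x)).
have h : ((j (i (F n)) (x ∙ inv z) * g z) : C^o) @[n --> \oo] -->
    (j a (x ∙ inv z) * g z : C^o).
  by apply: cvgM; [exact: acvg_j | exact: cvg_cst].
apply: cvg_trans h; apply: near_eq_cvg; apply: nearW => n.
rewrite -iM// !ji//; last exact: Cc_conv.
by rewrite (conv_bisection _ bK gK Kz szx).
Qed.

Lemma j_mul_bisection0 a g K x : Cc g -> supp g `<=` K ->
  (forall z, K z -> s z <> s x) -> j (a ⋅ i g) x = 0.
Proof.
move=> cg gK nK; have [F [cF Fa]] := approx a; have ua := approx_acvg Fa.
apply: (cvgC_unique (acvg_j (acvg_mul ua (acvg_cst (i g))) x)).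
rewrite (_ : (fun n => _) = (fun=> 0)); first exact: cvg_cst.
apply/funext => n; rewrite -iM// ji//; last exact: Cc_conv.
by rewrite (conv_bisection0 _ gK nK).
Qed.

(* The product formula holds without any summability argument because the row of
   [j a] through [x] has at most one nonzero entry. *)
Lemma j_mul_row a b x y : r y = r x ->
  (forall y', r y' = r x -> j a y' != 0 -> y' = y) ->
  j (a ⋅ b) x = j a y * j b (inv y ∙ x).
Proof.
move=> ryx row.
have hC g : Cc g -> j (a ⋅ i g) x = j a y * g (inv y ∙ x).
  move: g; apply: (Cc_ind G_hausdorff G_ample) => [g h cg ch hg hh|g K cg gK cK oK bK].
    by rewrite iD// bmulDr jD hg hh mulrDr.
  have [[z Kz szx]|nz] := pselect (exists2 z, K z & s z = s x).
    rewrite (j_mul_bisection _ cg bK gK Kz szx).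
    have [e|ne] := eqVneq (x ∙ inv z) y.
      by rewrite -e gpinv_div// gpmulVK.
    (* Away from the entry [y] both sides vanish: the left one by [row], the right one because y^-1
       x in [K] would have to be [z], giving x z^-1 = y. *)
    rewrite (_ : j a (x ∙ inv z) = 0); last first.
      apply/eqP; apply: contraNT ne => jne; apply/eqP; apply: row => //.
      by rewrite rng_div.
    rewrite (_ : g (inv y ∙ x) = 0) ?mul0r ?mulr0//.
    apply/suppP => /gK Kyx; move/eqP : ne; apply.
    have -> : z = inv y ∙ x by apply: (bisection_src bK) => //; rewrite src_ldiv.
    rewrite -[RHS](@gpmulKr _ gr _ (inv y ∙ x)) ?rng_ldiv//.
    by rewrite gpmulKV.
  rewrite (j_mul_bisection0 _ cg gK) => [|z Kz e]; last by apply: nz; exists z.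
  rewrite (_ : g (inv y ∙ x) = 0) ?mulr0//.
  apply/suppP => /gK Kyx; apply: nz; exists (inv y ∙ x) => //.
  by rewrite src_ldiv.
have [F [cF Fb]] := approx b; have ub := approx_acvg Fb.
apply: (cvgC_unique (acvg_j (acvg_mul (acvg_cst a) ub) x)).
have h : ((j a y * j (i (F n)) (inv y ∙ x)) : C^o) @[n --> \oo] -->
    (j a y * j b (inv y ∙ x) : C^o).
  by apply: cvgM; [exact: cvg_cst | exact: acvg_j].
apply: cvg_trans h; apply: near_eq_cvg; apply: nearW => n.
by rewrite hC// ji.
Qed.

End Algebra.

Arguments acvg_j [R G A i j] j_realization [u a] _ x.

(** * Disjointness of supports on range fibres *)

(** Under termwise domination each single gap is at most the difference of the totals. For the two
    sides of Clarkson's inequality this turns a near equality of l^q sums into a near equality at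
    one arrow. *)
Lemma esum_gap (R : realType) (T : choiceType) (D : set T) (a b : T -> R) x :
  (forall y, 0 <= a y) -> (forall y, a y <= b y) -> D x ->
  (\esum_(y in D) (a y)%:E + (b x - a x)%:E <= \esum_(y in D) (b y)%:E)%E.
Proof.
move=> a0 ab Dx.
have ba0 y : 0 <= b y - a y by rewrite subr_ge0.
have -> : (\esum_(y in D) (b y)%:E = \esum_(y in D) ((a y)%:E + (b y - a y)%:E))%E.
  by apply: eq_esum => y _; rewrite -EFinD addrC subrK.
rewrite esumD; [|by move=> y _; rewrite lee_fin..].
apply: leeD2l; apply: esum_ge; exists [set x]; last by rewrite fsbig_set1.
by split; [exact: finite_set1 | move=> _ ->].
Qed.

Lemma leif_gap_eq0 (R : realFieldType) (u v : R) (c : bool) :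
  u <= v ?= iff c -> v - u <= 0 -> c.
Proof.
move=> h; rewrite subr_le0 => vu.
by rewrite -(h.2) eq_le h.1 vu.
Qed.

Lemma cvg_powR_invS (R : realType) (q : R) : 0 < q ->
  (1 + n.+1%:R^-1) `^ q @[n --> \oo] --> (1 : R).
Proof.
move=> q0; have h : (1 + n.+1%:R^-1 : R) @[n --> \oo] --> (1 + 0 : R).
  by apply: cvgD; [exact: cvg_cst | exact: cvg_invS].
have := cvg_powR q0 _ h; rewrite addr0 powR1; apply => n.
by rewrite addr_ge0// invr_ge0.
Qed.

Section Lamperti.
Variables (R : realType) (G : topologicalType) (gr : groupoid G).
Hypotheses (G_hausdorff : hausdorff_space G) (G_ample : ample gr).
Hypothesis G0_compact : compact (units gr).
Variables (q : R) (N : (G -> R[i]) -> \bar R).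
Hypothesis N_tame : tame_norm gr q N.
Variables (A : completeNormedModType R[i]) (alg : banach_algebra A).
Variables (i : (G -> R[i]) -> A) (j : A -> G -> R[i]).
Hypotheses (A_completion : is_completion gr N alg i).
Hypothesis (j_realization : is_realization i j).
Local Notation C := R[i].
Local Notation s := (src gr).
Local Notation r := (rng gr).
Local Notation "x ∙ y" := (gpmul gr x y) (at level 40, left associativity).
Local Notation inv := (gpinv gr).
Local Notation conv := (convolution gr).
Local Notation "a ⋅ b" := (bmul alg a b) (at level 40, left associativity).
Local Notation G0 := (units gr).
Local Notation ji := (ji j_realization).
Local Notation iM := (iM A_completion).
Implicit Types (f g h : G -> C) (a b : A).

Lemma qsumE p D h M : (qsum p D h <= M%:E)%E ->
  exists P, [/\ qsum p D h = P%:E, 0 <= P & P <= M].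
Proof.
have : (0 <= qsum p D h)%E by apply: esum_ge0 => x _; rewrite lee_fin powR_ge0.
by case: (qsum p D h) => [P| |]//; rewrite !lee_fin => P0 PM; exists P.
Qed.

Let q0 : 0 < q := lt_le_trans ltr01 (tame_ge1 N_tame).

Variables (a b : A).
Hypotheses (a1 : nu a <= 1) (b1 : nu b <= 1) (ba1 : b ⋅ a = bone alg).

Section Sequences.
Variables (F H : nat -> G -> C).
Hypotheses (cF : forall n, Cc (F n)) (cH : forall n, Cc (H n)).
Hypotheses (Fa : forall n, nu (a - i (F n)) <= n.+1%:R^-1).
Hypotheses (Hb : forall n, nu (b - i (H n)) <= n.+1%:R^-1).

(** A bound for the norm of the n-th approximant of an element of norm at most 1; it tends to 1. *)
Let c n : R := 1 + n.+1%:R^-1.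

Let c0 n : 0 < c n.
Proof. by rewrite /c addr_gt0// invr_gt0. Qed.

Let le_c (d : A) (E : nat -> G -> C) : nu d <= 1 ->
  (forall n, Cc (E n)) -> (forall n, nu (d - i (E n)) <= n.+1%:R^-1) ->
  forall n, (N (E n) <= (c n)%:E)%E.
Proof.
move=> d1 cE Ed n; apply/(iN A_completion _ (cE n)).
by have := nuD d (i (E n) - d); rewrite subrKC nuB => /le_trans; apply;
  rewrite lerD.
Qed.

Lemma qsum_upper u k M n : G0 u -> Cc k -> 0 < M ->
  (qsum q (src_fiber gr u) k <= M%:E)%E ->
  exists P, [/\ qsum q (src_fiber gr u) (conv (F n) k) = P%:E, 0 <= P &
    P <= c n `^ q * M].
Proof.
move=> u0 ck M0 kM; apply: qsumE.
by apply: (tame_conv N_tame) => //; [exact: ltW | exact: (le_c a1 cF Fa)].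
Qed.

(* As [H n * F n] tends to the unit, [F n] almost does not decrease the l^q
   norm.  The term [n.+1%:R^-1] keeps the bound given to [tame_conv] positive. *)
Lemma qsum_lower u k (t : seq G) n P : G0 u -> Cc k -> 0 <= P ->
  uniq t -> (forall x, x \in t -> s x = u) ->
  qsum q (src_fiber gr u) (conv (F n) k) = P%:E ->
  (\sum_(x <- t) normc (conv (H n) (conv (F n) k) x) `^ q) / c n `^ q
    - n.+1%:R^-1 <= P.
Proof.
move=> u0 ck P0 ut tu e.
have P0' : 0 < P + n.+1%:R^-1 by rewrite ltr_wpDl// invr_gt0.
rewrite lerBlDr ler_pdivrMr ?powR_gt0// mulrC.
suff /qsum_leP : (qsum q (src_fiber gr u) (conv (H n) (conv (F n) k)) <=
  (c n `^ q * (P + n.+1%:R^-1))%:E)%E by apply.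
apply: (tame_conv N_tame) => //; first exact: ltW.
- exact: (le_c b1 cH Hb).
- exact: Cc_conv.
- by rewrite e lee_fin lerDl invr_ge0.
Qed.

(** The products of [H n], [F n] and [k] tend to b a k = k in [A], hence pointwise, which suffices
    for a finite sum; the corrections c n ^ q and 1/(n+1) disappear in the limit. *)
Lemma lower_cvg k (t : seq G) : Cc k ->
  (\sum_(x <- t) normc (conv (H n) (conv (F n) k) x) `^ q) / c n `^ q
    - n.+1%:R^-1 @[n --> \oo] --> \sum_(x <- t) normc (k x) `^ q.
Proof.
move=> ck.
have ua := approx_acvg Fa; have ub := approx_acvg Hb.
have uab := acvg_mul alg ub (acvg_mul alg ua (acvg_cst (i k))).
rewrite -[X in _ --> X]subr0 -[X in _ --> X - _]divr1.
apply: cvgB; last exact: cvg_invS.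
apply: cvgM; last by apply: cvgV => //; exact: cvg_powR_invS.
apply: cvg_big => [|x _]; first exact: add_continuous.
apply: cvg_powR => // [n|]; first exact: normc_ge0.
apply: cvg_normc.
have := acvg_j j_realization uab x.
rewrite bmulA ba1 bmul1x ji//.
have -> : (fun n => conv (H n) (conv (F n) k) x) =
    (fun n => j (i (H n) ⋅ (i (F n) ⋅ i k)) x).
  apply/funext => n; have cFk : Cc (conv (F n) k) by exact: Cc_conv.
  by rewrite -iM// -iM// ji//; exact: Cc_conv.
exact.
Qed.

End Sequences.

(* The point masses at [g^-1] and [h^-1] in the source fibre over [r g], and their
   sum and difference, are restrictions of indicators of compact open bisections. *)
Lemma row_disjoint (g h : G) : r g = r h -> g != h -> j a g * j a h = 0.
Proof.
move=> rgh gh.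
have [F [cF Fa]] := approx A_completion a.
have [H [cH Hb]] := approx A_completion b.
pose v := r g; pose y := inv g; pose z := inv h.
have v0 : G0 v by exact: units_rng.
have sy : s y = v by rewrite src_inv.
have sz : s z = v by rewrite src_inv -rgh.
have yz : y != z by apply: contra gh => /eqP/(@gpinv_inj _ gr) ->.
have [K [cK oK bK Ky _]] := ample_basis G_ample openT (I : [set: G] y).
have [L [cL oL bL Lz _]] := ample_basis G_ample openT (I : [set: G] z).
pose ky : G -> C := \1_K; pose kz : G -> C := \1_L.
have cy : Cc ky by exact: Cc_indic.
have cz : Cc kz by exact: Cc_indic.
have kyE x : s x = v -> ky x = (x == y)%:R.
  move=> sx; rewrite /ky indicE; suff -> : (x \in K) = (x == y) by [].
  apply/idP/idP.
    by move/set_mem => Kx; apply/eqP; apply: (bisection_src bK) => //; rewrite sx.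
  by move/eqP => ->; rewrite mem_set.
have kzE x : s x = v -> kz x = (x == z)%:R.
  move=> sx; rewrite /kz indicE; suff -> : (x \in L) = (x == z) by [].
  apply/idP/idP.
    by move/set_mem => Kx; apply/eqP; apply: (bisection_src bL) => //; rewrite sx.
  by move/eqP => ->; rewrite mem_set.
pose kp x := ky x + kz x; pose km x := ky x - kz x.
have cp : Cc kp by exact: CcD.
have cm : Cc km by exact: CcB.
have powb (e : bool) : normc (e%:R : C) `^ q = e%:R :> R.
  by case: e; rewrite ?normc1 ?powR1// normc0 powR0// gt_eqF.
have pyE x : s x = v -> normc (ky x) `^ q = (x == y)%:R.
  by move=> sx; rewrite kyE.
have pzE x : s x = v -> normc (kz x) `^ q = (x == z)%:R.
  by move=> sx; rewrite kzE.
have ppE x : s x = v -> normc (kp x) `^ q = (x == y)%:R + (x == z)%:R.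
  move=> sx; rewrite /kp kyE// kzE//.
  have [->|_] := eqVneq x y; first by rewrite (negbTE yz) !addr0 powb.
  by rewrite !add0r powb.
have pmE x : s x = v -> normc (km x) `^ q = (x == y)%:R + (x == z)%:R.
  move=> sx; rewrite /km kyE// kzE//.
  have [->|_] := eqVneq x y; first by rewrite (negbTE yz) subr0 addr0 powb.
  by rewrite sub0r normcN !add0r powb.
have sum1 (t : seq G) w : uniq t -> \sum_(x <- t) ((x == w)%:R : R) <= 1.
  move=> ut; apply: ler_sum_single => // [x _|x x' _ _]; first by case: eqP.
  by rewrite !pnatr_eq0 !eqb0 !negbK => /eqP-> /eqP->.
have qy : (qsum q (src_fiber gr v) ky <= 1%:E)%E.
  apply/qsum_leP => t ut tv; apply: le_trans (sum1 t y ut).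
  by rewrite big_seq [leRHS]big_seq; apply: ler_sum => x /tv xv; rewrite pyE.
have qz : (qsum q (src_fiber gr v) kz <= 1%:E)%E.
  apply/qsum_leP => t ut tv; apply: le_trans (sum1 t z ut).
  by rewrite big_seq [leRHS]big_seq; apply: ler_sum => x /tv xv; rewrite pzE.
have sum2 (t : seq G) : uniq t ->
    \sum_(x <- t) ((x == y)%:R + (x == z)%:R : R) <= 2.
  by move=> ut; rewrite big_split/=; have := lerD (sum1 t y ut) (sum1 t z ut).
have qp : (qsum q (src_fiber gr v) kp <= 2%:E)%E.
  apply/qsum_leP => t ut tv; apply: le_trans (sum2 t ut).
  by rewrite big_seq [leRHS]big_seq; apply: ler_sum => x /tv xv; rewrite ppE.
have qm : (qsum q (src_fiber gr v) km <= 2%:E)%E.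
  apply/qsum_leP => t ut tv; apply: le_trans (sum2 t ut).
  by rewrite big_seq [leRHS]big_seq; apply: ler_sum => x /tv xv; rewrite pmE.
(* The four test functions carry all their mass on this fibre at [y] and [z], so a lower bound over
   these two arrows is already sharp in the limit. *)
pose t := [:: y; z].
have ut : uniq t by rewrite /t /= inE yz.
have tv x : x \in t -> s x = v by rewrite !inE => /orP[]/eqP ->.
pose L_ k n := (\sum_(x <- t) normc (conv (H n) (conv (F n) k) x) `^ q)
  / (1 + n.+1%:R^-1) `^ q - n.+1%:R^-1 : R.
have Lcvg k : Cc k -> L_ k n @[n --> \oo] --> \sum_(x <- t) normc (k x) `^ q.
  exact: lower_cvg.
have tsum (f : G -> R) : \sum_(x <- t) f x = f y + f z.
  by rewrite big_cons big_seq1.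
have Ly : L_ ky n @[n --> \oo] --> (1 : R).
  rewrite [X in _ --> X](_ : _ = \sum_(x <- t) normc (ky x) `^ q); first exact: Lcvg.
  by rewrite tsum !pyE// eqxx eq_sym (negbTE yz) addr0.
have Lz' : L_ kz n @[n --> \oo] --> (1 : R).
  rewrite [X in _ --> X](_ : _ = \sum_(x <- t) normc (kz x) `^ q); first exact: Lcvg.
  by rewrite tsum !pzE// eqxx (negbTE yz) add0r.
have Lp : L_ kp n @[n --> \oo] --> (2 : R).
  rewrite [X in _ --> X](_ : _ = \sum_(x <- t) normc (kp x) `^ q); first exact: Lcvg.
  by rewrite tsum !ppE// !eqxx [z == y]eq_sym (negbTE yz) addr0 add0r.
have Lm : L_ km n @[n --> \oo] --> (2 : R).
  rewrite [X in _ --> X](_ : _ = \sum_(x <- t) normc (km x) `^ q); first exact: Lcvg.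
  by rewrite tsum !pmE// !eqxx [z == y]eq_sym (negbTE yz) addr0 add0r.
pose C_ n : R := (1 + n.+1%:R^-1) `^ q.
have Ccvg : C_ n @[n --> \oo] --> (1 : R) by exact: cvg_powR_invS.
have vy x : s x = v -> v ∙ inv x = inv x.
  by move=> sx; rewrite mul_unitl// rng_inv sx.
(* Convolving with the point mass at g^-1 and evaluating at the unit [v] reads off the value at [g];
   this is why the gap below is taken at [v]. *)
have cvy n : conv (F n) ky v = F n g.
  rewrite (conv_bisection _ bK _ Ky) ?supp_indic//; last by rewrite sy src_unit.
  by rewrite kyE// eqxx mulr1 vy// gpinvK.
have cvz n : conv (F n) kz v = F n h.
  rewrite (conv_bisection _ bL _ Lz) ?supp_indic//; last by rewrite sz src_unit.
  by rewrite kzE// eqxx mulr1 vy// gpinvK.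
have cvp n x : conv (F n) kp x = conv (F n) ky x + conv (F n) kz x.
  by rewrite /kp (convDr G_hausdorff G_ample _ cy cz).
have cvm n x : conv (F n) km x = conv (F n) ky x - conv (F n) kz x.
  have e : ky = (fun x => km x + kz x) by apply/funext => w; rewrite /km subrK.
  by rewrite [in RHS]e (convDr G_hausdorff G_ample _ cm cz) addrK.
have Fg w : (F n w : C^o) @[n --> \oo] --> (j a w : C^o).
  have := acvg_j j_realization (approx_acvg Fa) w.
  have -> : (fun n => j (i (F n)) w) = (fun n => F n w).
    by apply/funext => n; rewrite ji.
  exact.
(* The two sides of Clarkson's inequality. Summed over the fibre, [S2] gives the q-sums of the
   images of [kp] and [km], and [T2] gives twice those of [ky] and [kz]. *)
pose S2 (z w : C) : R := normc (z + w) `^ q + normc (z - w) `^ q.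
pose T2 (z w : C) : R := 2 * (normc z `^ q + normc w `^ q).
have S2cvg : S2 (F n g) (F n h) @[n --> \oo] --> S2 (j a g) (j a h).
  by apply: cvgD; apply: cvg_powR => // [n|]; rewrite ?normc_ge0//;
    apply: cvg_normc; [apply: cvgD | apply: cvgB].
have T2cvg : T2 (F n g) (F n h) @[n --> \oo] --> T2 (j a g) (j a h).
  apply: cvgM; first exact: cvg_cst.
  by apply: cvgD; apply: cvg_powR => // [n|]; rewrite ?normc_ge0//;
    apply: cvg_normc.
have sums n : exists P Q P' Q' : R,
   [/\ [/\ L_ kp n <= P, L_ km n <= Q, L_ ky n <= P' & L_ kz n <= Q'],
       [/\ P <= C_ n * 2, Q <= C_ n * 2, P' <= C_ n * 1 & Q' <= C_ n * 1],
       (\esum_(x in src_fiber gr v) (S2 (conv (F n) ky x) (conv (F n) kz x))%:E =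
         (P + Q)%:E)%E &
       (\esum_(x in src_fiber gr v) (T2 (conv (F n) ky x) (conv (F n) kz x))%:E =
         (2 * (P' + Q'))%:E)%E].
  have [P [eP P0 PC]] := qsum_upper cF Fa n v0 cp (ltr0n R 2) qp.
  have [Q [eQ Q0 QC]] := qsum_upper cF Fa n v0 cm (ltr0n R 2) qm.
  have [P' [eP' P0' PC']] := qsum_upper cF Fa n v0 cy ltr01 qy.
  have [Q' [eQ' Q0' QC']] := qsum_upper cF Fa n v0 cz ltr01 qz.
  exists P, Q, P', Q'; split => //.
  - split; [exact: (qsum_lower cF cH Hb v0 cp P0 ut tv eP) |
      exact: (qsum_lower cF cH Hb v0 cm Q0 ut tv eQ) |
      exact: (qsum_lower cF cH Hb v0 cy P0' ut tv eP') |
      exact: (qsum_lower cF cH Hb v0 cz Q0' ut tv eQ')].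
  - rewrite EFinD -eP -eQ /qsum -esumD => [|x _|x _]; rewrite ?lee_fin ?powR_ge0//.
    by apply: eq_esum => x _; rewrite -EFinD cvp cvm.
  - rewrite mulr_natl mulr2n !EFinD -eP' -eQ' /qsum.
    rewrite -esumD => [|x _|x _]; rewrite ?lee_fin ?powR_ge0//.
    rewrite -esumD => [|x _|x _]; rewrite -?EFinD ?lee_fin ?addr_ge0 ?powR_ge0//.
    by apply: eq_esum => x _; rewrite -!EFinD /T2 mulr_natl mulr2n.
have [qlt|qge] := ltP q 2.
  (* Here [S2] is everywhere at most [T2]. The total of [T2] is at most 4 C_n, and that of [S2] is
     at least [L_ kp n + L_ km n], which tends to 2 + 2; so the gap at [v] closes. *)
  have gap0 : T2 (j a g) (j a h) - S2 (j a g) (j a h) <= 0.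
    have e : (T2 (F n g) (F n h) - S2 (F n g) (F n h))
        - (4 * C_ n - L_ kp n - L_ km n) @[n --> \oo] -->
        T2 (j a g) (j a h) - S2 (j a g) (j a h) - (4 * 1 - 2 - 2).
      apply: cvgB; first by apply: cvgB; [exact: T2cvg | exact: S2cvg].
      apply: cvgB; last exact: Lm.
      apply: cvgB; last exact: Lp.
      by apply: cvgM; [exact: cvg_cst | exact: Ccvg].
    (* Subtracting 0, written as 4 * 1 - 2 - 2, gives the left side the shape of the limit in
       [e]. *)
    rewrite -[leLHS]subr0 (_ : 0 = 4 * 1 - 2 - 2 :> R) ?[X in _ <= X](_ : _ = 0); try lra.
    rewrite -(cvg_lim (@Rhausdorff R) e).
    apply: limr_le; first exact: (cvgP _ e).
    apply: nearW => n.
    have [P [Q [P' [Q' [[lP lQ lP' lQ'] [uP uQ uP' uQ'] eS eT]]]]] := sums n.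
    have := @esum_gap _ _ (src_fiber gr v) (fun x => S2 (conv (F n) ky x) (conv (F n) kz x))
      (fun x => T2 (conv (F n) ky x) (conv (F n) kz x)) v _ _ (src_unit v0).
    rewrite eS eT cvy cvz -EFinD lee_fin => gap.
    have {gap} : P + Q + (T2 (F n g) (F n h) - S2 (F n g) (F n h)) <= 2 * (P' + Q').
      apply: gap => x; first by rewrite addr_ge0// powR_ge0.
      exact: (clarkson_lt _ _ (tame_ge1 N_tame) qlt).1.
    move: lP lQ uP' uQ'; clear; move: (L_ kp n) (L_ km n) (C_ n) (T2 _ _) (S2 _ _).
    by move=> *; lra.
  apply/eqP; apply: leif_gap_eq0 gap0.
  exact: (clarkson_lt _ _ (tame_ge1 N_tame) qlt).
have qgt : 2 < q by rewrite lt_def qge (tame_neq2 N_tame).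
(* The roles are exchanged: upper bounds serve for [kp] and [km], lower bounds for [ky] and [kz]. *)
have gap0 : S2 (j a g) (j a h) - T2 (j a g) (j a h) <= 0.
  have e : (S2 (F n g) (F n h) - T2 (F n g) (F n h))
      - (4 * C_ n - 2 * (L_ ky n + L_ kz n)) @[n --> \oo] -->
      S2 (j a g) (j a h) - T2 (j a g) (j a h) - (4 * 1 - 2 * (1 + 1)).
    apply: cvgB; first by apply: cvgB; [exact: S2cvg | exact: T2cvg].
    apply: cvgB; first by apply: cvgM; [exact: cvg_cst | exact: Ccvg].
    apply: cvgM; first exact: cvg_cst.
    by apply: cvgD; [exact: Ly | exact: Lz'].
  rewrite -[leLHS]subr0 (_ : 0 = 4 * 1 - 2 * (1 + 1) :> R) ?[X in _ <= X](_ : _ = 0); try lra.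
  rewrite -(cvg_lim (@Rhausdorff R) e).
  apply: limr_le; first exact: (cvgP _ e).
  apply: nearW => n.
  have [P [Q [P' [Q' [[lP lQ lP' lQ'] [uP uQ uP' uQ'] eS eT]]]]] := sums n.
  have := @esum_gap _ _ (src_fiber gr v) (fun x => T2 (conv (F n) ky x) (conv (F n) kz x))
    (fun x => S2 (conv (F n) ky x) (conv (F n) kz x)) v _ _ (src_unit v0).
  rewrite eS eT cvy cvz -EFinD lee_fin => gap.
  have {gap} : 2 * (P' + Q') + (S2 (F n g) (F n h) - T2 (F n g) (F n h)) <= P + Q.
    apply: gap => x; first by rewrite mulr_ge0// addr_ge0// powR_ge0.
    exact: (clarkson_gt _ _ qgt).1.
  move: lP' lQ' uP uQ; clear; move: (L_ ky n) (L_ kz n) (C_ n) (T2 _ _) (S2 _ _).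
  by move=> *; lra.
apply/eqP; apply: leif_gap_eq0 gap0.
exact: (clarkson_gt _ _ qgt).
Qed.

End Lamperti.

(** * Invertible isometries *)

Section UnitaryGroup.
Variables (R : realType) (G : topologicalType) (gr : groupoid G).
Hypotheses (G_hausdorff : hausdorff_space G) (G_ample : ample gr).
Hypothesis G0_compact : compact (units gr).
Variables (q : R) (N : (G -> R[i]) -> \bar R).
Hypothesis N_tame : tame_norm gr q N.
Variables (A : completeNormedModType R[i]) (alg : banach_algebra A).
Variables (i : (G -> R[i]) -> A) (j : A -> G -> R[i]).
Hypotheses (A_completion : is_completion gr N alg i).
Hypothesis (j_realization : is_realization i j).
Local Notation C := R[i].
Local Notation s := (src gr).
Local Notation r := (rng gr).
Local Notation "x ∙ y" := (gpmul gr x y) (at level 40, left associativity).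
Local Notation inv := (gpinv gr).
Local Notation conv := (convolution gr).
Local Notation "a ⋅ b" := (bmul alg a b) (at level 40, left associativity).
Local Notation G0 := (units gr).
Local Notation U := (isometry_group alg).
Local Notation F := (full_group gr).
Local Notation CT := (circle_group R gr).
Local Notation ji := (ji j_realization).
Local Notation iM := (iM A_completion).
Local Notation i_units := (i_units G_hausdorff G_ample G0_compact A_completion).
Local Notation j_one := (j_one G_hausdorff G_ample G0_compact A_completion j_realization).
Local Notation j_inj := (j_inj G_hausdorff N_tame A_completion j_realization).
Implicit Types (f g h : G -> C) (a b u v : A) (B : set G).

Lemma nu_le f K c : 0 <= c -> Cc f -> bisection gr K -> supp f `<=` K ->
  (forall x, normc (f x) <= c) -> nu (i f) <= c.
Proof.
by move=> c0 cf bK fK fc; apply/(iN A_completion _ cf);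
  exact: tame_bisection N_tame _ _ _ c0 bK fK fc.
Qed.

(** The unit of [A] is nonzero and [j] has trivial kernel, which excludes the empty groupoid. *)
Lemma units_nonempty : G0 !=set0.
Proof.
apply/set0P/negP => /eqP G00; have /negP := bone_neq0 alg; apply; apply/eqP.
apply: (j_ker G_hausdorff N_tame A_completion j_realization).
by rewrite j_one G00 indic0.
Qed.

Lemma nu_fun f K x : Cc f -> bisection gr K -> supp f `<=` K ->
  (forall x, normc (f x) <= 1) -> normc (f x) = 1 -> nu (i f) = 1.
Proof.
move=> cf bK fK f1 fx; apply/eqP; rewrite eq_le.
rewrite (nu_le ler01 cf bK fK f1)/=.
by have := j_le j_realization (i f) x; rewrite ji// fx.
Qed.

Lemma binvE u v : u ⋅ v = bone alg -> v ⋅ u = bone alg -> binv alg u = v.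
Proof.
move=> uv vu; rewrite /binv.
have [/= uw wu] := @xgetPex _ (bone alg) (inverses alg u) (ex_intro _ v (conj uv vu)).
set w := xget _ _ in uw wu *.
by rewrite -[w](bmul1x alg) -vu -bmulA uw bmulx1.
Qed.

Lemma isometryP u : gcar U u <->
  exists v, [/\ u ⋅ v = bone alg, v ⋅ u = bone alg, nu u = 1 & nu v = 1].
Proof.
split.
  move=> [[v [uv vu]] /normE1 nu1 /normE1]; rewrite (binvE uv vu) => nv1.
  by exists v.
move=> [v [uv vu nu1 nv1]]; split; first by exists v.
  exact/normE1.
by apply/normE1; rewrite (binvE uv vu).
Qed.

(** The axioms of a Banach algebra only make the unit nonzero. Its norm is computed from the
    concrete norms, which are at most 1 on the indicator of a bisection. *)
Lemma nu_one : nu (bone alg) = 1.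
Proof.
have [x Gx] := units_nonempty.
rewrite -i_units.
apply: (@nu_fun _ G0 x).
- exact: Cc_units.
- exact: bisection_units.
- by rewrite supp_indic.
- by move=> y; rewrite indicE; case: (y \in G0); rewrite ?normc1 ?normc0.
- by rewrite indicE mem_set// normc1.
Qed.

Lemma isometry_is_group : is_group U.
Proof.
split.
- move=> u v /isometryP[u' [uu' u'u nu1 nu1']] /isometryP[v' [vv' v'v nv1 nv1']].
  have e1 : u ⋅ v ⋅ (v' ⋅ u') = bone alg.
    by rewrite -bmulA [v ⋅ _]bmulA vv' bmul1x.
  have e2 : v' ⋅ u' ⋅ (u ⋅ v) = bone alg.
    by rewrite -bmulA [u' ⋅ _]bmulA u'u bmul1x.
  have h1 : nu (u ⋅ v) <= 1 by have := nuM alg u v; rewrite nu1 nv1 mulr1.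
  have h2 : nu (v' ⋅ u') <= 1 by have := nuM alg v' u'; rewrite nu1' nv1' mulr1.
  (* Submultiplicativity also bounds from below: 1 is at most a product of two norms that are each
     at most 1, so both equal 1. *)
  have h3 := nuM alg (u ⋅ v) (v' ⋅ u'); rewrite e1 nu_one in h3.
  have := nu_ge0 (u ⋅ v); have := nu_ge0 (v' ⋅ u') => p1 p2.
  apply/isometryP; exists (v' ⋅ u'); split => //; apply/eqP; rewrite eq_le.
    by rewrite h1/=; apply: (le_trans h3); rewrite ler_piMr.
  by rewrite h2/=; apply: (le_trans h3); rewrite ler_piMl.
- by apply/isometryP; exists (bone alg); rewrite bmul1x nu_one.
- move=> u /isometryP[v [uv vu n1 n2]]; apply/isometryP.
  by exists u; rewrite /= (binvE uv vu).
- by move=> *; exact: bmulA.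
- by move=> *; exact: bmul1x.
- by move=> u /isometryP[v [uv vu _ _]] /=; rewrite (binvE uv vu).
Qed.

Section Support.
Variables (u v : A).
Hypotheses (uv : u ⋅ v = bone alg) (vu : v ⋅ u = bone alg).
Hypotheses (nu1 : nu u = 1) (nv1 : nu v = 1).

Lemma supp_row x y : supp (j u) x -> supp (j u) y -> r x = r y -> x = y.
Proof.
move=> ux uy rxy; apply/eqP; apply/negP => /negP xy.
have u1 : nu u <= 1 by rewrite nu1.
have v1 : nu v <= 1 by rewrite nv1.
have := row_disjoint G_hausdorff G_ample N_tame A_completion j_realization
  u1 v1 vu rxy xy.
move=> /eqP; rewrite mulf_eq0; apply/negP; rewrite negb_or; exact/andP.
Qed.

(** If the row of [j u] over [x] were zero, the product formula for u v = 1 at [x] would read 0 = 1.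
    The formula is kept for all [z] in the row, since it then computes [j v] from [j u]. *)
Lemma supp_cover x : G0 x -> exists y, [/\ supp (j u) y, r y = x &
  forall z, r z = x -> j u y * j v (inv y ∙ z) = \1_G0 z].
Proof.
move=> Gx.
have key y : r y = x -> (forall y', r y' = x -> j u y' != 0 -> y' = y) ->
    forall z, r z = x -> j u y * j v (inv y ∙ z) = \1_G0 z.
  move=> ry row z rz; rewrite -j_one -uv.
  rewrite (j_mul_row G_hausdorff G_ample A_completion j_realization v (y := y))//.
    by rewrite ry.
  by rewrite rz.
have [[y [uy ry]]|ny] := pselect (exists y, supp (j u) y /\ r y = x).
  exists y; split => //; apply: key => // y' ry' uy'.
  by apply: supp_row => //; rewrite ry.
have rx := rng_unit Gx.
have := key x rx _ x rx; rewrite [X in _ = X]indicE mem_set// => e.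
have {e} : j u x * j v (inv x ∙ x) = 1.
  by apply: e => y' ry' uy'; exfalso; apply: ny; exists y'.
rewrite (_ : j u x = 0); first by rewrite mul0r => /eqP; rewrite eq_sym oner_eq0.
by apply/suppP => ux; apply: ny; exists x.
Qed.

Lemma supp_inverse y : supp (j u) y -> j u y * j v (inv y) = 1.
Proof.
move=> uy; have [y' [uy' ry' e]] := supp_cover (units_rng gr y).
have yy' : y' = y by exact: supp_row.
have := e (r y) (rng_rng gr y); rewrite yy' indicE mem_set; last exact: units_rng.
by rewrite -[in X in X -> _](src_inv gr y) gpmul_src.
Qed.

(** Two numbers of modulus at most 1 with product 1 lie on the unit circle. *)
Lemma supp_norm y : supp (j u) y -> normc (j u y) = 1.
Proof.
move=> uy; have := supp_inverse uy => /(congr1 (@normc R)).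
rewrite normcM normc1 => e.
have h1 : normc (j u y) <= 1 by have := j_le j_realization u y; rewrite nu1.
have h2 : normc (j v (inv y)) <= 1 by have := j_le j_realization v (inv y); rewrite nv1.
apply/eqP; rewrite eq_le h1 -e ler_piMr//.
exact: normc_ge0.
Qed.

(** Contractivity of [j] makes [j u] a uniform limit of functions in [Cc]. *)
Lemma j_continuous : continuous (j u : G -> C^o).
Proof.
move=> x; apply/cvgrPdist_le => e e0.
have eR : e = (complex.Re e)%:C by rewrite RRe_real// gtr0_real.
have e0' : 0 < complex.Re e / 3 by rewrite divr_gt0// -ltcR -eR.
have [E [cE Eu]] := approx A_completion u.
have [n ne] : exists n, (n.+1%:R^-1 : R) <= complex.Re e / 3.
  have /cvgrPdist_le/(_ _ e0')[n _ /(_ n (leqnn n))] := @cvg_invS R.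
  by rewrite sub0r normrN ger0_norm ?invr_ge0//; exists n.
have e0C : 0 < (complex.Re e / 3)%:C by rewrite ltcR.
have /cvgrPdist_le/(_ _ e0C) := proj1 (cE n) x.
apply: filterS => y; rewrite !normcC lecR => h.
rewrite eR lecR.
have d w : normc (j u w - E n w) <= complex.Re e / 3.
  have := j_le j_realization (u - i (E n)) w.
  by rewrite (jB j_realization) ji// => /le_trans; apply; exact: le_trans (Eu n) ne.
rewrite (_ : j u x - j u y = (j u x - E n x) + (E n x - E n y) - (j u y - E n y)); last by ring.
apply: le_trans (le_normcD _ _) _; rewrite normcN.
have := le_normcD (j u x - E n x) (E n x - E n y); have := d x; have := d y.
move: (normc _) (normc _) (normc _) h (normc _).
by move=> *; lra.
Qed.

Lemma supp_open : open (supp (j u)).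
Proof.
rewrite openE => x ux.
have h := supp_norm ux.
have e0 : 0 < (1 : C) by rewrite ltr01.
have /cvgrPdist_lt/(_ _ e0) := @j_continuous x.
apply: filterS => y; rewrite normcC ltcR /supp/= => hy.
by apply: contraTneq hy => ->; rewrite subr0 h ltxx.
Qed.

Lemma Cc_j : Cc (j u).
Proof.
have [E [cE Eu]] := approx A_completion u.
(* Index 1 gives distance at most 1/2; index 0 would only give 1, which does not separate a value of
   modulus 1 from 0. *)
apply: (@Cc_supp _ _ G_hausdorff _ (closure (supp (E 1%N)))).
- exact: j_continuous.
- exact: (proj2 (cE 1%N)).
move=> x ux; apply: subset_closure; rewrite /supp/=; apply/negP => /eqP Ex.
have := j_le j_realization (u - i (E 1%N)) x.
rewrite (jB j_realization) (ji (cE 1%N)) Ex subr0 (supp_norm ux).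
by move=> /le_trans/(_ (Eu 1%N)); rewrite invf_ge1// lern1.
Qed.

(** By injectivity of [j], an invertible isometry already lies in the uncompleted algebra. *)
Lemma i_j : i (j u) = u.
Proof. by apply: j_inj; rewrite ji//; exact: Cc_j. Qed.

End Support.

(** Injectivity of the source map comes from the inverse: [j v] is nonzero at the inverses of the
    arrows where [j u] is, so the row property of [j v] is a column property of [j u]. *)
Lemma isometry_supp u : gcar U u -> [/\ gcar F (supp (j u)), Cc (j u),
  i (j u) = u & forall x, supp (j u) x -> normc (j u x) = 1].
Proof.
move=> /isometryP[v [uv vu nu1 nv1]].
have col x y : supp (j u) x -> supp (j u) y -> s x = s y -> x = y.
  move=> ux uy sxy; apply: (@gpinv_inj _ gr).
  apply: (supp_row uv nv1 nu1); rewrite ?rng_inv//.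
    rewrite /supp/=; have := supp_inverse uv vu nu1 nv1 ux.
    by apply: contra_eqN => /eqP->; rewrite mulr0 eq_sym oner_neq0.
  rewrite /supp/=; have := supp_inverse uv vu nu1 nv1 uy.
  by apply: contra_eqN => /eqP->; rewrite mulr0 eq_sym oner_neq0.
split; [|exact: (Cc_j uv vu nu1 nv1)|exact: (i_j uv vu nu1 nv1)|
  exact: (supp_norm uv vu nu1 nv1)].
split; first exact: (supp_open uv vu nu1 nv1).
- by apply: bisectionP => //; exact: (supp_row vu nu1 nv1).
- apply/seteqP; split => [_ [x _ <-]|x Gx]; first exact: units_rng.
  by have [y [uy ry _]] := supp_cover uv vu nu1 nv1 Gx; exists y.
- apply/seteqP; split => [_ [x _ <-]|x Gx]; first exact: units_src.
  have [y [vy ry _]] := supp_cover vu uv nv1 nu1 Gx.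
  exists (inv y); last by rewrite src_inv.
  rewrite /supp/=; have := supp_inverse vu uv nv1 nu1 vy.
  by apply: contra_eqN => /eqP->; rewrite mulr0 eq_sym oner_neq0.
Qed.

End UnitaryGroup.

(** * The support map, its kernel and its splitting by indicators *)

Section Extension.
Variables (R : realType) (G : topologicalType) (gr : groupoid G).
Hypotheses (G_hausdorff : hausdorff_space G) (G_ample : ample gr).
Hypothesis G0_compact : compact (units gr).
Variables (q : R) (N : (G -> R[i]) -> \bar R).
Hypothesis N_tame : tame_norm gr q N.
Variables (A : completeNormedModType R[i]) (alg : banach_algebra A).
Variables (i : (G -> R[i]) -> A) (j : A -> G -> R[i]).
Hypotheses (A_completion : is_completion gr N alg i).
Hypothesis (j_realization : is_realization i j).
Local Notation C := R[i].
Local Notation s := (src gr).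
Local Notation r := (rng gr).
Local Notation "x ∙ y" := (gpmul gr x y) (at level 40, left associativity).
Local Notation inv := (gpinv gr).
Local Notation conv := (convolution gr).
Local Notation "a ⋅ b" := (bmul alg a b) (at level 40, left associativity).
Local Notation G0 := (units gr).
Local Notation U := (isometry_group alg).
Local Notation F := (full_group gr).
Local Notation CT := (circle_group R gr).
Local Notation ji := (ji j_realization).
Local Notation iM := (iM A_completion).
Local Notation i_units := (i_units G_hausdorff G_ample G0_compact A_completion).
Local Notation j_one := (j_one G_hausdorff G_ample G0_compact A_completion j_realization).
Local Notation j_inj := (j_inj G_hausdorff N_tame A_completion j_realization).
Local Notation isometry_supp := (isometry_supp G_hausdorff G_ample G0_compact
  N_tame A_completion j_realization).
Local Notation U_group := (isometry_is_group G_hausdorff G_ample G0_compact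
  N_tame A_completion j_realization).
Implicit Types (f g h : G -> C) (a b u v : A) (B : set G).


Lemma full_compact B : gcar F B -> compact B.
Proof. by move=> [oB bB _ sB]; exact: (bisection_compact G_ample G0_compact). Qed.

Lemma Cc_full B : gcar F B -> Cc (\1_B : G -> C).
Proof.
by move=> FB; apply: Cc_indic => //; [case: FB | exact: full_compact].
Qed.

Lemma full_rng B x : gcar F B -> G0 x -> exists2 y, B y & r y = x.
Proof. by move=> [_ _ <- _] [y By <-]; exists y. Qed.

Lemma full_src B x : gcar F B -> G0 x -> exists2 y, B y & s y = x.
Proof. by move=> [_ _ _ <-] [y By <-]; exists y. Qed.

Lemma full_bisection B : gcar F B -> bisection gr B.
Proof. by case. Qed.

Lemma full_units : gcar F G0.
Proof.
split; [exact: (open_units G_ample)|exact: bisection_units|..].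
  apply/seteqP; split => [_ [x _ <-]|x Gx]; first exact: units_rng.
  by exists x => //; exact: rng_unit.
apply/seteqP; split => [_ [x _ <-]|x Gx]; first exact: units_src.
by exists x => //; exact: src_unit.
Qed.

Lemma full_preinv B : gcar F B -> gcar F [set x | B (inv x)].
Proof.
move=> FB; case: (FB) => oB bB rB sB.
split; [exact: (open_inv G_ample)|exact: bisection_inv|..].
  apply/seteqP; split => [_ [x _ <-]|x Gx]; first exact: units_rng.
  have [y By sy] := full_src FB Gx.
  by exists (inv y); rewrite /= ?gpinvK// rng_inv.
apply/seteqP; split => [_ [x _ <-]|x Gx]; first exact: units_src.
have [y By ry] := full_rng FB Gx.
by exists (inv y); rewrite /= ?gpinvK// src_inv.
Qed.

Lemma full_inv B : [set inv x | x in B] = [set x | B (inv x)].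
Proof.
apply/seteqP; split => [_ [x Bx <-]|x Bx] /=; first by rewrite gpinvK.
by exists (inv x) => //; rewrite gpinvK.
Qed.

Lemma supp_star f : supp (star gr f) = [set x | supp f (inv x)].
Proof. by apply/seteqP; split => x; rewrite /supp/star/= conjc_eq0. Qed.

Lemma starK f : star gr (star gr f) = f.
Proof. by apply/funext => x; rewrite /star gpinvK conjcK. Qed.

(** Only the factorization of [x] through the point [y] of the support with range [s x] counts.
    There f(x y) is nonzero only if x y = y, that is if [x] is a unit, and the term is then |f(y)|^2
    = 1. *)
Lemma conv_star f : gcar F (supp f) -> (forall x, supp f x -> normc (f x) = 1) ->
  conv f (star gr f) = \1_G0.
Proof.
move=> FB f1; have bB := full_bisection FB; apply/funext => x.
have [y By ry] := full_rng FB (units_src gr x).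
have bB' := full_bisection (full_preinv FB).
rewrite (@conv_bisection _ _ _ f (star gr f) _ x (inv y) bB'); last 3 first.
- by rewrite supp_star.
- by rewrite /= gpinvK.
- by rewrite src_inv.
rewrite gpinvK /star gpinvK.
have [Gx|nGx] := pselect (G0 x).
  rewrite indicE mem_set// mul_unitl//; last by rewrite ry src_unit.
  by rewrite -sqr_normc normcC f1// expr1n.
rewrite indicE memNset// (_ : f (x ∙ y) = 0) ?mul0r//.
apply/suppP => fxy; apply: nGx.
have e : x ∙ y = y by apply: (bisection_src bB) => //; rewrite src_mul.
have -> : x = r y by rewrite -[LHS](@gpmulKr _ gr _ y) ?ry// e gpmulV.
exact: units_rng.
Qed.

(** The inverse is the image of [star gr f], a function of the same kind, so one computation serves
    both products and both norms. *)
Lemma isometry_fun f : Cc f -> gcar F (supp f) ->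
  (forall x, supp f x -> normc (f x) = 1) -> gcar U (i f).
Proof.
move=> cf FB f1.
have cf' : Cc (star gr f) by exact: Cc_star.
have FB' : gcar F (supp (star gr f)) by rewrite supp_star; exact: full_preinv.
have f1' x : supp (star gr f) x -> normc (star gr f x) = 1.
  rewrite supp_star => /f1; have := normcJ (f (inv x)).
  by rewrite !normcC => -[<-].
have le1 g : Cc g -> gcar F (supp g) -> (forall x, supp g x -> normc (g x) = 1) ->
    nu (i g) = 1.
  move=> cg Fg g1.
  have [x Gx] := units_nonempty G_hausdorff G_ample G0_compact N_tame
    A_completion j_realization.
  have [y gy _] := full_rng Fg Gx.
  apply: (nu_fun N_tame A_completion j_realization cg (full_bisection Fg)
    (@subset_refl _ _) _ (g1 _ gy)) => z.
  have [->|gz] := eqVneq (g z) 0; first by rewrite normc0.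
  by rewrite g1.
apply/isometryP.
exists (i (star gr f)); split; try exact: le1.
  by rewrite -iM// conv_star// i_units.
by rewrite -iM// -{2}(starK f) conv_star// i_units.
Qed.

(** The support has full range, so arrows y z with [y] in the support exhaust [G]; at such arrows
    the product formula is a single term. *)
Lemma isometry_decomp u x : gcar U u ->
  exists y z, [/\ supp (j u) y, s y = r z & x = y ∙ z].
Proof.
move=> /isometry_supp[FB _ _ _]; have [y By ry] := full_rng FB (units_rng gr x).
by exists y, (inv y ∙ x); rewrite rng_ldiv// gpmulKV.
Qed.

Lemma j_mul_at u b y z : gcar U u -> supp (j u) y -> s y = r z ->
  j (u ⋅ b) (y ∙ z) = j u y * j b z.
Proof.
move=> /isometry_supp[FB _ _ _] uy yz.
rewrite (@j_mul_row _ _ _ G_hausdorff G_ample _ _ _ _ _ A_completion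
  j_realization u b (y ∙ z) y) ?gpmulKl// rng_mul// => y' ry' uy'.
exact: (bisection_rng (full_bisection FB)).
Qed.

Lemma supp_mul u v : gcar U u -> gcar U v ->
  supp (j (u ⋅ v)) = gmul F (supp (j u)) (supp (j v)).
Proof.
move=> Uu Uv; apply/seteqP; split => x.
  have [y [z [uy yz ->]]] := isometry_decomp x Uu.
  rewrite {1}/supp/= (j_mul_at _ Uu)// mulf_eq0 negb_or => /andP[_ vz].
  by exists y, z.
move=> [y [z [uy vz yz ->]]]; rewrite /supp/= (j_mul_at _ Uu)//.
by rewrite mulf_neq0.
Qed.

Lemma i_full B : gcar F B -> gcar U (i \1_B).
Proof.
move=> FB; apply: isometry_fun; rewrite ?supp_indic//; first exact: Cc_full.
by move=> x Bx; rewrite indicE mem_set// normc1.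
Qed.

Lemma j_full B : gcar F B -> j (i \1_B) = \1_B.
Proof. by move=> FB; rewrite ji//; exact: Cc_full. Qed.

Lemma supp_full B : gcar F B -> supp (j (i \1_B)) = B.
Proof. by move=> FB; rewrite j_full// supp_indic. Qed.

(** The product of the two indicators in [A] is an invertible isometry whose support is the product
    set, so openness and the bisection property come from [isometry_supp]. *)
Lemma full_mul B B' : gcar F B -> gcar F B' -> gcar F (gmul F B B').
Proof.
move=> FB FB'; have UB := i_full FB; have UB' := i_full FB'.
have [+ _ _ _] := isometry_supp (is_group_mul U_group UB UB').
by rewrite supp_mul// !supp_full.
Qed.

Lemma full_is_group : is_group F.
Proof.
split; [exact: full_mul|exact: full_units|..].
- by move=> B FB; rewrite /= full_inv; exact: full_preinv.
- move=> B1 B2 B3 F1 F2 F3; apply/seteqP; split => x /=.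
    move=> [a [_ [Ba [b [c [Bb Bc bc ->]]] + ->]]]; rewrite rng_mul// => ab.
    exists (a ∙ b), c; rewrite src_mul// gpmulA//; split => //.
    by exists a, b.
  move=> [_ [c [[a [b [Ba Bb ab ->]]] Bc + ->]]]; rewrite src_mul// => bc.
  exists a, (b ∙ c); rewrite rng_mul// gpmulA//; split => //.
  by exists b, c.
- move=> B FB; apply/seteqP; split => x /=.
    move=> [a [b [Ga Bb + ->]]]; rewrite src_unit// => ab.
    by rewrite mul_unitl.
  move=> Bx; exists (r x), x; rewrite src_rng gpmul_rng; split => //.
  exact: units_rng.
- move=> B FB; apply/seteqP; split => x /=.
    move=> [_ [b [[a Ba <-] Bb + ->]]]; rewrite src_inv => ab.
    have -> : a = b by exact: (bisection_rng (full_bisection FB)).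
    by rewrite gpmulVr; exact: units_src.
  move=> Gx; have [y By sy] := full_src FB Gx.
  exists (inv y), y; rewrite src_inv gpmulVr sy; split => //.
  by exists y.
Qed.

Lemma i_full_mul B B' : gcar F B -> gcar F B' ->
  i \1_(gmul F B B') = i \1_B ⋅ i \1_B'.
Proof.
move=> FB FB'; have UB := i_full FB; have UB' := i_full FB'.
apply: j_inj; apply/funext => x; rewrite j_full; last exact: full_mul.
have [y [z [uy yz ->]]] := isometry_decomp x UB.
rewrite (j_mul_at _ UB)// !j_full//; rewrite supp_full// in uy.
rewrite [\1_B y]indicE mem_set// mul1r !indicE.
suff -> : (y ∙ z \in gmul F B B') = (z \in B') by [].
apply/idP/idP => /set_mem h; apply: mem_set; last by exists y, z.
move: h => [a [b [Ba Bb ab e]]].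
have ay : y = a.
  apply: (bisection_rng (full_bisection FB)) => //.
  by rewrite -(rng_mul (g := gr) yz) e rng_mul.
by rewrite -(@gpmulKl _ gr y z)// e ay gpmulKl.
Qed.

(** The unit space is clopen, so extension by zero preserves continuity. *)
Lemma circleP h : gcar CT h <->
  [/\ Cc h, supp h = G0 & forall x, G0 x -> normc (h x) = 1].
Proof.
have oG := open_units G_ample.
split.
  move=> [ch h1 h0].
  have h1' x : G0 x -> normc (h x) = 1.
    by move=> /h1; rewrite normcC => /(congr1 (@complex.Re R)).
  have sh : supp h = G0.
    apply/seteqP; split => x; rewrite /supp/=.
      by move=> hx; apply: contrapT => /h0 e; rewrite e eqxx in hx.
    by move=> Gx; rewrite -normc_eq0 h1' ?oner_neq0.
  split => //; apply: (@Cc_supp _ _ G_hausdorff _ G0) => //; last by rewrite sh.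
  move=> x; have [Gx|nGx] := pselect (G0 x).
    by move: ch; rewrite continuous_open_subspace// => /(_ x); apply; rewrite inE.
  have n0 : nbhs x (~` G0).
    apply: open_nbhs_nbhs; split => //; apply: closed_openC.
    exact: compact_closed.
  apply/cvgrPdist_lt => e e0; apply: filterS n0 => y nGy.
  by rewrite !h0// subrr normr0.
move=> [[ch _] sh h1]; split.
- exact: continuous_subspaceT.
- by move=> x /h1; rewrite normcC => ->.
- by move=> x nGx; apply/suppP; rewrite sh.
Qed.

Lemma i_circle h : gcar CT h -> gcar U (i h).
Proof.
move=> /circleP[ch sh h1]; apply: isometry_fun => //.
  by rewrite sh; exact: full_units.
by rewrite sh.
Qed.

Lemma j_circle h : gcar CT h -> j (i h) = h.
Proof. by move=> /circleP[ch _ _]; exact: ji. Qed.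

Lemma supp_circle h : gcar CT h -> supp (j (i h)) = G0.
Proof. by move=> ch; rewrite j_circle//; have /circleP[] := ch. Qed.

Lemma circle_off h x : gcar CT h -> ~ G0 x -> h x = 0.
Proof. by move=> [_ _]; exact. Qed.

Lemma j_circle_mul h b x : gcar CT h -> j (i h ⋅ b) x = h (r x) * j b x.
Proof.
move=> ch; have Gr := units_rng gr x.
rewrite -[in LHS](gpmul_rng gr x) (j_mul_at _ (i_circle ch)) ?src_rng//.
  by rewrite j_circle.
by rewrite supp_circle.
Qed.

Lemma i_circle_mul h k : gcar CT h -> gcar CT k ->
  i (fun x => h x * k x) = i h ⋅ i k.
Proof.
move=> ch ck; have [cch _ _] := (circleP h).1 ch; have [cck _ _] := (circleP k).1 ck.
apply: j_inj; rewrite ji; last by apply: CcM => //; case: cck.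
apply/funext => x; rewrite j_circle_mul// j_circle//.
have [Gx|nGx] := pselect (G0 x); first by rewrite rng_unit.
by rewrite (circle_off ck)// !mulr0.
Qed.

Lemma circle_is_group : is_group CT.
Proof.
split.
- move=> h k [ch h1 h0] [ck k1 k0]; split => /=.
  + by move=> x; apply: cvgM; [exact: ch | exact: ck].
  + by move=> x Gx; rewrite normrM h1// k1// mulr1.
  + by move=> x nGx; rewrite h0// mul0r.
- apply/circleP; split; [exact: (Cc_full full_units) | exact: supp_indic|].
  by move=> x Gx; rewrite [gone _ _]indicE mem_set// normc1.
- move=> h ch; have [cch sh h1] := (circleP h).1 ch.
  (* On the circle the inverse is the conjugate, and both send 0 to 0; continuity then needs no
     division. *)
  have e : (fun x => (h x)^-1) = (fun x => (h x)^*).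
    apply/funext => x; rewrite invc_norm; have [Gx|nGx] := pselect (G0 x).
      by rewrite normcC h1// expr1n invr1 mul1r.
    by rewrite (circle_off ch)// conjc0 mulr0.
  rewrite /= e; case: ch => ch h1' h0; split => [|x Gx|x nGx].
  + apply: continuous_subspaceT => x; apply/cvgrPdist_lt => d d0.
    have /cvgrPdist_lt/(_ _ d0) := proj1 cch x.
    by apply: filterS => y; rewrite -rmorphB normcJ.
  + by rewrite normfV h1'// invr1.
  + by rewrite h0// invr0.
- by move=> *; apply/funext => x /=; rewrite mulrA.
- move=> h ch; apply/funext => x /=; rewrite indicE.
  have [Gx|nGx] := pselect (G0 x); first by rewrite mem_set// mul1r.
  by rewrite (circle_off ch)// mulr0.
- move=> h ch; apply/funext => x /=; rewrite indicE.
  have [Gx|nGx] := pselect (G0 x); last by rewrite (circle_off ch)// mulr0 memNset.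
  have [_ _ /(_ x Gx) h1] := (circleP h).1 ch.
  by rewrite mem_set// mulVf// -normc_eq0 h1 oner_neq0.
Qed.

Lemma ker_supp u : gcar U u -> supp (j u) = G0 -> gcar CT (j u) /\ i (j u) = u.
Proof.
move=> /isometry_supp[FB cu iu u1] su; split => //.
by apply/circleP; split => // x; rewrite -su; exact: u1.
Qed.

(** Every unit is r y for a unique [y] in [B], and [rho gr B] sends s y to r y. In this
    parametrization the partial inverses disappear from later computations. *)
Lemma full_actE B g y : gcar F B -> B y -> full_act gr B g (r y) = g (s y).
Proof.
move=> FB By; have bB := full_bisection FB.
have rhoE z : B z -> rho gr B (s z) = r z.
  by move=> Bz; rewrite /rho/= pinvKV ?inE//; exact: bB.2.
rewrite /full_act mem_set; last exact: units_rng.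
rewrite -(rhoE y)// pinvKV ?inE//; last exact: units_src.
move=> v w; rewrite !inE => Gv Gw.
have [y1 B1 <-] := full_src FB Gv; have [y2 B2 <-] := full_src FB Gw.
by rewrite !rhoE// => e; congr s; exact: (bisection_rng bB).
Qed.

Lemma full_act_off B g x : ~ G0 x -> full_act gr B g x = 0.
Proof. by move=> nGx; rewrite /full_act memNset. Qed.

Lemma full_act_circle B g : gcar F B -> gcar CT g -> gcar CT (full_act gr B g).
Proof.
move=> FB cg; have [ccg sg g1] := (circleP g).1 cg.
have bB := full_bisection FB; have FB' := full_preinv FB.
have eG x : G0 x -> exists2 y, B y & x = r y.
  by move=> Gx; have [y By <-] := full_rng FB Gx; exists y.
(* The action is conjugation by the indicator of [B]; written as a convolution of functions in [Cc]
   it is continuous. *)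
have e : full_act gr B g = conv (conv \1_B g) \1_[set x | B (inv x)].
  apply/funext => x; have [y By ry] := full_rng FB (units_src gr x).
  rewrite (@conv_bisection _ _ _ _ _ [set x | B (inv x)] x (inv y)); last 4 first.
  - exact: full_bisection.
  - by rewrite supp_indic.
  - by rewrite /= gpinvK.
  - by rewrite src_inv.
  rewrite gpinvK indicE mem_set; last by rewrite /= gpinvK.
  rewrite mulr1 (@conv_bisection _ _ _ _ _ G0 _ (s y)); last 4 first.
  - exact: bisection_units.
  - by rewrite sg.
  - exact: units_src.
  - by rewrite src_src src_mul.
  rewrite inv_unit; last exact: units_src.
  rewrite -[in x ∙ y ∙ _](src_mul (g := gr) (x := x) (y := y))// gpmul_src.
  have [Gx|nGx] := pselect (G0 x).
    have xr : x = r y by rewrite ry src_unit.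
    by rewrite xr full_actE// gpmul_rng indicE mem_set// mul1r.
  rewrite full_act_off// indicE memNset ?mul0r// => Bxy; apply: nGx.
  have exy : x ∙ y = y by apply: (bisection_src bB) => //; rewrite src_mul.
  have -> : x = r y by rewrite -[LHS](@gpmulKr _ gr _ y) ?ry// exy gpmulV.
  exact: units_rng.
have h1 x : G0 x -> normc (full_act gr B g x) = 1.
  by move=> /eG[y By ->]; rewrite full_actE// g1//; exact: units_src.
apply/circleP; split => //.
  by rewrite e; do ?apply: Cc_conv => //; exact: Cc_full.
apply/seteqP; split => x.
  by move=> hx; apply: contrapT => /(full_act_off B g)/suppP.
by move=> Gx; rewrite /supp/= -normc_eq0 h1 ?oner_neq0.
Qed.

(** The covariance relation of the semidirect product: both sides live on [B], with value g(s y) at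
    [y]. *)
Lemma full_act_intertwine B g : gcar F B -> gcar CT g ->
  i \1_B ⋅ i g = i (full_act gr B g) ⋅ i \1_B.
Proof.
move=> FB cg; have UB := i_full FB; have bB := full_bisection FB.
have cBg := full_act_circle FB cg.
apply: j_inj; apply/funext => x.
have [y [z [+ yz ->]]] := isometry_decomp x UB; rewrite supp_full// => By.
rewrite (j_mul_at _ UB) ?supp_full// j_circle_mul//.
rewrite rng_mul// full_actE// !j_full// j_circle// [\1_B y]indicE mem_set// mul1r.
have [Gz|nGz] := pselect (G0 z).
  have zs : z = s y by rewrite yz rng_unit.
  by rewrite zs gpmul_src indicE mem_set// mulr1.
rewrite (circle_off cg)// indicE memNset ?mulr0// => Byz; apply: nGz.
have e : y ∙ z = y by apply: (bisection_rng bB) => //; rewrite rng_mul.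
by rewrite -(@gpmulKl _ gr y z)// e gpmulVr; exact: units_src.
Qed.

Lemma full_act_aut : acts_by_automorphisms F CT (@full_act R G gr).
Proof.
have actM B B' k : gcar F B -> gcar F B' -> gcar CT k ->
    full_act gr (gmul F B B') k = full_act gr B (full_act gr B' k).
  move=> FB FB' ck; have FBB' := full_mul FB FB'.
  apply/funext => x; have [Gx|nGx] := pselect (G0 x); last by rewrite !full_act_off.
  have [_ [a [b [Ba Bb ab ->]]] <-] := full_rng FBB' Gx.
  rewrite full_actE//; last by exists a, b.
  by rewrite src_mul// rng_mul// full_actE// ab full_actE.
have act1 k : gcar CT k -> full_act gr G0 k = k.
  move=> ck; apply/funext => x; have [Gx|nGx] := pselect (G0 x).
    by rewrite -{1}(rng_unit Gx) full_actE ?src_unit//; exact: full_units.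
  by rewrite full_act_off// (circle_off ck).
split => // B FB; have FB' := is_group_inv full_is_group FB.
have eV : gmul F (ginv F B) B = G0 := is_group_mulV full_is_group FB.
have eVr : gmul F B (ginv F B) = G0 := group_mulrV full_is_group FB.
split; [split|split].
- by move=> k; exact: full_act_circle.
- move=> h k ch ck; apply/funext => x /=.
  by rewrite /full_act; case: ifP => //; rewrite mulr0.
- by move=> k; exact: full_act_circle.
- move=> h k; rewrite !inE => ch ck e.
  by rewrite -(act1 h)// -(act1 k)// -eV !actM// e.
- move=> k ck; exists (full_act gr (ginv F B) k); first exact: full_act_circle.
  by rewrite -actM// eVr act1.
Qed.

End Extension.

(** * The identity component *)

Section UnitSegment.
Variable R : realType.
Local Notation C := R[i].
Implicit Types (z w : C) (t : R).

Lemma sqr_normc_ReIm (a b : R) : normc (a +i* b) ^+ 2 = a ^+ 2 + b ^+ 2.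
Proof. by rewrite sqr_sqrtr// addr_ge0// sqr_ge0. Qed.

Lemma le_normc c z : 0 <= c -> (c <= normc z) = (c ^+ 2 <= normc z ^+ 2).
Proof. by move=> c0; rewrite ler_sqr ?nnegrE ?normc_ge0. Qed.

(** The hypothesis says that 2 Re(z w') >= -1 for the conjugate w' of w, so the squared modulus is
    at least 1 - 3 t (1 - t), and t (1 - t) <= 1/4 leaves 1/4. *)
Lemma segment_normc_ge z w t : normc z = 1 -> normc w = 1 -> 1 <= normc (z + w) ->
  0 <= t <= 1 -> 2^-1 <= normc ((1 - t)%:C * w + t%:C * z).
Proof.
move=> z1 w1 zw /andP[t0 t1].
have : normc z ^+ 2 = 1 by rewrite z1 expr1n.
have : normc w ^+ 2 = 1 by rewrite w1 expr1n.
move: zw; rewrite !le_normc ?invr_ge0//.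
case: z {z1} => a b; case: w {w1} => c d.
rewrite (_ : (a +i* b) + (c +i* d) = (a + c) +i* (b + d))//.
rewrite (_ : (1 - t)%:C * (c +i* d) + t%:C * (a +i* b) =
  ((1 - t) * c + t * a) +i* ((1 - t) * d + t * b)); last first.
  by simpc; congr (_ +i* _); ring.
rewrite !sqr_normc_ReIm => h1 h2 h3.
have p : -1 <= 2 * (a * c + b * d).
  have -> : 2 * (a * c + b * d) = (a + c) ^+ 2 + (b + d) ^+ 2
    - (a ^+ 2 + b ^+ 2) - (c ^+ 2 + d ^+ 2) by ring.
  by rewrite h2 h3; lra.
have -> : ((1 - t) * c + t * a) ^+ 2 + ((1 - t) * d + t * b) ^+ 2 =
  (1 - t) ^+ 2 * (c ^+ 2 + d ^+ 2) + t ^+ 2 * (a ^+ 2 + b ^+ 2)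
  + t * (1 - t) * (2 * (a * c + b * d)) by ring.
rewrite h2 h3.
have tt : 0 <= t * (1 - t) by rewrite mulr_ge0// subr_ge0.
have := ler_wpM2l tt p; have := sqr_ge0 (t - 2^-1).
by move: (2 * _) => e; nra.
Qed.

(** Over the common denominator |w| the numerator is at most |z - w| plus the difference of the
    moduli, so 2 |z - w|; dividing by |w| >= 1/2 doubles it. *)
Lemma unit_dist z w : 2^-1 <= normc z -> 2^-1 <= normc w ->
  normc (z / (normc z)%:C - w / (normc w)%:C) <= 4 * normc (z - w).
Proof.
move=> z2 w2; have z0 : 0 < normc z by apply: lt_le_trans z2.
have w0 : 0 < normc w by apply: lt_le_trans w2.
have z0' : (normc z)%:C != 0 :> C by rewrite eq_complex /= eqxx andbT gt_eqF.
have w0' : (normc w)%:C != 0 :> C by rewrite eq_complex /= eqxx andbT gt_eqF.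
have -> : z / (normc z)%:C - w / (normc w)%:C =
  ((z - w) + z / (normc z)%:C * (normc w - normc z)%:C) / (normc w)%:C.
  rewrite rmorphB/=; field.
  by rewrite w0' z0'.
rewrite normcM normcV normc_real (ger0_norm (ltW w0)) ler_pdivrMr//.
apply: le_trans (le_normcD _ _) _.
rewrite !normcM normcV !normc_real (ger0_norm (ltW z0)) mulfV ?gt_eqF// mul1r.
have := normc_distr w z; rewrite -[normc (w - z)]normcN opprB => h.
apply: (@le_trans _ _ (2 * normc (z - w))).
  by rewrite mulr_natl mulr2n lerD2l.
have := normc_ge0 (z - w); nra.
Qed.

Lemma cvg_Re T (F : set_system T) (f : T -> C) z : Filter F ->
  (f t : C^o) @[t --> F] --> (z : C^o) ->
  complex.Re (f t) @[t --> F] --> complex.Re z.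
Proof.
move=> FF /cvgrPdist_lt fz; apply/cvgrPdist_lt => e e0.
have e0' : 0 < e%:C by rewrite ltcR.
apply: filterS (fz _ e0') => t; rewrite normcC ltcR => h.
by apply: le_lt_trans h; rewrite -raddfB; exact: normc_Re.
Qed.

End UnitSegment.

(** * The kernel of the support map is connected, and open and closed among the isometries *)

Section Component.
Variables (R : realType) (G : topologicalType) (gr : groupoid G).
Hypotheses (G_hausdorff : hausdorff_space G) (G_ample : ample gr).
Hypothesis G0_compact : compact (units gr).
Variables (q : R) (N : (G -> R[i]) -> \bar R).
Hypothesis N_tame : tame_norm gr q N.
Variables (A : completeNormedModType R[i]) (alg : banach_algebra A).
Variables (i : (G -> R[i]) -> A) (j : A -> G -> R[i]).
Hypotheses (A_completion : is_completion gr N alg i).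
Hypothesis (j_realization : is_realization i j).
Local Notation C := R[i].
Local Notation s := (src gr).
Local Notation r := (rng gr).
Local Notation "x ∙ y" := (gpmul gr x y) (at level 40, left associativity).
Local Notation inv := (gpinv gr).
Local Notation conv := (convolution gr).
Local Notation "a ⋅ b" := (bmul alg a b) (at level 40, left associativity).
Local Notation G0 := (units gr).
Local Notation U := (isometry_group alg).
Local Notation F := (full_group gr).
Local Notation CT := (circle_group R gr).
Local Notation ji := (ji j_realization).
Local Notation iM := (iM A_completion).
Local Notation i_units := (i_units G_hausdorff G_ample G0_compact A_completion).
Local Notation j_one := (j_one G_hausdorff G_ample G0_compact A_completion j_realization).
Local Notation j_inj := (j_inj G_hausdorff N_tame A_completion j_realization).
Implicit Types (f g h : G -> C) (a b u v : A) (B : set G).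


Lemma segment_circle h k t : gcar CT h -> gcar CT k ->
  (forall x, G0 x -> 1 <= normc (h x + k x)) -> 0 <= t <= 1 ->
  gcar CT (fun x => ((1 - t)%:C * k x + t%:C * h x) /
                    (normc ((1 - t)%:C * k x + t%:C * h x))%:C).
Proof.
move=> ch ck hk t01.
have [cch sh h1] := (circleP G_hausdorff G_ample G0_compact h).1 ch.
have [cck sk k1] := (circleP G_hausdorff G_ample G0_compact k).1 ck.
pose w x := (1 - t)%:C * k x + t%:C * h x.
have w2 x : G0 x -> 2^-1 <= normc (w x).
  by move=> Gx; apply: segment_normc_ge => //; [exact: h1|exact: k1|exact: hk].
have w0 x : ~ G0 x -> w x = 0.
  by move=> nGx; rewrite /w (circle_off ch)// (circle_off ck)// !mulr0 addr0.
have cw : continuous (w : G -> C^o).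
  move=> x; apply: cvgD; apply: cvgM; try exact: cvg_cst.
    exact: (proj1 cck).
  exact: (proj1 cch).
have f1 x : G0 x -> normc (w x / (normc (w x))%:C) = 1.
  move=> Gx; have wx : 0 < normc (w x) by apply: lt_le_trans (w2 x Gx); rewrite invr_gt0.
  by rewrite normcM normcV normc_real ger0_norm ?normc_ge0// mulfV// gt_eqF.
have f0 x : ~ G0 x -> w x / (normc (w x))%:C = 0.
  by move=> nGx; rewrite w0// mul0r.
change (gcar CT (fun x => w x / (normc (w x))%:C)).
split; [| by move=> x Gx; rewrite normcC f1 | exact: f0].
apply: (@continuous_subspaceT _ _ _ (fun x => w x / (normc (w x))%:C : C^o)) => x.
have [Gx|nGx] := pselect (G0 x); last first.
  have n0 : nbhs x (~` G0).
    apply: open_nbhs_nbhs; split => //; apply: closed_openC.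
    exact: compact_closed.
  by apply/cvgrPdist_lt => e e0; apply: filterS n0 => y nGy; rewrite !f0// subrr normr0.
apply: cvgM; first exact: cw.
have wx : 0 < normc (w x) by apply: lt_le_trans (w2 x Gx); rewrite invr_gt0.
apply: cvgV; first by rewrite -normcC normr_eq0 -normc_eq0 gt_eqF.
rewrite -normcC; under eq_fun do rewrite -normcC.
by apply: (@cvg_norm _ C^o); exact: cw.
Qed.

(* [h] and [k] are never closer than 60 degrees to being antipodal, so the
   normalized segment between them is a path, Lipschitz in the sup norm. *)
Lemma circle_step h k : gcar CT h -> gcar CT k ->
  (forall x, G0 x -> 1 <= normc (h x + k x)) ->
  exists D : set A, [/\ connected D, D `<=` i @` gcar CT, D (i h) & D (i k)].
Proof.
move=> ch ck hk.
have [cch sh h1] := (circleP G_hausdorff G_ample G0_compact h).1 ch.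
have [cck sk k1] := (circleP G_hausdorff G_ample G0_compact k).1 ck.
pose w t x := (1 - t)%:C * k x + t%:C * h x.
pose phi t x := w t x / (normc (w t x))%:C.
have phiC t : 0 <= t <= 1 -> gcar CT (phi t) by move=> t01; exact: segment_circle.
have phi0 : phi 0 = k.
  apply/funext => x; rewrite /phi /w subr0 mul1r mul0r addr0.
  have [Gx|nGx] := pselect (G0 x); first by rewrite k1// divr1.
  by rewrite (circle_off ck)// mul0r.
have phi1 : phi 1 = h.
  apply/funext => x; rewrite /phi /w subrr mul0r mul1r add0r.
  have [Gx|nGx] := pselect (G0 x); first by rewrite h1// divr1.
  by rewrite (circle_off ch)// mul0r.
(* On functions supported in the unit space the norm of [A] is bounded by the supremum norm. The
   constant 8 is the Lipschitz constant 4 of normalization times the bound 2 for |h - k|. *)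
have lip t t' : 0 <= t <= 1 -> 0 <= t' <= 1 -> nu (i (phi t) - i (phi t')) <= 8 * `|t - t'|.
  move=> t01 t01'.
  have [cc sc _] := (circleP G_hausdorff G_ample G0_compact _).1 (phiC t t01).
  have [cc' sc' _] := (circleP G_hausdorff G_ample G0_compact _).1 (phiC t' t01').
  rewrite -(iB A_completion)//.
  apply: (@nu_le _ _ _ _ _ N_tame _ _ _ A_completion _ G0).
  - by rewrite mulr_ge0.
  - exact: CcB.
  - exact: bisection_units.
  - move=> x; apply: contraPP => nGx; apply/suppP.
    by rewrite (circle_off (phiC _ t01))// (circle_off (phiC _ t01'))// subrr.
  move=> x; have [Gx|nGx] := pselect (G0 x); last first.
    rewrite (circle_off (phiC _ t01))// (circle_off (phiC _ t01'))// subrr normc0.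
    by rewrite mulr_ge0.
  apply: le_trans (unit_dist _ _) _.
  - by apply: segment_normc_ge => //; [exact: h1|exact: k1|exact: hk].
  - by apply: segment_normc_ge => //; [exact: h1|exact: k1|exact: hk].
  have -> : w t x - w t' x = (t - t')%:C * (h x - k x).
    by rewrite /w !rmorphB/=; ring.
  rewrite normcM normc_real.
  have : normc (h x - k x) <= 2.
    by apply: le_trans (le_normcD _ _) _; rewrite normcN h1// k1.
  have := normr_ge0 (t - t'); have := normc_ge0 (h x - k x); nra.
exists ((fun t => i (phi t)) @` `[0, 1]); split.
- apply: connected_continuous_connected; first exact: segment_connected.
  apply/subspace_continuousP => t; rewrite /= in_itv/= => t01.
  apply/cvgrPdist_lt => e e0.
  have eR : e = (complex.Re e)%:C by rewrite RRe_real// gtr0_real.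
  have e0' : 0 < complex.Re e by rewrite -ltcR -eR.
  have e8 : 0 < complex.Re e / 8 by rewrite divr_gt0.
  have nb : nbhs t (ball t (complex.Re e / 8)) by exact: nbhsx_ballx.
  rewrite near_withinE; apply: filterS nb => t' tt' t01'.
  rewrite nuE eR ltcR; apply: le_lt_trans (lip _ _ t01 _) _.
    by move: t01'; rewrite /= in_itv.
  by rewrite mulrC -ltr_pdivlMr.
- by move=> _ [t + <-]; rewrite /= in_itv/= => t01; exists (phi t) => //; exact: phiC.
- by exists 1; rewrite ?phi1//= in_itv/= ler01 lexx.
- by exists 0; rewrite ?phi0//= in_itv/= ler01 lexx.
Qed.

Lemma circle_indic (c : C) (Q : set G) : normc c = 1 -> open Q -> compact Q ->
  Q `<=` G0 -> gcar CT (fun x => (c - 1) * \1_Q x + \1_G0 x).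
Proof.
move=> c1 oQ cQ QG; have oG := open_units G_ample.
have val x : G0 x -> normc ((c - 1) * \1_Q x + \1_G0 x) = 1.
  move=> Gx; rewrite !indicE [x \in G0]mem_set// mulr1n.
  by case: (x \in Q); rewrite ?mulr1 ?subrK// mulr0 add0r normc1.
apply/circleP => //; split => //.
  have cQ1 : Cc (\1_Q : G -> C) by exact: Cc_indic.
  have cG1 : Cc (\1_G0 : G -> C) by exact: Cc_indic.
  exact: (CcL G_hausdorff (c - 1) cQ1 cG1).
apply/seteqP; split => x; rewrite /supp/=.
  apply: contraPP => nGx; rewrite !indicE !memNset ?mulr0 ?addr0 ?eqxx//.
  by move=> /QG.
by move=> Gx; rewrite -normc_eq0 val ?oner_neq0.
Qed.

Lemma circle_component :
  i @` gcar CT `<=` connected_component (i @` gcar CT) (bone alg).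
Proof.
have oG := open_units G_ample.
have one_CT : gcar CT \1_G0.
  exact: (is_group_one (circle_is_group R G_hausdorff G_ample G0_compact)).
have step h k : gcar CT h -> gcar CT k ->
    (forall x, G0 x -> 1 <= normc (h x + k x)) ->
    connected_component (i @` gcar CT) (bone alg) (i k) ->
    connected_component (i @` gcar CT) (bone alg) (i h).
  move=> ch ck hk; have [D [cD DU Dh Dk]] := circle_step ch ck hk.
  move=> /connected_component_trans; apply.
  exact: (@connected_component_max _ _ D).
move=> _ [h ch <-].
have [cch sh h1] := (circleP G_hausdorff G_ample G0_compact h).1 ch.
have cRe : continuous (fun x => complex.Re (h x)).
  by move=> x; apply: cvg_Re; exact: (proj1 cch).
(* For |h| = 1, |h - 1|^2 = 2 - 2 Re h and |h + 1|^2 = 2 + 2 Re h. The first is at least 1 on [Q]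
   since Re h < 1/2 there, the second off [Q] since Re h > 0 there. *)
have [Q [cQ oQ KQ QO]] : exists Q : set G, [/\ compact Q, open Q,
    G0 `&` [set x | complex.Re (h x) <= 0] `<=` Q &
    Q `<=` G0 `&` [set x | complex.Re (h x) < 2^-1]].
  apply: (compact_open_between G_ample).
  - apply: compact_closedI => //.
    by apply: (@preimage_closed _ _ (fun x => complex.Re (h x)) [set y | y <= 0]);
      [move=> x _; exact: cRe | exact: closed_le].
  - apply: openI => //.
    by apply: (@open_comp _ _ (fun x => complex.Re (h x)) [set y | y < 2^-1]);
      [move=> x _; exact: cRe | exact: open_lt].
  - move=> x [Gx hx]; split => //=; apply: le_lt_trans hx _.
    by rewrite invr_gt0.
have QG : Q `<=` G0 by move=> x /QO[].
(* [k c] is [c] on [Q] and 1 elsewhere; the path goes through [k (-1)] and [k 'i]. *)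
pose k (c : C) x := (c - 1) * \1_Q x + \1_G0 x.
have ck c : normc c = 1 -> gcar CT (k c) by move=> c1; exact: circle_indic.
have kE c x : G0 x -> k c x = if x \in Q then c else 1.
  move=> Gx; rewrite /k !indicE [x \in G0]mem_set// mulr1n.
  by case: (x \in Q); rewrite ?mulr1 ?subrK// mulr0 add0r.
have N1 : normc (-1 : C) = 1 by rewrite normcN normc1.
have I1 : normc ('i : C) = 1 by rewrite /= expr0n expr1n add0r sqrtr1.
have two : 1 <= normc (1 + 1 : C).
  by rewrite (_ : 1 + 1 = 2%:C) ?normc_real ?ger0_norm ?ler1n// rmorph_nat.
apply: (step _ (k (-1))) => //; first exact: ck.
  move=> x Gx; have := h1 x Gx.
  move=> /(congr1 (fun y => y ^+ 2)); rewrite expr1n le_normc// expr1n.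
  have [xQ|xQ] := boolP (x \in Q).
    rewrite (_ : k (-1) x = -1); last by rewrite kE// xQ.
    have [_ /= hx] := QO _ (set_mem xQ).
    case: (h x) hx => a b hx; rewrite /= in hx.
    rewrite (_ : (a +i* b) + -1 = (a - 1) +i* b); last by simpc.
    rewrite !sqr_normc_ReIm => e.
    have -> : (a - 1) ^+ 2 + b ^+ 2 = a ^+ 2 + b ^+ 2 - 2 * a + 1 by ring.
    by rewrite e; lra.
  rewrite (_ : k (-1) x = 1); last by rewrite kE// (negbTE xQ).
  have hx : 0 < complex.Re (h x).
    rewrite ltNge; apply: contra xQ => hx.
    by apply: mem_set; apply: KQ.
  case: (h x) hx => a b hx; rewrite /= in hx.
  rewrite (_ : (a +i* b) + 1 = (a + 1) +i* b); last by simpc.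
  rewrite !sqr_normc_ReIm => e.
  have -> : (a + 1) ^+ 2 + b ^+ 2 = a ^+ 2 + b ^+ 2 + 2 * a + 1 by ring.
  by rewrite e; lra.
have i1 (c : R) : c ^+ 2 = 1 -> 1 <= normc (c +i* 1).
  by move=> c1; rewrite le_normc// sqr_normc_ReIm c1 expr1n; lra.
(* The points -1 and 1 are antipodal, hence the detour: -1 + 'i and 'i + 1 both have modulus sqrt
   2. *)
apply: (step _ (k 'i)); try exact: ck.
  move=> x Gx; rewrite !kE//; case: (x \in Q) => //.
  rewrite (_ : -1 + 'i = (-1) +i* 1); last by simpc.
  by apply: i1; rewrite sqrrN expr1n.
apply: (step _ \1_G0) => //; first exact: ck.
  move=> x Gx; rewrite kE// indicE [x \in G0]mem_set//; case: (x \in Q) => //.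
  rewrite [X in normc X](_ : _ = 1 +i* 1 :> C); last first.
    by change ('i + 1 = 1 +i* 1 :> C); simpc.
  by apply: i1; rewrite expr1n.
rewrite i_units.
apply: (@connected_component_refl); exists \1_G0 => //.
exact: i_units.
Qed.

(** At a point of the support of [j u] outside that of [j v] the difference has modulus 1, which
    contractivity of [j] forbids. *)
Lemma supp_close u v : gcar U u -> gcar U v -> nu (u - v) < 1 ->
  supp (j u) `<=` supp (j v).
Proof.
move=> Uu Uv uv x ux.
have [_ _ _ u1] := isometry_supp G_hausdorff G_ample G0_compact N_tame
  A_completion j_realization Uu.
rewrite /supp/=; apply/negP => /eqP vx.
have := j_le j_realization (u - v) x.
by rewrite (jB j_realization) vx subr0 u1// leNgt uv.
Qed.

Lemma identity_component :
  connected_component (gcar U) (bone alg) = i @` gcar CT.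
Proof.
have one_CT : gcar CT \1_G0.
  exact: (is_group_one (circle_is_group R G_hausdorff G_ample G0_compact)).
have CT_U : i @` gcar CT `<=` gcar U.
  by move=> _ [h ch <-]; exact: (i_circle G_hausdorff G_ample G0_compact N_tame
    A_completion j_realization).
have oneC : (i @` gcar CT) (bone alg) by exists \1_G0 => //; exact: i_units.
apply/seteqP; split; last first.
  move=> u Cu; have := circle_component Cu; case=> D [D1 DC cD] Du.
  by exists D => //; split => //; exact: subset_trans CT_U.
move=> u [D [D1 DU cD] Du].
(* Unit balls around the kernel and around its complement in the isometries cut the connected set
   [D] into two disjoint relatively open parts, since isometries at distance less than 1 have the
   same support. *)
pose ball1 (S : set A) := \bigcup_(v in S) (ball v (1 : C)).
have ob S : open (ball1 S) by apply: bigcup_open => v _; exact: ball_open.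
have ballE v w : gcar U v -> gcar U w -> ball v (1 : C) w -> supp (j v) = supp (j w).
  move=> Uv Uw; rewrite -ball_normE/= nuE -[1]/(1%:C) ltcR => h.
  by apply/seteqP; split; apply: supp_close; rewrite // nuB.
have ballx v : ball v (1 : C) v by apply: ballxx.
have kerP v : gcar U v -> supp (j v) = G0 -> (i @` gcar CT) v.
  move=> Uv sv; have [cv iv] := ker_supp G_hausdorff G_ample G0_compact N_tame
    A_completion j_realization Uv sv.
  by exists (j v).
have kerS v : (i @` gcar CT) v -> supp (j v) = G0.
  by move=> [h ch <-]; exact: (supp_circle G_hausdorff G_ample G0_compact
    j_realization).
have eD : D `&` i @` gcar CT = D.
  apply: cD.
  - by exists (bone alg).
  - exists (ball1 (i @` gcar CT)); first exact: ob.
    apply/seteqP; split => [v [Dv Cv]|v [Dv [w Cw wv]]].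
      by split => //; exists v.
    split => //; apply: kerP; first exact: DU.
    by rewrite -(ballE w v (CT_U _ Cw) (DU _ Dv) wv); exact: kerS.
  - exists (~` ball1 (gcar U `\` i @` gcar CT)); first by apply: open_closedC; exact: ob.
    apply/seteqP; split => [v [Dv Cv]|v [Dv nv]].
      split => // -[w [Uw nCw] wv]; apply: nCw; apply: kerP => //.
      by rewrite (ballE w v Uw (DU _ Dv) wv); exact: kerS.
    split => //; apply: contrapT => nCv; apply: nv.
    by exists v => //; split => //; exact: DU.
by move: Du; rewrite -{1}eD => -[].
Qed.

End Component.

Theorem theoremA (R : realType) (G : topologicalType) (gr : groupoid G)
    (G_hausdorff : hausdorff_space G) (G_ample : ample gr)
    (G0_compact : compact (units gr))
    (p : R) (p_ge1 : 1 <= p) (p_neq2 : p != 2)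
    (N : (G -> R[i]) -> \bar R)
    (N_def : [\/ N = normI gr, N = normFs gr p | N = normF gr p])
    (A : completeNormedModType R[i]) (alg : banach_algebra A)
    (i : (G -> R[i]) -> A) (A_completion : is_completion gr N alg i)
    (j : A -> G -> R[i]) (j_realization : is_realization i j) :
  let CT := circle_group R gr in
  let U := isometry_group alg in
  let F := full_group gr in
  let U0 := connected_component (gcar U) (bone alg) in
  [/\ [/\ is_group CT, is_group U & is_group F],
      U0 = i @` gcar CT,
      split_exact CT U F i (fun a => supp (j a)),
      [/\ acts_by_automorphisms F CT (@full_act R G gr),
          is_group (semidirect CT F (@full_act R G gr)) &
          is_iso (semidirect CT F (@full_act R G gr)) U
            (fun gB => bmul alg (i gB.1) (i \1_(gB.2)))] &
      is_group (quotient_group U U0) /\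
      is_iso F (quotient_group U U0) (fun B => lcoset U U0 (i \1_B))].
Proof.
move=> CT U F U0.
(* For the I-norm the exponent is 1, whatever [p] is. *)
have [q N_tame] : exists q, tame_norm gr q N.
  by case: N_def => ->; [exists 1; exact: normI_tame | exists p; exact: normFs_tame
    | exists p; exact: normF_tame].
have CT_group : is_group CT by exact: circle_is_group.
have U_group : is_group U.
  exact: (isometry_is_group G_hausdorff G_ample G0_compact N_tame A_completion
    j_realization).
have F_group : is_group F.
  exact: (full_is_group G_hausdorff G_ample G0_compact N_tame A_completion
    j_realization).
have i_CT h : gcar CT h -> gcar U (i h).
  exact: (i_circle G_hausdorff G_ample G0_compact N_tame A_completion
    j_realization).
have i_F B : gcar F B -> gcar U (i \1_B).
  exact: (i_full G_hausdorff G_ample G0_compact N_tame A_completion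
    j_realization).
have supp_F B : gcar F B -> supp (j (i \1_B)) = B.
  exact: (supp_full G_hausdorff G_ample G0_compact j_realization).
have supp_CT h : gcar CT h -> supp (j (i h)) = units gr.
  exact: (supp_circle G_hausdorff G_ample G0_compact j_realization).
have j_CT h : gcar CT h -> j (i h) = h.
  exact: (j_circle G_hausdorff G_ample G0_compact j_realization).
have ker_supp u : gcar U u -> supp (j u) = units gr -> gcar CT (j u) /\ i (j u) = u.
  exact: (ker_supp G_hausdorff G_ample G0_compact N_tame A_completion
    j_realization).
have i_hom : is_hom CT U i.
  split=> // h k ch ck.
  exact: (i_circle_mul G_hausdorff G_ample G0_compact N_tame A_completion
    j_realization ch ck).
have s_hom : is_hom U F (fun a => supp (j a)).
  split=> [u Uu|u v Uu Uv].
    by have [] := isometry_supp G_hausdorff G_ample G0_compact N_tame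
      A_completion j_realization Uu.
  exact: (supp_mul G_hausdorff G_ample G0_compact N_tame A_completion
    j_realization Uu Uv).
have t_hom : is_hom F U (fun B => i \1_B).
  split=> // B B' FB FB'.
  exact: (i_full_mul G_hausdorff G_ample G0_compact N_tame A_completion
    j_realization FB FB').
have i_inj : {in gcar CT &, injective i}.
  by move=> h k; rewrite !inE => ch ck e; rewrite -(j_CT h)// e j_CT.
have kerE : i @` gcar CT = [set e | gcar U e /\ supp (j e) = gone F].
  apply/seteqP; split => [_ [h ch <-]|u [Uu su]].
    by split; [exact: i_CT | exact: supp_CT].
  by have [cu iu] := ker_supp u Uu su; exists (j u).
have act_aut : acts_by_automorphisms F CT (@full_act R G gr).
  exact: (full_act_aut G_hausdorff G_ample G0_compact N_tame A_completion
    j_realization).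
have U0E : U0 = i @` gcar CT.
  exact: (identity_component G_hausdorff G_ample G0_compact N_tame A_completion
    j_realization).
split => //.
- split => //.
    by move=> B FB; exists (i \1_B); [exact: i_F | exact: supp_F].
  by exists (fun B => i \1_B).
- have mulU := is_group_mul U_group.
  split => //; first exact: semidirect_is_group.
  split; [split|split].
  + by move=> [h B] [/= ch FB]; apply: mulU; [exact: i_CT | exact: i_F].
  + move=> [h B] [k B'] [/= ch FB] [/= ck FB'] /=.
    have ca : gcar CT (full_act gr B k) by exact: (act_car act_aut FB ck).
    rewrite (t_hom.2 _ _ FB FB') (i_hom.2 _ _ ch ca).
    rewrite -!bmulA; congr (bmul alg _ _); rewrite !bmulA; congr (bmul alg _ _).
    exact/esym/(full_act_intertwine G_hausdorff G_ample G0_compact N_tame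
      A_completion j_realization).
  + by move=> [h B] [/= ch FB]; apply: mulU; [exact: i_CT | exact: i_F].
  + move=> [h B] [k B']; rewrite !inE => -[/= ch FB] [/= ck FB'] e.
    (* Uniqueness of the decomposition: the circle-valued factor has the unit space as support, so
       the support of the product recovers the bisection. *)
    have BE h' C : gcar CT h' -> gcar F C ->
        supp (j (bmul alg (i h') (i \1_C))) = C.
      move=> ch' FC; rewrite (s_hom.2 _ _ (i_CT _ ch') (i_F _ FC)).
      by rewrite supp_CT// supp_F// (is_group_mul1 F_group).
    have BB' : B = B' by rewrite -(BE h B)// e BE.
    congr pair => //; apply: i_inj; rewrite ?inE//; subst B'.
    exact: (group_cancel_r U_group (i_F _ FB) (i_CT _ ch) (i_CT _ ck)).
  (* Existence of the decomposition: dividing [u] by the indicator of its support leaves an element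
     of the kernel. *)
  + move=> u Uu /=.
    have FB := s_hom.1 _ Uu; have UB := i_F _ FB.
    have UBi := is_group_inv U_group UB.
    have Uv := mulU _ _ Uu UBi.
    have sv : supp (j (gmul U u (ginv U (i \1_(supp (j u)))))) = units gr.
      rewrite (s_hom.2 _ _ Uu UBi) (hom_inv U_group F_group s_hom UB).
      by rewrite supp_F// (group_mulrV F_group).
    have [cv iv] := ker_supp _ Uv sv.
    exists (j (gmul U u (ginv U (i \1_(supp (j u))))), supp (j u)) => //=.
    by rewrite iv; exact: (group_mulVKr U_group UB Uu).
(* The component is the kernel of the support map, which the indicators split, so the quotient is
   the image. *)
- rewrite U0E kerE; split.
    exact: (quotient_is_group U_group F_group s_hom t_hom supp_F).
  exact: (quotient_iso U_group F_group s_hom t_hom supp_F).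
Qed.
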